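(* For every directed graph $G=(V,E,\ell)$ with $n$ nodes, $m$ edges and positive edge lengths bounded by $\mathrm{poly}(n)$, and every $D\ge1$, there exists a directed low-diameter decomposition with loss $O(\log n\log\log n)$ whose support has size $O(D\log n)$, and it can be computed (i.e., its full support, as a uniform distribution over a list of $O(D\log n)$ edge sets, can be output) by a deterministic algorithm in time $\widetilde O(m\,\mathrm{poly}(D))$.
   Context: A directed low-diameter decomposition (LDD) with loss $L$ for a directed edge-weighted graph $G=(V,E,\ell)$ and a parameter $D\ge 1$ is a probability distribution over edge sets $S\subseteq E$ such that: (1) any two nodes $u,v$ in the same strongly connected component of $G\setminus S$ satisfy $d_G(u,v)\le D$ and $d_G(v,u)\le D$, where $d_G$ is shortest-path distance in the original graph $G$; (2) for every edge $e$, $\Pr(e\in S)\le\frac{\ell(e)}{D}\cdot L$. $\widetilde O(\cdot)$ hides polylogarithmic factors in $n$. Standing assumption: edge lengths are positive and bounded by a polynomial in $n$.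
   Formalization: Edge lengths are taken to be positive integers: for arbitrary positive reals the claim fails (an n-cycle with lengths n^(-1/2), D=1, and only O(log n) edge sets); real lengths at least 1 reduce to integers by rounding up. *)

(* Defs.v *)
From HB Require Import structures.
From mathcomp Require Import all_boot all_order all_algebra.
From mathcomp Require Import all_classical all_reals all_analysis.

Set Implicit Arguments.
Unset Strict Implicit.
Unset Printing Implicit Defensive.

Import Order.TTheory GRing.Theory Num.Theory.

Local Open Scope ring_scope.

(* Simple directed graphs (self-loops allowed) with positive integer lengths.
   The values of [len] outside [edges] are irrelevant. *)
Record digraph (V : finType) := Digraph {
  edges : {set V * V};
  len : V * V -> nat;
  len_gt0 : forall e, e \in edges -> (0 < len e)%N }.

Section Graph.
Context {V : finType}.

Definition edge_rel (F : {set V * V}) : rel V := fun u v => (u, v) \in F.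

Definition same_scc (F : {set V * V}) (u v : V) : bool :=
  connect (edge_rel F) u v && connect (edge_rel F) v u.

Definition walk_len (G : digraph V) (u : V) (p : seq V) : nat :=
  (\sum_(e <- zip (u :: p) p) len G e)%N.

(* The distance is +oo when v is not reachable from u. *)
Definition dist (R : realType) (G : digraph V) (u v : V) : \bar R :=
  ereal_inf [set ((walk_len G u p)%:R)%:E | p in
    [set p | path (edge_rel (edges G)) u p /\ last u p = v]%classic]%classic.

Definition is_distr (R : realType) (T : finType) (mu : T -> R) : Prop :=
  (forall x, 0 <= mu x) /\ \sum_x mu x = 1.

Definition supp (R : realType) (T : finType) (mu : T -> R) : pred T :=
  fun x => mu x != 0.

Definition is_LDD (R : realType) (G : digraph V) (D L : R)
    (mu : {set V * V} -> R) : Prop :=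
  [/\ is_distr mu,
      forall S, S \in supp mu -> S \subset edges G,
      forall S, S \in supp mu -> forall u v, same_scc (edges G :\: S) u v ->
        (dist R G u v <= D%:E)%E /\ (dist R G v u <= D%:E)%E
    & forall e, e \in edges G ->
        \sum_(S : {set V * V} | e \in S) mu S <= (len G e)%:R / D * L].

(* The distribution of a uniformly random position of a list, so entries are
   counted with multiplicity. *)
Definition uniform_on (R : realType) (T : finType) (s : seq T) : T -> R :=
  fun x => (count_mem x s)%:R / (size s)%:R.

End Graph.

(* Logarithms truncated below at 1, so that O-bounds make sense for all n. *)
Definition log (R : realType) (n : nat) : R := Num.max 1 (ln n%:R).
Definition loglog (R : realType) (n : nat) : R := Num.max 1 (ln (log R n)).

(* A deterministic random access machine under the logarithmic cost criterion,
   presented as a structured language. The memory consists of zero-initialised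
   unbounded arrays of natural numbers; a program refers to arrays by constant
   names only, so it uses finitely many of them, which can be interleaved in a
   single memory. *)
Inductive binop := Add | Sub | Mul | Div.

Inductive expr :=
  | Cst of nat
  | Get of nat & expr          (* Get a i: the entry at index i of array a *)
  | Bin of binop & expr & expr.

Inductive cmd :=
  | Skip
  | Put of nat & expr & expr   (* Put a i x: store x at index i of array a *)
  | Seq of cmd & cmd
  | If of expr & cmd & cmd
  | While of expr & cmd.

Definition memory := nat -> nat -> nat.

Definition update (M : memory) (a i x : nat) : memory :=
  fun b j => if (b == a) && (j == i) then x else M b j.

Definition bits (x : nat) : nat := (trunc_log 2 x).+1.

(* Subtraction is truncated and division by zero yields zero. *)
Definition op_val (o : binop) (x y : nat) : nat :=
  match o with
  | Add => x + y | Sub => x - y | Mul => x * y | Div => x %/ y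
  end%N.

Fixpoint expr_val (M : memory) (e : expr) : nat :=
  match e with
  | Cst c => c
  | Get a i => M a (expr_val M i)
  | Bin o x y => op_val o (expr_val M x) (expr_val M y)
  end.

Fixpoint expr_cost (M : memory) (e : expr) : nat :=
  match e with
  | Cst c => bits c
  | Get a i => expr_cost M i + bits (expr_val M i) + bits (expr_val M e)
  | Bin o x y =>
      expr_cost M x + expr_cost M y + bits (expr_val M x) + bits (expr_val M y)
  end%N.

(* [exec c M t M']: run from memory M, the program c halts with memory M'
   after time t. *)
Inductive exec : cmd -> memory -> nat -> memory -> Prop :=
  | exec_Skip M : exec Skip M 1 M
  | exec_Put M a i x :
      exec (Put a i x) M
        (expr_cost M i + expr_cost M x
          + bits (expr_val M i) + bits (expr_val M x))%N
        (update M a (expr_val M i) (expr_val M x))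
  | exec_Seq M1 M2 M3 c1 c2 t1 t2 :
      exec c1 M1 t1 M2 -> exec c2 M2 t2 M3 ->
      exec (Seq c1 c2) M1 (t1 + t2)%N M3
  | exec_If M M' e c1 c2 t :
      exec (if expr_val M e != 0%N then c1 else c2) M t M' ->
      exec (If e c1 c2) M (expr_cost M e + bits (expr_val M e) + t)%N M'
  | exec_While_stop M e c :
      expr_val M e = 0%N ->
      exec (While e c) M (expr_cost M e + bits (expr_val M e))%N M
  | exec_While_step M1 M2 M3 e c t1 t2 :
      expr_val M1 e <> 0%N ->
      exec c M1 t1 M2 -> exec (While e c) M2 t2 M3 ->
      exec (While e c) M1
        (expr_cost M1 e + bits (expr_val M1 e) + t1 + t2)%N M3.

(* [es] lists the edges, in any order. *)
Definition edge_listing (V : finType) (G : digraph V) (es : seq (V * V)) :=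
  uniq es /\ es =i edges G.

(* Array 0 holds n, m and D; arrays 1, 2 and 3 hold the tails, heads and lengths
   of the edges. A real parameter D is rounded down: lengths being integers,
   a distance is at most D iff it is at most the floor of D. *)
Definition input (R : realType) (n : nat) (G : digraph 'I_n) (D : R)
    (es : seq ('I_n * 'I_n)) : memory :=
  fun a => nth 0%N
    match a with
    | 0 => [:: n; size es; Num.truncn D]
    | 1 => [seq val e.1 | e <- es]
    | 2 => [seq val e.2 | e <- es]
    | 3 => [seq len G e | e <- es]
    | _ => [::]
    end%N.

(* A list of edge sets is output as its size, at index 0 of array 4, and its
   membership table, stored row by row in array 5. *)
Definition outputs (V : finType) (es : seq (V * V)) (Ss : seq {set V * V})
    (M : memory) : Prop :=
  M 4%N 0%N = size Ss /\
  forall i e, (i < size Ss)%N -> e \in es ->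
    M 5%N (i * size es + index e es)%N = (e \in nth finset.set0 Ss i) :> nat.

(* Main.v *)
(* Multiplicative weights. Run a deterministic decomposition D log n times (up to
   rounding), where an edge of length l which has been cut c times so far has weight
   2^(c/l), rounded down in the exponent. Each run cuts weight at most
   O(log n loglog n)/D times the sum of weight * length, and the potential
   sum weight * (length + c mod length) increases by exactly the weight cut. Hence
   it is multiplied by at most 1 + O(log n loglog n)/D per run, no edge of length l
   is ever cut more than l * O(log^2 n loglog n) times, and the uniform distribution
   over the runs has the required loss.

   One run. Grow shortest-path balls forwards and backwards from a vertex, always
   advancing the side whose ball has fewer incident edges, until one of them has a
   radius where the weight of the boundary is at most its volume A times
   O(log(V/A) loglog n)/D, V being the volume of the current part. A harmonic sum
   over the dyadic values of log(V/A) shows that such a radius occurs before D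
   while 2A <= V. That ball becomes a part of its own. If both balls get larger
   than half of the part, then balls of larger radius whose complements are small
   are cut instead, and every vertex of the remaining core is within D/2 of the
   root in both directions. The volume at least halves for every vertex that is
   charged, so a vertex pays O(log n) times, for the cut weight as well as for
   the running time. *)

From HB Require Import structures.
From mathcomp Require Import all_boot all_order all_algebra.
From mathcomp Require Import all_classical all_reals all_analysis.
From mathcomp Require Import zify lra ring.
Require Import Defs.

Set Implicit Arguments.
Unset Strict Implicit.
Unset Printing Implicit Defensive.

(** * Costs of programs *)

(** The number [D * log n] of runs is dictated by the loss: the initial potential is polynomial in
    [n], and its logarithm, spread over the runs, has to be absorbed. Since the loss leaves room for
    a single factor [log n] over all levels of the recursion, a cut is paid in proportion to the
    number of halvings of its volume; [log log n] is the number of dyadic blocks of this quantity.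
    Near-linear time dictates the data structures: a queue is bounded by the degrees of the scanned
    vertices, labels are reset by replaying the queue, and a vertex that changes its part is
    appended to one growing list while its old entries go stale. Only edges that leave a ball in one
    direction are cut; a closed walk cannot cross the boundary in the other direction only. Weights
    have up to about [D * log n] bits, so logarithmic cost contributes one factor [D] to the time,
    besides the runs and the radii. Steps are counted by a total-correctness calculus in which a
    step costs at most a constant times the word length. *)

Definition bounded (B : nat) (M : memory) := forall a i, M a i < 2 ^ B.

(** When all entries have [B] bits, a value has at most [B * val_size e] bits and its evaluation
    costs at most [B * cost_size e]. Both sizes depend on the text of the program only. *)
Fixpoint val_size (e : expr) : nat :=
  match e with
  | Cst c => bits c
  | Get _ _ => 1
  | Bin _ x y => (val_size x + val_size y).+1
  end.

Fixpoint cost_size (e : expr) : nat :=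
  match e with
  | Cst c => bits c
  | Get _ i => (cost_size i + val_size i).+1
  | Bin _ x y => cost_size x + cost_size y + val_size x + val_size y
  end.

(** Sequencing takes a maximum because this bounds the cost of a single step per bit; the number of
    steps is counted separately. *)
Fixpoint cmd_size (c : cmd) : nat :=
  match c with
  | Skip => 1
  | Put _ i x => cost_size i + cost_size x + val_size i + val_size x
  | Seq c1 c2 => maxn (cmd_size c1) (cmd_size c2)
  | If e c1 c2 => maxn (cost_size e + val_size e) (maxn (cmd_size c1) (cmd_size c2))
  | While e c => maxn (cost_size e + val_size e) (cmd_size c)
  end.

Lemma val_size_gt0 e : 0 < val_size e.
Proof. by case: e. Qed.

Lemma bits_leP x k : 0 < k -> x < 2 ^ k -> bits x <= k.
Proof.
move=> k0 xk; rewrite /bits; case: (posnP x) => [->|x0]; first by rewrite trunc_log0.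
have := trunc_logP (isT : 1 < 2) x0 => h.
by rewrite -(@ltn_exp2l 2) //; apply: leq_ltn_trans h xk.
Qed.

Lemma ltn_bits x : x < 2 ^ bits x.
Proof. exact: trunc_log_ltn. Qed.

Section Wp.
Variable B : nat.
Hypothesis B_gt0 : 0 < B.

Lemma expr_val_lt M e : bounded B M -> expr_val M e < 2 ^ (B * val_size e).
Proof.
move=> bM; elim: e => [c|a i _|o x IHx y IHy] /=.
- by apply: leq_trans (ltn_bits c) _; rewrite leq_exp2l //; apply: leq_pmull.
- by rewrite muln1; apply: bM.
have le2 u v : 2 ^ (B * u) + 2 ^ (B * v) <= 2 ^ (B * (u + v).+1).
  have h1 : 2 ^ (B * u) <= 2 ^ (B * (u + v)) by rewrite leq_exp2l // leq_mul2l leq_addr orbT.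
  have h2 : 2 ^ (B * v) <= 2 ^ (B * (u + v)) by rewrite leq_exp2l // leq_mul2l leq_addl orbT.
  have h3 : 2 ^ (B * (u + v)).+1 <= 2 ^ (B * (u + v).+1) by rewrite leq_exp2l //; nia.
  by apply: leq_trans h3; rewrite expnS mul2n -addnn leq_add.
have lex u v : 2 ^ (B * u) <= 2 ^ (B * (u + v).+1) by rewrite leq_exp2l // leq_mul2l; nia.
case: o => /=.
- by apply: leq_trans (le2 _ _); lia.
- by apply: leq_trans (lex _ _); lia.
- have h : expr_val M x * expr_val M y < 2 ^ (B * val_size x) * 2 ^ (B * val_size y) by apply: ltn_mul.
  by apply: leq_trans h _; rewrite -expnD -mulnDr leq_exp2l // leq_mul2l; lia.
- by apply: leq_trans (lex _ _); apply: leq_ltn_trans (leq_div _ _) IHx.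
Qed.

Lemma expr_bits M e : bounded B M -> bits (expr_val M e) <= B * val_size e.
Proof.
move=> bM; apply: bits_leP (expr_val_lt e bM).
by rewrite muln_gt0 B_gt0 val_size_gt0.
Qed.

Lemma expr_cost_le M e : bounded B M -> expr_cost M e <= B * cost_size e.
Proof.
move=> bM; elim: e => [c|a i IHi|o x IHx y IHy] /=.
- exact: leq_pmull.
- have h1 := expr_bits i bM; have h2 : bits (M a (expr_val M i)) <= B by apply: bits_leP (bM _ _).
  by rewrite mulnS mulnDr; lia.
- have h1 := expr_bits x bM; have h2 := expr_bits y bM.
  by rewrite !mulnDr; lia.
Qed.

(* Step-counting total correctness: [Q s M'] is the postcondition for a run of
   [s] unit-cost steps; each step costs at most [cmd_size c * B] bits as long as
   all stored values fit in [B] bits, which is enforced at every [Put]. *)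
Definition wp (c : cmd) (M : memory) (Q : nat -> memory -> Prop) : Prop :=
  bounded B M -> exists s t M',
    [/\ exec c M t M', t <= cmd_size c * B * s, bounded B M' & Q s M'].

Lemma wp_conseq c M (Q Q' : nat -> memory -> Prop) :
  wp c M Q -> (forall s M', Q s M' -> Q' s M') -> wp c M Q'.
Proof.
move=> h hQ bM; have [s [t [M' [e tl b q]]]] := h bM.
by exists s, t, M'; split=> //; apply: hQ.
Qed.

Lemma wp_bounded c M Q : (bounded B M -> wp c M Q) -> wp c M Q.
Proof. by move=> h bM; apply: h. Qed.

Lemma wp_skip M (Q : nat -> memory -> Prop) : Q 1 M -> wp Skip M Q.
Proof. by move=> q bM; exists 1, 1, M; split=> //=; [constructor | lia]. Qed.

Lemma bounded_update M a i x : bounded B M -> x < 2 ^ B -> bounded B (update M a i x).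
Proof. by move=> bM xB b j; rewrite /update; case: ifP. Qed.

Lemma wp_put a i x M (Q : nat -> memory -> Prop) :
  (bounded B M -> expr_val M x < 2 ^ B) ->
  Q 1 (update M a (expr_val M i) (expr_val M x)) -> wp (Put a i x) M Q.
Proof.
move=> hx q bM; eexists 1, _, _; split; [exact: exec_Put | | | exact: q] => /=.
  have := expr_cost_le i bM; have := expr_cost_le x bM.
  by have := expr_bits i bM; have := expr_bits x bM; lia.
by apply: bounded_update => //; apply: hx.
Qed.

Lemma wp_seq c1 c2 M (Q : nat -> memory -> Prop) :
  wp c1 M (fun s1 M1 => wp c2 M1 (fun s2 M2 => Q (s1 + s2) M2)) -> wp (Seq c1 c2) M Q.
Proof.
move=> h bM; have [s1 [t1 [M1 [e1 l1 b1 h1]]]] := h bM.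
have [s2 [t2 [M2 [e2 l2 b2 q]]]] := h1 b1.
exists (s1 + s2), (t1 + t2), M2; split=> //; first by apply: exec_Seq; [exact: e1 | exact: e2].
rewrite /= mulnDr; apply: leq_add; [apply: leq_trans l1 _ | apply: leq_trans l2 _];
  by rewrite -!mulnA leq_mul2r ?leq_maxl ?leq_maxr ?orbT.
Qed.

Lemma wp_if e c1 c2 M (Q : nat -> memory -> Prop) :
  (if expr_val M e != 0 then wp c1 M (fun s => Q s.+1) else wp c2 M (fun s => Q s.+1)) ->
  wp (If e c1 c2) M Q.
Proof.
move=> h bM.
have h' : wp (if expr_val M e != 0 then c1 else c2) M (fun s => Q s.+1) by move: h; case: ifP.
have [s [t [M1 [e1 l1 b1 q]]]] := h' bM.
exists s.+1, (expr_cost M e + bits (expr_val M e) + t), M1; split=> //; first exact: exec_If.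
have h1 := expr_cost_le e bM; have h2 := expr_bits e bM.
have l3 : cmd_size (if expr_val M e != 0 then c1 else c2) <= cmd_size (If e c1 c2).
  by rewrite /= ; case: ifP => _; rewrite !leq_max leqnn ?orbT.
have l2 : t <= cmd_size (If e c1 c2) * B * s by apply: leq_trans l1 _; rewrite -!mulnA leq_mul2r l3 orbT.
have l4 : cost_size e + val_size e <= cmd_size (If e c1 c2) by rewrite /= leq_maxl.
by move: (cmd_size (If e c1 c2)) l2 l4 => K l2 l4; rewrite mulnS; nia.
Qed.

(** In the invariant [I k s M], the variant [k] decreases with each iteration and [s] is the number
    of steps done so far, one of them per test. *)
Lemma wp_while (I : nat -> nat -> memory -> Prop) k0 e c M (Q : nat -> memory -> Prop) :
  I k0 0 M ->
  (forall k s M, I k s M -> expr_val M e != 0 ->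
    wp c M (fun s' M' => exists2 k', k' < k & I k' (s + s').+1 M')) ->
  (forall k s M, I k s M -> expr_val M e = 0 -> Q s.+1 M) ->
  wp (While e c) M Q.
Proof.
move=> h0 hstep hend; have [k hk] : exists k, k0 <= k by exists k0.
have {h0} : I k0 0 M by [].
suff gen : forall k k0 s0 M, k0 <= k -> I k0 s0 M ->
    wp (While e c) M (fun s M' => Q (s0 + s) M').
  by move=> h0; apply: wp_conseq (gen k k0 0 M hk h0) _.
move=> {k0 hk M}; elim=> [|k' IH] => k0 s0 M lek h0 bM.
- case E: (expr_val M e) => [|v].
    exists 1, (expr_cost M e + bits (expr_val M e)), M; split=> //; first exact: exec_While_stop.
      have := expr_cost_le e bM; have := expr_bits e bM.
      by have := leq_maxl (cost_size e + val_size e) (cmd_size c); rewrite /= => *; nia.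
    by rewrite addn1; apply: hend h0 E.
  have E0 : expr_val M e != 0 by rewrite E.
  have [s [t [M1 [_ _ _ [k' lt _]]]]] := hstep _ _ _ h0 E0 bM.
  by move: lt; rewrite ltnNge; move: lek; case: (k0).
- case E: (expr_val M e) => [|v].
    exists 1, (expr_cost M e + bits (expr_val M e)), M; split=> //; first exact: exec_While_stop.
      have := expr_cost_le e bM; have := expr_bits e bM.
      by have := leq_maxl (cost_size e + val_size e) (cmd_size c); rewrite /= => *; nia.
    by rewrite addn1; apply: hend h0 E.
  have E0 : expr_val M e != 0 by rewrite E.
  have [s1 [t1 [M1 [e1 l1 b1 [k1 lt h1]]]]] := hstep _ _ _ h0 E0 bM.
  have lek1 : k1 <= k' by rewrite -ltnS; apply: leq_trans lt lek.
  have [s2 [t2 [M2 [e2 l2 b2 q]]]] := IH _ _ _ lek1 h1 b1.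
  exists (s1 + s2).+1, (expr_cost M e + bits (expr_val M e) + t1 + t2), M2; split=> //.
  + by apply: exec_While_step; [move/eqP: E0 | exact: e1 | exact: e2].
  + have := expr_cost_le e bM; have := expr_bits e bM.
    have := leq_maxl (cost_size e + val_size e) (cmd_size c).
    have m2 := leq_maxr (cost_size e + val_size e) (cmd_size c).
    have {l1}l1 : t1 <= cmd_size (While e c) * B * s1.
      by apply: leq_trans l1 _; rewrite -!mulnA leq_mul2r m2 orbT.
    by move: l1 l2; rewrite /=; set K := maxn _ _ => *; rewrite mulnS mulnDr; nia.
  + by have -> : s0 + (s1 + s2).+1 = (s0 + s1).+1 + s2 by lia.
Qed.

End Wp.

(** * Frame conditions, tests and loops *)

Definition fupd (f : nat -> nat) (i x : nat) : nat -> nat :=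
  fun j => if j == i then x else f j.

Lemma fupdE f i x : fupd f i x i = x.
Proof. by rewrite /fupd eqxx. Qed.

Lemma fupdN f i x j : j != i -> fupd f i x j = f j.
Proof. by rewrite /fupd => /negbTE ->. Qed.

Lemma updE M a i x : update M a i x a = fupd (M a) i x.
Proof. by apply/funext => j; rewrite /update eqxx. Qed.

Lemma updN M a i x b : b != a -> update M a i x b = M b.
Proof. by move=> /negbTE ba; apply/funext => j; rewrite /update ba. Qed.

(** The frame condition of a program that writes to the arrays [xs] only. *)
Definition agree (xs : seq nat) (M M' : memory) : Prop :=
  forall a, a \notin xs -> M' a = M a.

Lemma agree_refl xs M : agree xs M M.
Proof. by []. Qed.

Lemma agree_trans xs M1 M2 M3 : agree xs M1 M2 -> agree xs M2 M3 -> agree xs M1 M3.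
Proof. by move=> h1 h2 a ha; rewrite h2 // h1. Qed.

Lemma agree_sub xs ys M M' : {subset xs <= ys} -> agree xs M M' -> agree ys M M'.
Proof. by move=> s h a ha; apply: h; apply: contra ha => /s. Qed.

Lemma agree_update xs M M' a i x : a \in xs -> agree xs M M' -> agree xs M (update M' a i x).
Proof.
by move=> ax h b hb; rewrite updN; [apply: h | apply: contraNneq hb => ->].
Qed.

(* Array names indexed by the direction of an exploration:
   [false] is forward, [true] is backward. *)
Definition dirv (k : nat) (d : bool) : nat := if d then k.+1 else k.

Ltac neqarr := solve [ by [] | clear; repeat match goal with
  | |- context [dirv _ ?d] => is_var d; destruct d
  | |- context [dirv _ (~~ ?d)] => is_var d; destruct d end; by [] ].

Ltac upds := repeat first [ rewrite updE | rewrite fupdE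
  | match goal with |- context [update ?M ?a ?i ?x ?b] =>
      rewrite (@updN M a i x b); [| neqarr] end ].

Ltac use_agree h := repeat match goal with |- context [?M ?a] =>
      match type of h with agree _ _ M => rewrite (h a); [| neqarr] end end.

Definition var (a : nat) := Get a (Cst 0).
Definition Set_ (a : nat) (x : expr) := Put a (Cst 0) x.
(** Truncated subtraction encodes comparisons, and any nonzero value counts as true. *)
Definition leE (x y : expr) := Bin Defs.Sub (Cst 1) (Bin Defs.Sub x y).
Definition ltE (x y : expr) := Bin Defs.Sub y x.
Definition eqE (x y : expr) := Bin Defs.Sub (Cst 1) (Bin Add (Bin Defs.Sub x y) (Bin Defs.Sub y x)).
Definition andE (x y : expr) := Bin Mul x y.
Definition orE (x y : expr) := Bin Add x y.

Lemma leEv M x y : (expr_val M (leE x y) != 0) = (expr_val M x <= expr_val M y).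
Proof. by rewrite /=; lia. Qed.
Lemma ltEv M x y : (expr_val M (ltE x y) != 0) = (expr_val M x < expr_val M y).
Proof. by rewrite /=; lia. Qed.
Lemma eqEv M x y : (expr_val M (eqE x y) != 0) = (expr_val M x == expr_val M y).
Proof. by rewrite /=; lia. Qed.
Lemma andEv M x y : (expr_val M (andE x y) != 0) = (expr_val M x != 0) && (expr_val M y != 0).
Proof. by rewrite /= muln_eq0 negb_or. Qed.
Lemma orEv M x y : (expr_val M (orE x y) != 0) = (expr_val M x != 0) || (expr_val M y != 0).
Proof. by rewrite /= addn_eq0 negb_and. Qed.
Definition condE := (leEv, ltEv, eqEv, andEv, orEv).

Definition For (vi hi : nat) (body : cmd) : cmd :=
  Seq (Set_ vi (Cst 0))
    (While (ltE (var vi) (var hi)) (Seq body (Set_ vi (Bin Add (var vi) (Cst 1))))).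

Section Loops.
Variable B : nat.
Hypothesis B_gt0 : 0 < B.

Lemma wp_set a x M (Q : nat -> memory -> Prop) :
  (bounded B M -> expr_val M x < 2 ^ B) ->
  Q 1 (update M a 0 (expr_val M x)) -> wp B (Set_ a x) M Q.
Proof. exact: wp_put. Qed.

(** An iteration costs two steps besides its body, for the increment and the test; the final [+ 2]
    is for the initialisation and the last test. The invariant must survive assignments to the loop
    variable, as its index already plays that role. *)
Lemma wp_for (J : nat -> memory -> Prop) (f : nat -> nat) N vi hi body M (Q : nat -> memory -> Prop) :
  hi != vi -> M hi 0 = N ->
  J 0 M ->
  (forall k M1 p, J k M1 -> J k (update M1 vi 0 p)) ->
  (forall k M1, k < N -> J k M1 -> M1 vi 0 = k ->
    wp B body M1 (fun s M2 => [/\ s <= f k, M2 vi 0 = k, M2 hi 0 = N & J k.+1 M2])) ->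
  (forall s M1, s <= \sum_(k < N) (f k + 2) + 2 -> J N M1 -> Q s M1) ->
  wp B (For vi hi body) M Q.
Proof.
move=> hv hN J0 Jst hbody hQ; apply: wp_seq; apply: wp_set => [_|/=]; first by rewrite expn_gt0.
apply: (wp_while B_gt0 (I := fun k s M' => exists2 i, i + k = N &
  [/\ s <= \sum_(j < N | j < i) (f j + 2), M' vi 0 = i, M' hi 0 = N & J i M']) (k0 := N)).
- exists 0; first by lia.
  split; [by [] | by rewrite updE fupdE | by rewrite updN | exact: Jst].
- move=> k s M1 [i ik [sl vi_ hi_ Ji]].
  rewrite condE /= vi_ hi_ => iN.
  apply: wp_seq; apply: wp_conseq (hbody i M1 iN Ji vi_) _ => s1 M2 [s1l vi2 hi2 J2].
  apply: wp_set => [bM|/=].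
    by have := bM hi 0; rewrite hi2 /= vi2; lia.
  exists (k.-1); first by lia.
  exists i.+1; first by lia.
  rewrite !updE fupdE vi2 updN // addn1; split; [|lia|by []|by rewrite addn1; exact: Jst].
  rewrite (bigD1 (Ordinal iN)) /=; last by [].
  have -> : \sum_(j < N | (j < i.+1) && (j != Ordinal iN)) (f j + 2) = \sum_(j < N | j < i) (f j + 2).
    apply: eq_bigl => j; rewrite -val_eqE /=; lia.
  lia.
- move=> k s M1 [i ik [sl vi_ hi_ Ji]].
  rewrite /= vi_ hi_ => /eqP; rewrite subn_eq0 => Ni.
  have iN : i = N by lia.
  apply: hQ; last by rewrite -iN.
  rewrite iN in sl; have -> : \sum_(k0 < N) (f k0 + 2) = \sum_(j < N | j < N) (f j + 2).
    by apply: eq_bigl => j; rewrite ltn_ord.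
  lia.
Qed.

(* Linked list starting at pointer [p]; pointer [e.+1] denotes cell [e], and
   [0] the end of the list. *)
Fixpoint chain (nxt : nat -> nat) (p : nat) (l : seq nat) : Prop :=
  if l is e :: l' then p = e.+1 /\ chain nxt (nxt e) l' else p = 0.

Definition ForChain (vp : nat) (first : expr) (nxt : nat) (body : cmd) : cmd :=
  Seq (Set_ vp first)
    (While (var vp) (Seq body (Set_ vp (Get nxt (Bin Defs.Sub (var vp) (Cst 1)))))).

(** The invariant is indexed by the cells that remain to be visited. *)
Lemma wp_forchain (J : seq nat -> memory -> Prop) (f : nat -> nat) nx vp first nxt body l M
    (Q : nat -> memory -> Prop) :
  nxt != vp ->
  (forall l' M1, J l' M1 -> M1 nxt = nx) ->
  chain nx (expr_val M first) l ->
  (bounded B M -> expr_val M first < 2 ^ B) ->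
  J l M ->
  (forall l' M1 p, J l' M1 -> J l' (update M1 vp 0 p)) ->
  (forall e l' M1, J (e :: l') M1 -> M1 vp 0 = e.+1 ->
    wp B body M1 (fun s M2 => [/\ s <= f e, M2 vp 0 = e.+1 & J l' M2])) ->
  (forall s M1, s <= \sum_(e <- l) (f e + 2) + 2 -> J [::] M1 -> Q s M1) ->
  wp B (ForChain vp first nxt body) M Q.
Proof.
move=> nv Jn hl hb J0 Jst hbody hQ; apply: wp_seq; apply: wp_set => //=.
apply: (wp_while B_gt0 (I := fun k s M' => exists2 l', size l' = k &
  [/\ s + \sum_(e <- l') (f e + 2) <= \sum_(e <- l) (f e + 2), chain nx (M' vp 0) l' & J l' M']) (k0 := size l)).
- exists l => //; split; [by [] | by rewrite updE fupdE | exact: Jst].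
- move=> k s M1 [[|e l'] //= sk [sl cl Jl]]; first by rewrite cl.
  move: cl => [pe cl] _; rewrite big_cons in sl.
  apply: wp_seq; apply: wp_conseq (hbody e l' M1 Jl pe) _ => s1 M2 [s1l vi2 J2].
  apply: wp_set => [bM|/=]; first by apply: bM.
  exists (size l'); first by rewrite -sk.
  exists l' => //; rewrite vi2 subn1 /= (Jn _ _ J2) updE fupdE; split=> //; [lia | exact: Jst].
- move=> k s M1 [[|e l'] sk [sl cl Jl]] /= h; last by move: cl => /= [pe _]; rewrite pe in h.
  apply: hQ => //; move: sl; rewrite big_nil; lia.
Qed.

End Loops.

(** * A harmonic sum over radii *)

Lemma sum_partition_nat N K (f : nat -> nat) (P : pred nat) :
  (forall r, r < N -> P r -> f r < K) ->
  \sum_(r < N | P r) 1 = \sum_(j < K) \sum_(r < N | P r && (f r == j)) 1.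
Proof.
case: K => [|K] fK.
  rewrite big_ord0; apply: big_pred0 => r; apply/negP => /(fK _ (ltn_ord r)); by [].
rewrite (partition_big (fun r : 'I_N => inord (f r) : 'I_K.+1) predT) //=.
apply: eq_bigr => j _; apply: eq_bigl => r; case Pr: (P r) => //=.
by rewrite -val_eqE /= inordK //; apply: fK.
Qed.

Lemma count_dyadic K i : \sum_(j < K | (0 < j) && (trunc_log 2 j == i)) 1 <= 2 ^ i.
Proof.
rewrite -(big_mkord (fun j => (0 < j) && (trunc_log 2 j == i)) (fun=> 1)) sum1_count -size_filter.
rewrite -[X in _ <= X](size_iota (2 ^ i)); apply: uniq_leq_size; first by rewrite filter_uniq ?iota_uniq.
move=> j; rewrite mem_filter mem_iota => /andP[/andP[j0 /eqP ti] _].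
have := trunc_logP (isT : 1 < 2) j0; have := trunc_log_ltn j (isT : 1 < 2).
by rewrite ti expnS; lia.
Qed.

(* If the inequality failed for every radius, then at most [D / (2 h j)] radii
   would have [trunc_log 2 (V / A r) = j]; summing the harmonic series over
   dyadic blocks of [j] leaves fewer than [D] radii. *)
Lemma good_radius (A dl : nat -> nat) V D J0 :
  0 < D -> (forall r, r < D -> 0 < A r) -> (forall r, r < D -> 2 * A r <= V) ->
  (forall r s, r <= s -> s < D -> A r <= A s) ->
  (forall r, r < D -> \sum_(s < r.+1) dl s <= A r) ->
  (forall r, r < D -> trunc_log 2 (V %/ A r) <= J0) ->
  exists2 r, r < D & dl r * D <= 4 * bits J0 * A r * trunc_log 2 (V %/ A r).
Proof.
move=> D0 A0 AV Amon dlA AJ.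
(* [h] is the number of dyadic blocks that cover the values of [j]: [trunc_log 2 (j r)] is always
   below [h]. *)
pose j r := trunc_log 2 (V %/ A r); pose h := bits J0.
have h0 : 0 < h by [].
case: (boolP [exists r : 'I_D, dl r * D <= 4 * h * A r * j r]) => [/existsP[r]|/existsPn bad].
  by exists r.
exfalso.
have {}bad r : r < D -> 4 * h * A r * j r < dl r * D.
  by move=> rD; rewrite ltnNge (bad (Ordinal rD)).
have j1 r : r < D -> 0 < j r.
  move=> rD; rewrite /j -(trunc_expnK 1 (isT : 1 < 2)) /=.
  by apply: leq_trunc_log; rewrite leq_divRL ?A0 // AV.
have AjV r : r < D -> A r * 2 ^ j r <= V.
  move=> rD; have q0 : 0 < V %/ A r by rewrite divn_gt0 ?A0 //; have := AV r rD; lia.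
  have := trunc_logP (isT : 1 < 2) q0; rewrite -/(j r) => hj.
  by rewrite mulnC; apply: leq_trans (leq_divM _ (A r)); rewrite leq_mul2r hj orbT.
have VAj r : r < D -> V < A r * 2 ^ (j r).+1.
  move=> rD; have := trunc_log_ltn (V %/ A r) (isT : 1 < 2); rewrite -/(j r).
  by rewrite ltn_divLR ?A0 // mulnC.
pose cnt i := \sum_(r < D | j r == i) 1.
(* Radii with the same value [i] have volumes within a factor 2 of each other, while their boundary
   weights sum to at most [A r] for the largest such radius [r]. Hence only few of them can violate
   the inequality. *)
have cntP i : 0 < i -> 2 * h * i * cnt i <= D.
  move=> i0; case: (pickP [pred r : 'I_D | j r == i]) => [r0 /= Pr0|none]; last first.
    by rewrite /cnt big_pred0 // muln0.
  have [r /= /eqP Pr rmax] := @arg_maxnP _ r0 [pred r : 'I_D | j r == i] val Pr0.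
  have s1 : \sum_(s < D | j s == i) dl s <= A r.
    apply: leq_trans (dlA r (ltn_ord r)).
    rewrite [X in _ <= X](big_ord_widen _ dl (ltn_ord r)) [X in X <= _]big_mkcond [X in _ <= X]big_mkcond.
    apply: leq_sum => s _; case: ifP => // js; rewrite ifT //.
    by have := rmax s js => /=.
  have s2 : \sum_(s < D | j s == i) 4 * h * i * A s <= (\sum_(s < D | j s == i) dl s) * D.
    rewrite big_distrl /=; apply: leq_sum => s /eqP js.
    by have := bad s (ltn_ord s); rewrite js; lia.
  have s3 : cnt i * V <= \sum_(s < D | j s == i) A s * 2 ^ i.+1.
    rewrite /cnt big_distrl /=; apply: leq_sum => s /eqP js.
    by have := VAj s (ltn_ord s); rewrite js; lia.
  rewrite -big_distrl /= in s3; rewrite -big_distrr /= in s2.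
  have s4 := AjV r (ltn_ord r); rewrite Pr in s4.
  have Ar := A0 r (ltn_ord r).
  have p0 : 0 < 2 ^ i by rewrite expn_gt0.
  rewrite expnS in s3.
  move: (\sum_(s < D | j s == i) A s) (\sum_(s < D | j s == i) dl s) (cnt i) (2 ^ i) s1 s2 s3 s4 p0
    => X Y c p s1 s2 s3 s4 p0.
  have e1 : c * (A r * p) <= X * (2 * p) by apply: leq_trans s3; rewrite leq_mul2l s4 orbT.
  have e2 : c * A r <= 2 * X by rewrite -(leq_pmul2r p0); lia.
  have e3 : 4 * h * i * X <= A r * D by apply: leq_trans s2 _; rewrite leq_mul2r s1 orbT.
  have e4 : (2 * h * i) * (c * A r) <= (2 * h * i) * (2 * X) by rewrite leq_mul2l e2 orbT.
  by rewrite -(leq_pmul2r Ar); lia.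
pose blk i := \sum_(r < D | trunc_log 2 (j r) == i) 1.
have blkP i : 2 * h * blk i <= D.
  have e1 : blk i = \sum_(k < J0.+1 | (0 < k) && (trunc_log 2 k == i)) cnt k.
    rewrite /blk (@sum_partition_nat _ J0.+1 j (fun r => trunc_log 2 (j r) == i)); last first.
      by move=> r rD _; rewrite ltnS; apply: AJ.
    rewrite [RHS]big_mkcond; apply: eq_bigr => k _; case: ifP => hk.
      apply: eq_bigl => r; case: (j r =P k) => [->|]; last by rewrite andbF.
      by case/andP: hk => _ ->.
    apply: big_pred0 => r; apply/negP => /andP[h1 /eqP h2].
    by move: hk; rewrite -h2 h1 j1.
  have e2 : 2 * h * 2 ^ i * blk i <= 2 ^ i * D.
    rewrite e1 big_distrr /=.
    apply: leq_trans (_ : \sum_(k < J0.+1 | (0 < k) && (trunc_log 2 k == i)) D <= _).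
      apply: leq_sum => k /andP[k0 /eqP ti].
      apply: leq_trans (cntP k k0); rewrite leq_mul2r leq_mul2l.
      by rewrite -{1}ti (trunc_logP (isT : 1 < 2) k0) !orbT.
    rewrite -[X in \sum_(_ < _ | _) X]mul1n -big_distrl /= leq_mul2r.
    by rewrite count_dyadic orbT.
  have p0 : 0 < 2 ^ i by rewrite expn_gt0.
  by rewrite -(leq_pmul2l p0); lia.
have tot : D = \sum_(i < h) blk i.
  rewrite /blk -(@sum_partition_nat _ h (fun r => trunc_log 2 (j r)) predT) /=.
    by rewrite sum_nat_const card_ord muln1.
  by move=> r rD _; rewrite /h /bits ltnS; apply: leq_trunc_log; apply: AJ.
have : 2 * h * D <= h * D.
  rewrite {1}tot big_distrr /=; apply: leq_trans (_ : \sum_(i < h) D <= _).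
    by apply: leq_sum => i _; apply: blkP.
  by rewrite sum_nat_const card_ord.
by move: h0 D0 => h0 D0; nia.
Qed.

(** * Balls and cuts *)

(* [src false e] is the tail and [src true e] the head of [e], so that [src d e]
   is where an exploration in direction [d] enters [e]. *)
Record graph := Graph {
  nv : nat; ne : nat; src : bool -> nat -> nat; elen : nat -> nat;
  src_lt : forall d e, e < ne -> src d e < nv;
  elen_gt0 : forall e, e < ne -> 0 < elen e }.

Section Cuts.
Variable g : graph.
Notation n := (nv g).
Notation m := (ne g).
Notation dst d := (src g (~~ d)).
Variables (w : nat -> nat) (beta : nat).

(* Explorations scale lengths by 4, so that radii below [2 * D] yield cores of
   radius [D / 2]. The summand [beta], an average of [w e * elen g e], keeps the
   ratios of nonzero volumes polynomial in [m]. *)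
Definition wmu (d : bool) (x : nat) : nat :=
  \sum_(e < m | src g d e == x) (4 * w e * elen g e + beta).

Definition mu x := wmu false x + wmu true x.

Definition vol (U : pred nat) := \sum_(x < n | U x) mu x.

Definition crosses (d : bool) (C U : pred nat) : pred nat :=
  fun e => [&& C (src g d e), C (dst d e), U (src g d e) & ~~ U (dst d e)].

Definition cutw d C U := \sum_(e < m | crosses d C U e) w e.

(* Labels are distances plus one; the label 0 marks undiscovered vertices. *)
Definition ball (lam : nat -> nat) (s : nat) : pred nat := fun x => 0 < lam x <= s.+1.

(** A label of at most [r] means a distance below [r]: all edges inside [C] that start at such a
    distance have been relaxed. *)
Definition closed d (C : pred nat) (lam : nat -> nat) (r : nat) : Prop :=
  forall e, e < m -> C (src g d e) -> C (dst d e) -> 0 < lam (src g d e) <= r ->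
    0 < lam (dst d e) <= lam (src g d e) + 4 * elen g e.

Lemma sum_src d (U : pred nat) (F : nat -> nat) :
  \sum_(e < m | U (src g d e)) F e = \sum_(x < n | U x) \sum_(e < m | src g d e == x) F e.
Proof.
case: (posnP n) => [n0|n0].
  rewrite big1 => [|e _]; last by exfalso; have := src_lt d (ltn_ord e); lia.
  by rewrite big1 // => x _; exfalso; have := ltn_ord x; lia.
pose f (e : 'I_m) : 'I_n := Ordinal (src_lt d (ltn_ord e)).
rewrite (partition_big f (fun x : 'I_n => U x)) //=.
apply: eq_bigr => x Ux; apply: eq_bigl => e; rewrite -val_eqE /=.
by case: eqP => [->|]; rewrite ?Ux ?andbF.
Qed.

Lemma sum_wmu d (U : pred nat) :
  \sum_(e < m | U (src g d e)) 4 * w e * elen g e <= vol U.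
Proof.
rewrite (sum_src d U (fun e => 4 * w e * elen g e)) /vol; apply: leq_sum => x _.
apply: leq_trans (_ : wmu d x <= _); last by rewrite /mu; case: d; lia.
by apply: leq_sum => e _; apply: leq_addr.
Qed.

Lemma count_interval N a k (P : pred nat) :
  (forall s, s < N -> P s -> a <= s < a + k) -> \sum_(s < N | P s) 1 <= k.
Proof.
move=> h; rewrite -(big_mkord P (fun=> 1)) sum1_count -size_filter -[X in _ <= X](size_iota a).
apply: uniq_leq_size; first by rewrite filter_uniq ?iota_uniq.
by move=> j; rewrite mem_filter !mem_iota => /andP[Pj /= jN]; apply: h => //; lia.
Qed.

(** By [closed], an edge of length [l] crosses the boundary for at most [4 * l] radii, an interval
    that starts at its inner endpoint. Summed over the radii, it pays at most its share [4 * w * l]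
    of the volume. The direction [d'] selects the paying endpoint: the inner one for balls, the
    outer one for complements. *)
Lemma cut_sum_le d d' C lam N (P : pred nat) (U : pred nat) :
  closed d C lam N ->
  (forall s e, s < N -> P s -> crosses d C (ball lam s) e -> U (src g d' e)) ->
  \sum_(s < N | P s) cutw d C (ball lam s) <= vol U.
Proof.
move=> cl hU.
apply: leq_trans (sum_wmu d' U).
rewrite [X in X <= _](exchange_big_dep (fun e : 'I_m => U (src g d' e))) /=; last first.
  by move=> s e Ps; apply: hU.
apply: leq_sum => e _; set X := \sum_(_ < _ | _) _.
have -> : X = w e * \sum_(s < N | P s && crosses d C (ball lam s) e) 1.
  by rewrite /X big_distrr /=; apply: eq_bigr => s _; rewrite muln1.
rewrite -mulnA mulnCA leq_mul2l; apply/orP; right.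
apply: (@count_interval N (lam (src g d e)).-1 _ (fun s => P s && crosses d C (ball lam s) e)).
move=> s sN /andP[Ps /and4P[c1 c2]]; rewrite /ball => /andP[l0 l1].
have := cl e (ltn_ord e) c1 c2; rewrite l0 /= => /(_ (leq_trans l1 sN)) /andP[h1 h2].
rewrite h1 /=; lia.
Qed.

Lemma vol_sub (U U' : pred nat) : (forall x, U x -> U' x) -> vol U <= vol U'.
Proof.
move=> h; rewrite /vol [X in X <= _]big_mkcond [X in _ <= X]big_mkcond; apply: leq_sum => x _.
by case Ux: (U x) => //; rewrite (h _ Ux).
Qed.

Lemma ball_sub lam s s' x : s <= s' -> ball lam s x -> ball lam s' x.
Proof. by rewrite /ball; lia. Qed.

Lemma closed_le d C lam r r' : r' <= r -> closed d C lam r -> closed d C lam r'.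
Proof. by move=> h cl e em c1 c2 l; apply: cl => //; lia. Qed.

(* The inequality tested by the algorithm before it cuts along [ball lam r]. *)
Definition cheap D h V A delta := delta * D <= 4 * h * A * trunc_log 2 (V %/ A).

Lemma cheap_ball d C lam D V J0 :
  0 < D -> closed d C lam D ->
  0 < vol (predI C (ball lam 0)) ->
  (forall r, r < D -> 2 * vol (predI C (ball lam r)) <= V) ->
  (forall U, 0 < vol U -> trunc_log 2 (V %/ vol U) <= J0) ->
  exists2 r, r < D & cheap D (bits J0) V (vol (predI C (ball lam r))) (cutw d C (ball lam r)).
Proof.
move=> D0 cl v0 vV vJ.
have mono r s : r <= s -> vol (predI C (ball lam r)) <= vol (predI C (ball lam s)).
  move=> rs; apply: vol_sub => x /= /andP[-> /=]; exact: ball_sub.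
have pos r : 0 < vol (predI C (ball lam r)) by apply: leq_trans v0 (mono _ _ _).
apply: (@good_radius (fun r => vol (predI C (ball lam r))) (fun r => cutw d C (ball lam r)) V D J0) => //.
- by move=> r s rs _; apply: mono.
- move=> r rD; apply: (@cut_sum_le d d C lam r.+1 predT); first exact: closed_le cl.
  move=> s e sr _ /and4P[c1 c2 b1 b2] /=; rewrite c1 /=; exact: ball_sub b1.
- by move=> r _; apply: vJ.
Qed.

(** Complements of balls grow as the radius decreases, so [good_radius] is applied to the radii in
    reverse order, from [2 * D - 1] down to [D]. *)
Lemma cheap_complement d C lam D V J0 :
  0 < D -> closed d C lam (2 * D) ->
  (forall r, D <= r < 2 * D -> 2 * vol (predI C (predC (ball lam r))) <= V) ->
  (forall U, 0 < vol U -> trunc_log 2 (V %/ vol U) <= J0) ->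
  exists2 r, D <= r < 2 * D &
    cheap D (bits J0) V (vol (predI C (predC (ball lam r)))) (cutw d C (ball lam r)).
Proof.
move=> D0 cl vV vJ.
pose A r := vol (predI C (predC (ball lam r))).
have mono r s : r <= s -> A s <= A r.
  move=> rs; apply: vol_sub => x /= /andP[-> /=]; apply: contra; exact: ball_sub.
have sumA r N : N <= 2 * D -> \sum_(s < N | r <= s) cutw d C (ball lam s) <= A r.
  move=> ND; apply: (@cut_sum_le d (~~ d) C lam N); first exact: closed_le cl.
  move=> s e sN rs /and4P[c1 c2 b1 b2] /=; rewrite c2 /=; apply: contra b2; exact: ball_sub.
(* [good_radius] requires positive volumes. If the smallest complement has volume zero, its boundary
   has weight zero and the last radius is cheap. *)
case: (posnP (A (2 * D).-1)) => [A0|A0].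
  exists (2 * D).-1; first by lia.
  have := sumA (2 * D).-1 (2 * D) (leqnn _).
  have lt : (2 * D).-1 < 2 * D by lia.
  rewrite (bigD1 (Ordinal lt)) //= A0 leqn0 addn_eq0 => /andP[/eqP c0 _].
  by rewrite /cheap c0.
have pos r : r < 2 * D -> 0 < A r by move=> h; apply: leq_trans A0 (mono _ _ _); lia.
have [|||||t tD ht] := @good_radius (fun t => A ((2 * D).-1 - t)) (fun t => cutw d C (ball lam ((2 * D).-1 - t))) V D J0 D0.
- by move=> t tD; apply: pos; lia.
- by move=> t tD; apply: vV; lia.
- by move=> r s rs sD; apply: mono; lia.
- move=> r rD; apply: leq_trans (sumA ((2 * D).-1 - r) (2 * D) (leqnn _)).
  rewrite [X in _ <= X](reindex_inj rev_ord_inj) /=.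
  rewrite (big_ord_widen (2 * D) (fun s => cutw d C (ball lam ((2 * D).-1 - s)))); last by lia.
  rewrite [X in X <= _]big_mkcond [X in _ <= X]big_mkcond; apply: leq_sum => s _.
  case: ifP => // sr; rewrite ifT; last by have := ltn_ord s; lia.
  by have -> : 2 * D - s.+1 = (2 * D).-1 - s by lia.
- by move=> r rD; apply: vJ; apply: pos; lia.
by exists ((2 * D).-1 - t); [lia | exact: ht].
Qed.

End Cuts.

(** * Exploring balls *)

Arguments update : simpl never.
Arguments fupd : simpl never.
Arguments dirv : simpl never.

(* The machine has numbered arrays; arrays 0-5 are those of the input and output.
   Indexed by edges: NXT (next edge of an adjacency list, plus one), WT (weight)
   and RM (number of cuts modulo the length). Indexed by vertices: FST (first edge
   of the adjacency list, plus one), DEG, LAM (distance label of an exploration),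
   MU (volume) and COMP (part containing the vertex, 0 for an isolated one).
   Indexed by parts: ST and EN (ends of the segment of LL which lists the part),
   VOL (upper bound on the volume) and DONE (the part is a core). The length of LL
   is TOP, and NP is the first unused part. QQ is the queue of an exploration and
   QL its length; AA and DG are the volume and the degree sum of the ball of radius
   LEV, and BIG tells that it exceeds half of the part. Row ROW of the output table
   is being filled. The others hold loop variables and temporaries. *)
Notation SRC d := (dirv 1 d).
Notation LEN := 3.
Notation FST d := (dirv 6 d).
Notation NXT d := (dirv 8 d).
Notation DEG d := (dirv 10 d).
Notation LAM d := (dirv 12 d).
Notation QQ d := (dirv 14 d).
Notation QL d := (dirv 16 d).
Notation LEV d := (dirv 18 d).
Notation AA d := (dirv 20 d).
Notation DG d := (dirv 22 d).
Notation BIG d := (dirv 24 d).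
Notation WT := 26.
Notation RM := 27.
Notation MU := 28.
Notation COMP := 29.
Notation LL := 30.
Notation ST := 31.
Notation EN := 32.
Notation VOL := 33.
Notation DONE := 34.
Notation NP := 35.
Notation TOP := 36.
Notation CI := 37.
Notation CX := 38.
Notation CQ := 39.
Notation VV := 40.
Notation DEL := 41.
Notation JJ := 42.
Notation HH := 43.
Notation FND := 44.
Notation ROW := 45.
Notation TT := 46.
Notation I1 := 47.
Notation N1 := 48.
Notation VX := 49.
Notation VE := 50.
Notation VY := 51.
Notation NL := 52.
Notation AC := 53.
Notation YY := 54.

Ltac with_gt0 tac := lazymatch goal with |- wp ?B _ _ _ =>
  match goal with H : is_true (0 < B) |- _ => tac H end end.
Ltac wif := with_gt0 ltac:(fun H => apply: (wp_if H)).
Ltac wset := with_gt0 ltac:(fun H => apply: (wp_set H)).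
Ltac wput := with_gt0 ltac:(fun H => apply: (wp_put H)).
Ltac wskip := with_gt0 ltac:(fun H => apply: (wp_skip H)).
Ltac agr := do !apply: agree_update; rewrite ?inE ?eqxx ?orbT //; exact: agree_refl.

Ltac sublist := apply/allP; neqarr.

Definition pred_ (x : expr) := Bin Defs.Sub x (Cst 1).
Definition succ_ (x : expr) := Bin Add x (Cst 1).

Definition relax_edge d : cmd :=
  Seq (Set_ VY (Get (SRC (~~ d)) (pred_ (var VE))))
  (If (eqE (Get COMP (var VY)) (var CQ))
    (Seq (Set_ NL (Bin Add (Get (LAM d) (var VX)) (Bin Mul (Cst 4) (Get LEN (pred_ (var VE))))))
     (If (eqE (Get (LAM d) (var VY)) (Cst 0))
        (Seq (Put (LAM d) (var VY) (var NL))
          (Seq (Put (QQ d) (var (QL d)) (var VY)) (Set_ (QL d) (succ_ (var (QL d))))))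
        (If (ltE (var NL) (Get (LAM d) (var VY))) (Put (LAM d) (var VY) (var NL)) Skip)))
    Skip).

(** Dijkstra's algorithm without a priority queue: for each radius, the whole queue is searched for
    labels equal to [LEV + 1]. Vertices appended meanwhile have larger labels because lengths are
    positive, so the initial length of the queue suffices. *)
Definition relax d : cmd :=
  Seq (Set_ N1 (var (QL d)))
  (For I1 N1
    (Seq (Set_ VX (Get (QQ d) (var I1)))
      (If (eqE (Get (LAM d) (var VX)) (succ_ (var (LEV d))))
        (ForChain VE (Get (FST d) (var VX)) (NXT d) (relax_edge d))
        Skip))).

(** [walk g d v x l] leads from [v] to [x] when [d] is forward and from [x] to [v] when it is
    backward. *)
Inductive walk (g : graph) (d : bool) : nat -> nat -> nat -> Prop :=
  | walk_nil v : walk g d v v 0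
  | walk_cons v e l : e < ne g -> walk g d v (src g d e) l ->
      walk g d v (src g (~~ d) e) (l + elen g e).

Notation relax_mods d := [:: LAM d; QQ d; QL d; VY; NL; VX; VE; I1; N1].

Section Explore.
Variable g : graph.
Notation n := (nv g).
Notation m := (ne g).
Notation dst d := (src g (~~ d)).
Notation closed := (closed g).

(** In decreasing order, because adjacency lists are built by inserting edges at the front. *)
Definition adj d x := [seq e <- rev (iota 0 m) | src g d e == x].

Lemma mem_adj d x e : (e \in adj d x) = (e < m) && (src g d e == x).
Proof. by rewrite mem_filter mem_rev mem_iota andbC. Qed.

Lemma sum_adj d x (F : nat -> nat) : \sum_(e <- adj d x) F e = \sum_(e < m | src g d e == x) F e.
Proof.
rewrite big_filter -(big_mkord (fun e => src g d e == x)); apply: perm_big.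
by rewrite /index_iota subn0; apply/permPl; exact: perm_rev.
Qed.

Definition degr d x := size (adj d x).

Record static (M : memory) : Prop := Static {
  st_m : M 0 1 = m;
  st_src : forall d e, e < m -> M (SRC d) e = src g d e;
  st_len : forall e, e < m -> M LEN e = elen g e;
  st_adj : forall d x, x < n -> chain (M (NXT d)) (M (FST d) x) (adj d x);
  st_deg : forall d x, x < n -> M (DEG d) x = degr d x }.

Definition qrep d (Qs : seq nat) (M : memory) : Prop :=
  M (QL d) 0 = size Qs /\ forall i, i < size Qs -> M (QQ d) i = nth 0 Qs i.

(** Labels bound distances from above, by actual walks; in the other direction, cuts rely on
    [closed] in place of the minimality of labels. *)
Record explored d (C : pred nat) v (lam : nat -> nat) (Qs : seq nat) : Prop := Explored {
  ex_uniq : uniq Qs;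
  ex_mem : forall x, (x \in Qs) = (0 < lam x);
  ex_lt : forall x, x \in Qs -> x < n;
  ex_C : forall x, x \in Qs -> C x;
  ex_walk : forall x, x \in Qs -> exists2 l, walk g d v x l & 4 * l < lam x;
  ex_root : lam v = 1 }.

Lemma explored_size d C v lam Qs : explored d C v lam Qs -> size Qs <= n.
Proof.
move=> ex; rewrite -[X in _ <= X](size_iota 0); apply: uniq_leq_size (ex_uniq ex) _ => x /(ex_lt ex).
by rewrite mem_iota.
Qed.

(** How a scan at radius [r] may change labels: they appear or decrease, and the changed ones stay
    above [r + 1]. Balls up to radius [r] are thereby frozen. *)
Definition lower r (lam lam' : nat -> nat) : Prop := forall z,
  (0 < lam z -> 0 < lam' z <= lam z) /\ (lam' z = lam z \/ r.+1 < lam' z).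

Lemma lower_refl r lam : lower r lam lam.
Proof. by move=> z; split; [lia | left]. Qed.

Lemma lower_trans r l1 l2 l3 : lower r l1 l2 -> lower r l2 l3 -> lower r l1 l3.
Proof. by move=> h1 h2 z; have [a1 b1] := h1 z; have [a2 b2] := h2 z; split; [lia | lia]. Qed.

Lemma lower_ball r s lam lam' : lower r lam lam' -> s <= r -> ball lam' s = ball lam s.
Proof. by move=> h sr; apply/funext => z; have [] := h z; rewrite /ball; lia. Qed.

Definition relaxed d (C : pred nat) (lam : nat -> nat) e : Prop :=
  C (dst d e) -> 0 < lam (dst d e) <= lam (src g d e) + 4 * elen g e.

Lemma relaxed_lower d C r lam lam' e : 0 < lam (src g d e) <= r.+1 ->
  lower r lam lam' -> relaxed d C lam e -> relaxed d C lam' e.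
Proof.
move=> h l rx c; have := rx c; have [] := l (src g d e); have [] := l (dst d e); lia.
Qed.

Variable B : nat.
Hypothesis B_gt0 : 0 < B.

Notation relax_mod d := [:: LAM d; QQ d; QL d; VY; NL].

Lemma wp_relax_edge d M C v r Qs x e :
  static M -> n < 2 ^ B -> r.+1 + 4 * elen g e < 2 ^ B ->
  C = (fun z => M COMP z == M CQ 0) ->
  M VX 0 = x -> M VE 0 = e.+1 -> e < m -> src g d e = x -> M (LAM d) x = r.+1 -> x \in Qs ->
  qrep d Qs M -> explored d C v (M (LAM d)) Qs ->
  wp B (relax_edge d) M (fun s M' => [/\ s <= 10, agree (relax_mod d) M M' &
    exists Qs', [/\ qrep d Qs' M', explored d C v (M' (LAM d)) Qs', prefix Qs Qs',
      size Qs' <= (size Qs).+1 & lower r (M (LAM d)) (M' (LAM d)) /\ relaxed d C (M' (LAM d)) e]]).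
Proof.
move=> st nB lB CE vx ve em sx lx xQ [ql qq] ex.
have ln0 := elen_gt0 em.
apply: wp_seq; wset => /= [bM|]; first exact: bM.
rewrite ve subn1 /= (st_src st _ em); set y := dst d e.
have yn : y < n by apply: src_lt.
wif; rewrite condE /=; upds; case: ifP => [/eqP cy|/negbT cy]; last first.
  wskip; split=> //; first by agr.
  exists Qs; rewrite /qrep; upds; split=> //; first exact: prefix_refl.
  split; first exact: lower_refl.
  by rewrite /relaxed CE -/y (negbTE cy).
have Cy : C y by rewrite CE cy.
have walky : exists2 l, walk g d v y l & 4 * l < r.+1 + 4 * elen g e.
  have [l wl hl] := ex_walk ex xQ; exists (l + elen g e); last by rewrite lx in hl; lia.
  by apply: walk_cons em _; rewrite sx.
apply: wp_seq; wset => /=; upds; rewrite vx ve subn1 /= (st_len st em) lx; first by [].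
wif; rewrite condE /=; upds; case: ifP => [/eqP ly|/negbT ly].
- apply: wp_seq; wput => /=; upds; first by [].
  apply: wp_seq; wput => /=; upds; first by move=> _; apply: ltn_trans nB.
  have yQ : y \notin Qs by rewrite (ex_mem ex) ly.
  have ex' : explored d C v (fupd (M (LAM d)) y (r.+1 + 4 * elen g e)) (rcons Qs y).
    split.
    + by rewrite rcons_uniq yQ (ex_uniq ex).
    + move=> z; rewrite mem_rcons inE (ex_mem ex) /fupd; case: eqP => [->|] //=.
    + by move=> z; rewrite mem_rcons inE => /orP[/eqP ->|/(ex_lt ex)].
    + by move=> z; rewrite mem_rcons inE => /orP[/eqP ->|/(ex_C ex)].
    + move=> z; rewrite mem_rcons inE => /orP[/eqP ->|zQ]; first by rewrite fupdE.
      by rewrite fupdN; [exact: (ex_walk ex) | apply: contraNneq yQ => <-].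
    + rewrite fupdN; first exact: (ex_root ex).
      by apply: contraNneq yQ => <-; rewrite (ex_mem ex) (ex_root ex).
  wset => /=; upds; rewrite ql.
    have := explored_size ex'; rewrite size_rcons => h _; lia.
  split=> //; first by agr.
  exists (rcons Qs y); rewrite /qrep; upds; split=> //.
  + rewrite size_rcons addn1; split=> // i iQ; rewrite nth_rcons /fupd.
    by case: (ltngtP i (size Qs)) => h //; [exact: qq | by rewrite ltnS leqNgt h in iQ].
  + exact: prefix_rcons.
  + by rewrite size_rcons.
  split.
    move=> z; rewrite /fupd; case: eqP => [->|_]; first by rewrite ly; split; [lia | right; lia].
    by split; [lia | left].
  move=> _; rewrite -/y fupdE sx fupdN ?lx; first by lia.
  by apply: contraNneq yQ => <-.
wif; rewrite condE /=; upds; case: ifP => lt.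
- wput => /=; upds; first by [].
  split=> //; first by agr.
  have yx : y != x by apply/eqP => yx; move: lt; rewrite yx lx; lia.
  exists Qs; rewrite /qrep; upds; split=> //.
  + split.
    + exact: (ex_uniq ex).
    + move=> z; rewrite (ex_mem ex) /fupd; case: eqP => [->|] //=; lia.
    + exact: (ex_lt ex).
    + exact: (ex_C ex).
    + move=> z zQ; rewrite /fupd; case: eqP => [->|_] //; exact: (ex_walk ex).
    + rewrite fupdN; first exact: (ex_root ex).
      by apply/eqP => vy; move: lt; rewrite -vy (ex_root ex); lia.
  + exact: prefix_refl.
  split.
    move=> z; rewrite /fupd; case: eqP => [->|_]; first by split; [lia | right; lia].
    by split; [lia | left].
  move=> _; rewrite -/y fupdE sx fupdN ?lx; first by lia.
  by rewrite eq_sym.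
wskip; split=> //; first by agr.
exists Qs; rewrite /qrep; upds; split=> //; first exact: prefix_refl.
split; first exact: lower_refl.
by move=> _; rewrite -/y sx lx; lia.
Qed.

(* The queue holds the root and heads of scanned edges only. *)
Definition small_queue d (lam : nat -> nat) r (Qs : seq nat) : Prop :=
  size Qs <= (\sum_(x <- Qs | 0 < lam x <= r) degr d x).+1.

(** The pass over the queue is paid for by [small_queue] and the scanned edges by the vertices of
    label [r + 1]. A level therefore costs the degree sum of its ball, although the queue may extend
    far beyond that ball. *)
Lemma wp_relax d M C v r Qs :
  static M -> n < 2 ^ B -> (forall e, e < m -> r.+1 + 4 * elen g e < 2 ^ B) ->
  C = (fun z => M COMP z == M CQ 0) -> M (LEV d) 0 = r ->
  qrep d Qs M -> explored d C v (M (LAM d)) Qs -> closed d C (M (LAM d)) r ->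
  small_queue d (M (LAM d)) r Qs ->
  wp B (relax d) M (fun s M' =>
    [/\ s <= 20 * (\sum_(x <- Qs | ball (M (LAM d)) r x) degr d x).+1,
        agree (relax_mods d) M M' &
        exists Qs', [/\ qrep d Qs' M', explored d C v (M' (LAM d)) Qs',
          closed d C (M' (LAM d)) r.+1, small_queue d (M' (LAM d)) r.+1 Qs' &
          lower r (M (LAM d)) (M' (LAM d))]]).
Proof.
move=> st nB lB CE lev qr ex cl sq.
have [ql qq] := qr.
set lam0 := M (LAM d).
apply: wp_seq; wset => /=; upds; first by move=> bM; apply: bM.
pose J i (M' : memory) := agree (relax_mods d) M M' /\
  M' N1 0 = size Qs /\ exists Qs', [/\ qrep d Qs' M', explored d C v (M' (LAM d)) Qs', prefix Qs Qs',
    lower r lam0 (M' (LAM d)) &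
    (forall j e, j < i -> lam0 (nth 0 Qs j) = r.+1 -> e \in adj d (nth 0 Qs j) -> relaxed d C (M' (LAM d)) e) /\
    size Qs' <= size Qs + \sum_(j < size Qs | (j < i) && (lam0 (nth 0 Qs j) == r.+1)) degr d (nth 0 Qs j)].
pose f i := if lam0 (nth 0 Qs i) == r.+1 then 12 * degr d (nth 0 Qs i) + 6 else 6.
apply: (wp_for B_gt0 (J := J) (f := f) (N := size Qs)) => //.
- split; first by agr.
  split; first by upds.
  exists Qs; rewrite /qrep; upds; split=> //; [exact: prefix_refl | exact: lower_refl|].
  by split=> //; rewrite big1 ?addn0 // => j.
- move=> k M1 p [ag [n1 [Qs' [qr' ex' pf lo [h1 h2]]]]]; split.
    by apply: agree_update => //; rewrite !inE !eqxx !orbT.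
  by split; [upds | exists Qs'; rewrite /qrep; upds].
- move=> k M1 kQ [ag [n1 [Qs' [[ql' qq'] ex' pf lo [h1 h2]]]]] i1.
  have szQ : size Qs <= size Qs' by apply: size_prefix pf.
  set x := nth 0 Qs k.
  have xE : nth 0 Qs' k = x.
    by case/prefixP: pf => t ->; rewrite nth_cat kQ.
  have xQ' : x \in Qs' by rewrite -xE mem_nth //; apply: leq_trans szQ.
  have xn : x < n by apply: ex_lt ex' _ xQ'.
  have sumS : \sum_(j < size Qs | (j < k.+1) && (lam0 (nth 0 Qs j) == r.+1)) degr d (nth 0 Qs j)
      = \sum_(j < size Qs | (j < k) && (lam0 (nth 0 Qs j) == r.+1)) degr d (nth 0 Qs j) +
        (if lam0 x == r.+1 then degr d x else 0) :> nat.
    case: ifP => lx.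
      rewrite (bigD1 (Ordinal kQ)) /=; last by rewrite lx ltnSn.
      rewrite addnC; congr (_ + _); apply: eq_bigl => j; rewrite -val_eqE /= ltnS.
      by rewrite [j <= k]leq_eqVlt; case: (ltngtP j k); rewrite /= ?andbT ?andbF.
    rewrite addn0; apply: eq_bigl => j; rewrite ltnS leq_eqVlt.
    by case: eqP => //= ->; rewrite -/x lx ltnn.
  apply: wp_seq; wset => /=; upds; rewrite i1; first by move=> bM; apply: bM.
  rewrite qq'; last by apply: leq_trans szQ.
  rewrite xE.
  (* A label that has changed during this scan is above [r + 1] and was so before, hence the test
     gives the same answer as at the beginning. *)
  have lxE : (M1 (LAM d) x == r.+1) = (lam0 x == r.+1).
    have [h3 h4] := lo x.
    have l0 : 0 < M1 (LAM d) x by rewrite -(ex_mem ex').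
    case: h4 => [->//|h4]; have : 0 < lam0 x by rewrite -(ex_mem ex) mem_nth.
    by move=> /h3; lia.
  wif; rewrite condE /=; upds; rewrite (ag (LEV d)); last by neqarr.
  rewrite lev addn1 lxE; case: ifP => lx; last first.
    wskip; rewrite /f -/x lx; split=> //.
    split; first by apply: agree_update; rewrite ?inE ?eqxx ?orbT.
    split; first by upds.
    exists Qs'; rewrite /qrep; upds; split=> //; split.
      move=> j e; rewrite ltnS leq_eqVlt => /orP[/eqP ->|]; last exact: h1.
      by rewrite -/x => lx'; rewrite lx' eqxx in lx.
    by rewrite sumS // lx addn0.
  have lx1 : M1 (LAM d) x = r.+1 by apply/eqP; rewrite lxE.
  have st1 : static M1.
    by case: st => h3 h4 h5 h6 h7; split; move=> *; use_agree ag; auto.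
  pose J2 (l : seq nat) (M' : memory) := agree (relax_mods d) M M' /\
    [/\ M' N1 0 = size Qs, M' VX 0 = x, M' I1 0 = k & 
    exists Qs2, [/\ qrep d Qs2 M', explored d C v (M' (LAM d)) Qs2, prefix Qs Qs2,
    lower r (M1 (LAM d)) (M' (LAM d)) &
    [/\ M' (LAM d) x = r.+1, x \in Qs2, exists2 l0, adj d x = l0 ++ l & forall e, e \in l0 -> relaxed d C (M' (LAM d)) e &
    size Qs2 + size l <= size Qs' + degr d x]]].
  apply: (wp_forchain B_gt0 (J := J2) (f := fun=> 10) (nx := M (NXT d)) (l := adj d x)).
  + by neqarr.
  + by move=> l' M2 [ag2 _]; rewrite ag2 //; neqarr.
  + rewrite /=; upds; use_agree ag; exact: st_adj st _ _ xn.
  + by rewrite /=; move=> bM; apply: bM.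
  + split; first by apply: agree_update; rewrite ?inE ?eqxx ?orbT.
    split; [by upds|by upds|by upds|].
    exists Qs'; rewrite /qrep; upds; split=> //; first exact: lower_refl.
    split=> //; first by exists [::].
  + move=> l' M2 p [ag2 [h3 h4 h5 [Qs2 [h6 h7 h8 h9 h10]]]].
    split; first by apply: agree_update; rewrite ?inE ?eqxx ?orbT.
    split; [by upds|by upds|by upds|].
    by exists Qs2; rewrite /qrep; upds.
  + move=> e l' M2 [ag2 [h3 h4 h5 [Qs2 [h6 h7 h8 h9 [h10 h11 [l0 al h12] h13]]]]] ve.
    have : e \in adj d x by rewrite al mem_cat mem_head orbT.
    rewrite mem_adj => /andP[em /eqP sx].
    have st2 : static M2.
      by case: st => g3 g4 g5 g6 g7; split; move=> *; use_agree ag2; auto.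
    have CE2 : C = (fun z => M2 COMP z == M2 CQ 0).
      by rewrite CE; apply/funext => z; use_agree ag2.
    apply: wp_conseq (wp_relax_edge st2 nB (lB e em) CE2 h4 ve em sx h10 h11 h6 h7) _.
    move=> s M3 [sl ag3 [Qs3 [g1 g2 g3 g4 [g5 g6]]]].
    split=> //; first by rewrite ag3 //; neqarr.
    split.
      by apply: agree_trans ag2 _; apply: agree_sub ag3; sublist.
    split; [by use_agree ag3 | by use_agree ag3 | by use_agree ag3 |].
    exists Qs3; split=> //; first exact: prefix_trans g3.
      exact: lower_trans h9 g5.
    split.
    * by have [] := g5 x; rewrite h10; lia.
    * by case/prefixP: g3 => t ->; rewrite mem_cat h11.
    * exists (rcons l0 e); first by rewrite al cat_rcons.
      move=> e'; rewrite mem_rcons inE => /orP[/eqP ->//|e'l].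
      have : e' \in adj d x by rewrite al mem_cat e'l.
      rewrite mem_adj => /andP[_ /eqP se'].
      by apply: relaxed_lower g5 (h12 _ e'l); rewrite se' h10; lia.
    * by apply: leq_trans h13; rewrite /= addnS -addSn leq_add2r.
  + move=> s M2 sl [ag2 [h3 h4 h5 [Qs2 [h6 h7 h8 h9 [h10 h11 [l0 al h12] h13]]]]].
    have lo2 := lower_trans lo h9.
    split=> //.
      rewrite /f -/x lx; move: sl; rewrite big_const_seq count_predT iter_addn_0.
      by rewrite -/(degr d x); lia.
    split=> //; split=> //; exists Qs2; split=> //; split.
      move=> j e; rewrite ltnS leq_eqVlt => /orP[/eqP ->|jk] lj ej.
        by apply: h12; move: ej; rewrite -/x al cats0.
      apply: relaxed_lower h9 (h1 j e jk lj ej).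
      move: ej; rewrite mem_adj => /andP[_ /eqP ->].
      have [] := lo (nth 0 Qs j); rewrite lj; lia.
    rewrite sumS lx addnA; apply: leq_trans (leq_add h2 (leqnn _)).
    by move: h13; rewrite addn0.
move=> s M1 sl [ag [n1 [Qs' [qr' ex' pf lo [h1 h2]]]]].
have sumQ : \sum_(j < size Qs | lam0 (nth 0 Qs j) == r.+1) degr d (nth 0 Qs j)
    = \sum_(x <- Qs | lam0 x == r.+1) degr d x by rewrite (big_nth 0) big_mkord.
have splitQ : \sum_(x <- Qs | ball lam0 r x) degr d x =
    \sum_(x <- Qs | 0 < lam0 x <= r) degr d x + \sum_(x <- Qs | lam0 x == r.+1) degr d x.
  rewrite (bigID (fun x => lam0 x == r.+1)) /= addnC; congr (_ + _); apply: eq_bigl => x; rewrite /ball; lia.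
split=> //.
  move: sl; rewrite big_split /= sum_nat_const card_ord => sl.
  have fl : \sum_(k < size Qs) f k <= 6 * size Qs + 12 * \sum_(x <- Qs | lam0 x == r.+1) degr d x.
    have -> : 6 * size Qs = \sum_(k < size Qs) 6 by rewrite sum_nat_const card_ord mulnC.
    rewrite -sumQ big_distrr /= [X in _ <= _ + X]big_mkcond -big_split /=.
    by apply: leq_sum => j _; rewrite /f; case: ifP => _; rewrite ?addn0 // addnC.
  rewrite -/lam0 splitQ; move: sq; rewrite /small_queue -/lam0 => sq.
  have {}sl := leq_trans sl (leq_add (leq_add fl (leqnn _)) (leqnn _)).
  by lia.
exists Qs'; split=> //.
- move=> e em c1 c2 /andP[l0 l1].
  have sQ : src g d e \in Qs.
    rewrite (ex_mem ex) -/lam0; have [] := lo (src g d e); lia.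
  have [h3 h4] := lo (src g d e); have [h5 h6] := lo (dst d e).
  have lE : M1 (LAM d) (src g d e) = lam0 (src g d e) by lia.
  case: (ltngtP (lam0 (src g d e)) r.+1) => hr; last first.
  + have iQ : index (src g d e) Qs < size Qs by rewrite index_mem.
    apply: (h1 _ e iQ) => //; rewrite nth_index //.
    by rewrite mem_adj em eqxx.
  + by lia.
  have := cl e em c1 c2; rewrite -/lam0 => h7.
  have : 0 < lam0 (dst d e) <= lam0 (src g d e) + 4 * elen g e by apply: h7; lia.
  lia.
- move: h2; rewrite /small_queue.
  have -> : \sum_(j < size Qs | (j < size Qs) && (lam0 (nth 0 Qs j) == r.+1)) degr d (nth 0 Qs j) =
    \sum_(x <- Qs | lam0 x == r.+1) degr d x by rewrite -sumQ; apply: eq_bigl => j; rewrite ltn_ord.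
  have : \sum_(x <- Qs | ball lam0 r x) degr d x <= \sum_(x <- Qs' | 0 < M1 (LAM d) x <= r.+1) degr d x.
    case/prefixP: pf => t ->; rewrite big_cat /=; apply: leq_trans (leq_addr _ _).
    rewrite (eq_bigl (fun x => 0 < M1 (LAM d) x <= r.+1)) // => x.
    by rewrite -/(ball (M1 (LAM d)) r x) (lower_ball lo).
  by move: sq; rewrite splitQ /small_queue -/lam0; lia.
Qed.

End Explore.

(** * Enumerating the boundary of a ball *)

Definition in_ball d x := leE (Get (LAM d) x) (succ_ (var (LEV d))).
Definition out_ball d x := orE (eqE (Get (LAM d) x) (Cst 0)) (ltE (succ_ (var (LEV d))) (Get (LAM d) x)).
Definition in_part x := eqE (Get COMP x) (var CQ).

(** Shared by measuring a cut and by recording it. Inside this loop [in_ball] need not exclude the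
    label 0, since queued vertices have positive labels. *)
Definition crossloop d (body : cmd) : cmd :=
  For I1 (QL d)
    (Seq (Set_ VX (Get (QQ d) (var I1)))
      (If (andE (in_ball d (var VX)) (in_part (var VX)))
        (ForChain VE (Get (FST d) (var VX)) (NXT d)
          (Seq (Set_ VY (Get (SRC (~~ d)) (pred_ (var VE))))
            (If (andE (in_part (var VY)) (out_ball d (var VY))) body Skip)))
        Skip)).

Definition measure d : cmd :=
  Seq (Set_ DEL (Cst 0))
    (crossloop d (Set_ DEL (Bin Add (var DEL) (Get WT (pred_ (var VE)))))).

Definition mark d : cmd :=
  crossloop d (Put 5 (Bin Add (var ROW) (pred_ (var VE))) (Cst 1)).

Notation static_arrays := [:: 0; 1; 2; 3; 6; 7; 8; 9; 10; 11].
Notation loop_vars := [:: I1; VX; VE; VY].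

Section Crossing.
Variables (B : nat) (g : graph).
Hypothesis B_gt0 : 0 < B.
Notation n := (nv g).
Notation m := (ne g).
Notation dst d := (src g (~~ d)).
Notation crosses := (crosses g).
Notation adj := (adj g).
Notation degr := (degr g).
Notation static := (static g).

Lemma static_agree xs M M' : all (fun a => a \notin xs) static_arrays ->
  agree xs M M' -> static M -> static M'.
Proof.
move=> /allP hx ag [h1 h2 h3 h4 h5]; split=> [|d e|e|d x|d x].
- by rewrite ag ?h1 // hx.
- by move=> em; rewrite ag ?h2 // hx //; case: d.
- by move=> em; rewrite ag ?h3 // hx.
- by move=> xn; rewrite !ag; [exact: h4 | apply: hx; case: d | apply: hx; case: d].
- by move=> xn; rewrite ag ?h5 // hx //; case: d.
Qed.

(** The crossing edges in the order in which [crossloop] meets them. *)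
Definition crosslist d C lam r (Qs : seq nat) :=
  flatten [seq [seq e <- adj d x | crosses d C (ball lam r) e] | x <- Qs].

Lemma mem_crosslist d C lam r (Qs : seq nat) e :
  (forall x, ball lam r x -> x \in Qs) ->
  (e \in crosslist d C lam r Qs) = (e < m) && crosses d C (ball lam r) e.
Proof.
move=> hQ; apply/flattenP/andP => [[s /mapP[x xQ ->]]|[em ce]].
  by rewrite mem_filter mem_adj => /and3P[ce em _].
exists [seq e <- adj d (src g d e) | crosses d C (ball lam r) e].
  by apply/map_f/hQ; case/and4P: ce.
by rewrite mem_filter ce mem_adj em eqxx.
Qed.

Lemma sum_crosslist d C lam r (Qs : seq nat) (F : nat -> nat) : uniq Qs ->
  (forall x, ball lam r x -> x \in Qs) -> (forall x, x \in Qs -> x < n) ->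
  \sum_(e <- crosslist d C lam r Qs) F e = \sum_(e < m | crosses d C (ball lam r) e) F e.
Proof.
move=> uQ hQ Qn; rewrite big_flatten big_map.
under eq_bigr => x _ do rewrite big_filter big_mkcond sum_adj.
have -> : \sum_(e < m | crosses d C (ball lam r) e) F e =
    \sum_(e < m | (fun x => x \in Qs) (src g d e)) if crosses d C (ball lam r) e then F e else 0.
  rewrite big_mkcond [RHS]big_mkcond; apply: eq_bigr => e _ /=.
  by case: ifP => [/and4P[_ _ /hQ -> _]|] //; case: ifP.
rewrite (sum_src g d (fun x => x \in Qs) (fun e => if crosses d C (ball lam r) e then F e else 0)).
rewrite -(big_mkord (fun x => x \in Qs) (fun x => \sum_(e < m | src g d e == x) if crosses d C (ball lam r) e then F e else 0)).
rewrite -[RHS]big_filter; apply: perm_big; apply: uniq_perm => //.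
  by rewrite filter_uniq // iota_uniq.
move=> x; rewrite mem_filter mem_index_iota /=; case xQ: (x \in Qs) => //=.
by rewrite Qn.
Qed.

(** Indexing the invariant by the processed prefix of [crosslist] hides the edges that do not
    cross. *)
Lemma wp_crossloop d M C (Qs : seq nat) r body cb xs (J : seq nat -> memory -> Prop) (Q : nat -> memory -> Prop) :
  static M -> qrep d Qs M -> (forall x, x \in Qs -> x < n /\ 0 < M (LAM d) x) ->
  C = (fun z => M COMP z == M CQ 0) -> M (LEV d) 0 = r ->
  all (fun a => a \notin xs) (static_arrays ++ loop_vars ++ [:: LAM d; QQ d; QL d; LEV d; COMP; CQ]) ->
  J [::] M ->
  (forall l M1, J l M1 -> agree (xs ++ loop_vars) M M1) ->
  (forall l M1 a p, a \in loop_vars -> J l M1 -> J l (update M1 a 0 p)) ->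
  (forall l e l' M1, J l M1 -> M1 VE 0 = e.+1 -> e < m -> crosses d C (ball (M (LAM d)) r) e ->
     crosslist d C (M (LAM d)) r Qs = l ++ e :: l' ->
    wp B body M1 (fun s M2 => [/\ s <= cb, agree xs M1 M2 & J (rcons l e) M2])) ->
  (forall s M1, s <= (cb + 20) * (\sum_(x <- Qs | ball (M (LAM d)) r x) degr d x + size Qs + 1) ->
     J (crosslist d C (M (LAM d)) r Qs) M1 -> Q s M1) ->
  wp B (crossloop d body) M Q.
Proof.
move=> st [ql qq] hQ CE lev xsP J0 Jag Jup hbody hend.
set lam := M (LAM d).
have nx a : a \in static_arrays ++ loop_vars ++ [:: LAM d; QQ d; QL d; LEV d; COMP; CQ] -> a \notin xs.
  by move/allP: xsP => h /h.
have rd l M1 a : J l M1 -> a \in static_arrays ++ [:: LAM d; QQ d; QL d; LEV d; COMP; CQ] -> M1 a = M a.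
  move=> /Jag ag ha; rewrite ag //; rewrite mem_cat negb_or nx ?andTb.
    by clear -ha; move: ha; rewrite !inE; case: d; do ![case/orP => [/eqP ->//|]] => /eqP ->.
  by move: ha; rewrite !mem_cat => /orP[->|->]; rewrite ?orbT.
pose L i := flatten [seq [seq e <- adj d x | crosses d C (ball lam r) e] | x <- take i Qs].
pose f i := if ball lam r (nth 0 Qs i) then (cb + 7) * degr d (nth 0 Qs i) + 6 else 6.
apply: (wp_for B_gt0 (J := fun i M1 => J (L i) M1) (f := f) (N := size Qs)) => //.
- by case: (d).
- by rewrite /L take0.
- by move=> k M1 p; apply: Jup.
- move=> k M1 kQ Jk i1.
  set x := nth 0 Qs k.
  have [xn lx0] : x < n /\ 0 < lam x by apply: hQ; rewrite mem_nth.
  have LS : L k.+1 = L k ++ [seq e <- adj d x | crosses d C (ball lam r) e].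
    by rewrite /L (take_nth 0 kQ) map_rcons flatten_rcons.
  have r1 a : a \in static_arrays ++ [:: LAM d; QQ d; QL d; LEV d; COMP; CQ] -> M1 a = M a by apply: rd Jk.
  apply: wp_seq; wset => /=; upds; rewrite i1; first by move=> bM; apply: bM.
  rewrite (r1 (QQ d)) ?qq -/x //; last by case: (d).
  wif; rewrite /in_part /in_ball /out_ball !condE /=; upds; rewrite !(r1 (LAM d), r1 (LEV d), r1 COMP, r1 CQ) //; try by case: (d).
  rewrite lev addn1.
  have -> : (lam x <= r.+1) && (M COMP x == M CQ 0) = ball lam r x && C x.
    by rewrite CE /ball lx0.
  have J1 p : J (L k) (update M1 VX 0 p) by apply: Jup.
  have QLE M2 l : J l M2 -> M2 (QL d) 0 = size Qs.
    by move=> J2; rewrite (rd _ _ _ J2) //; case: (d).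
  case: ifP => [/andP[bx Cx]|ncx]; last first.
    wskip; split; [|by upds|by rewrite (QLE _ _ (J1 _))|].
      by rewrite /f; case: ifP => _; lia.
    rewrite LS [X in L k ++ X](_ : _ = [::]) ?cats0; first exact: J1.
    apply/eqP; rewrite -[_ == _]negbK -has_filter; apply/hasPn => e.
    rewrite mem_adj => /andP[_ /eqP se]; apply/negP => /and4P[].
    by rewrite se => c1 c2 c3 _; rewrite c1 c3 in ncx.
  pose J2 (l : seq nat) M2 := [/\ exists2 l0, adj d x = l0 ++ l & J (L k ++ [seq e <- l0 | crosses d C (ball lam r) e]) M2,
     M2 I1 0 = k & M2 VX 0 = x].
  apply: (wp_forchain B_gt0 (J := J2) (f := fun=> cb + 5) (nx := M (NXT d)) (l := adj d x)).
  + by neqarr.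
  + by move=> l' M2 [[l0 _ h] _ _]; rewrite (rd _ _ (NXT d) h) //; case: (d).
  + rewrite /=; upds; rewrite (r1 (FST d)); last by case: (d).
    exact: st_adj st _ _ xn.
  + by rewrite /=; move=> bM; apply: bM.
  + split; [|by upds|by upds]; exists [::] => //; rewrite cats0; exact: J1.
  + move=> l' M2 p [[l0 al h1] h2 h3]; split; [|by upds|by upds].
    by exists l0 => //; apply: Jup.
  + move=> e l' M2 [[l0 al h1] h2 h3] ve.
    have : e \in adj d x by rewrite al mem_cat mem_head orbT.
    rewrite mem_adj => /andP[em /eqP sx].
    have r2 a : a \in static_arrays ++ [:: LAM d; QQ d; QL d; LEV d; COMP; CQ] -> M2 a = M a by apply: rd h1.
    apply: wp_seq; wset => /=; first by move=> bM; apply: bM.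
    rewrite ve subn1 /= (r2 (SRC (~~ d))); last by case: (d).
    rewrite (st_src st _ em); set y := dst d e.
    wif; rewrite /in_part /in_ball /out_ball !condE /=; upds; rewrite !(r2 (LAM d), r2 (LEV d), r2 COMP, r2 CQ) //; try by case: (d).
    rewrite lev addn1.
    have -> : (M COMP y == M CQ 0) && ((M (LAM d) y == 0) || (r.+1 < M (LAM d) y)) =
       crosses d C (ball lam r) e.
      rewrite /crosses sx -/y Cx bx /= CE /ball -/lam; case: (_ == _) => //=; lia.
    have J3 : J (L k ++ [seq e <- l0 | crosses d C (ball lam r) e]) (update M2 VY 0 y) by apply: Jup.
    case: ifP => ce; last first.
      wskip; split; [lia | by upds |]; split; [|by upds|by upds].
      exists (rcons l0 e); first by rewrite al cat_rcons.
      by rewrite filter_rcons ce.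
    have ve' : update M2 VY 0 y VE 0 = e.+1 by upds.
    have cE : crosslist d C lam r Qs = (L k ++ [seq e <- l0 | crosses d C (ball lam r) e]) ++
        e :: ([seq e <- l' | crosses d C (ball lam r) e] ++
              flatten [seq [seq e <- adj d x | crosses d C (ball lam r) e] | x <- drop k.+1 Qs]).
      rewrite -[in LHS](cat_take_drop k.+1 Qs) /crosslist map_cat flatten_cat -/(L k.+1) LS al.
      by rewrite filter_cat /= ce !catA -!catA.
    apply: wp_conseq (hbody _ _ _ _ J3 ve' em ce cE) _ => s M3 [sl ag3 J4].
    split; [lia | by rewrite ag3 ?nx //; upds |].
    split; [|by rewrite ag3 ?nx //; upds|by rewrite ag3 ?nx //; upds].
    exists (rcons l0 e); first by rewrite al cat_rcons.
    by rewrite filter_rcons ce -cats1 catA cats1.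
  + move=> s M2 sl [[l0 al h1] h2 h3].
    move: al; rewrite cats0 => al.
    split=> //; last by rewrite LS al.
      rewrite /f -/x bx; move: sl; rewrite big_const_seq count_predT iter_addn_0 -/(degr d x); lia.
    by rewrite (QLE _ _ h1).
move=> s M1 sl; rewrite /L take_size => J1; apply: hend => //; apply: leq_trans sl _.
rewrite big_split /= sum_nat_const card_ord.
have fl : \sum_(k < size Qs) f k <= 6 * size Qs + (cb + 7) * \sum_(x <- Qs | ball lam r x) degr d x.
  have -> : 6 * size Qs = \sum_(k < size Qs) 6 by rewrite sum_nat_const card_ord mulnC.
  rewrite (big_nth 0) big_mkord big_distrr /= [X in _ <= _ + X]big_mkcond -big_split /=.
  by apply: leq_sum => j _; rewrite /f; case: ifP => _; rewrite ?addn0 // addnC.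
apply: leq_trans (leq_add (leq_add fl (leqnn _)) (leqnn _)) _.
rewrite -/lam; move: (\sum_(x <- Qs | ball lam r x) _) => S; nia.
Qed.

End Crossing.

(** * Volumes and relabelling of balls and of their complements *)

Definition listloop (se : expr) (hi : nat) (cond : expr) (body : cmd) : cmd :=
  For I1 hi (Seq (Set_ VX se) (If cond body Skip)).

Definition queue_item d := Get (QQ d) (var I1).
(** Segments of [LL] are never rewritten: a vertex that moves to another part stays listed in the
    old segment and must be filtered out by [in_part]. *)
Definition part_item := Get LL (Bin Add (Get ST (var CQ)) (var I1)).

Definition scan_ball d : cmd :=
  Seq (Set_ (AA d) (Cst 0)) (Seq (Set_ (DG d) (Cst 0))
    (listloop (queue_item d) (QL d) (in_ball d (var VX))
      (Seq (Set_ (AA d) (Bin Add (var (AA d)) (Get MU (var VX))))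
           (Set_ (DG d) (Bin Add (var (DG d)) (Get (DEG d) (var VX))))))).

Definition scan_complement d : cmd :=
  Seq (Set_ AC (Cst 0))
    (listloop part_item N1 (andE (in_part (var VX)) (out_ball d (var VX)))
      (Set_ AC (Bin Add (var AC) (Get MU (var VX))))).

Definition move_vertex : cmd :=
  Seq (Put COMP (var VX) (var NP))
    (Seq (Put LL (var TOP) (var VX)) (Set_ TOP (succ_ (var TOP)))).

Definition relabel_ball d : cmd :=
  listloop (queue_item d) (QL d) (in_ball d (var VX)) move_vertex.

Definition relabel_complement d : cmd :=
  listloop part_item N1 (andE (in_part (var VX)) (out_ball d (var VX))) move_vertex.

(** Resetting only the labels of queued vertices keeps the cost of an exploration independent of
    [n]. *)
Definition cleanup d : cmd :=
  Seq (listloop (queue_item d) (QL d) (Cst 1) (Put (LAM d) (var VX) (Cst 0)))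
    (Set_ (QL d) (Cst 0)).

Definition log_ratio (a : expr) : cmd :=
  Seq (Set_ YY (Bin Div (var VV) a)) (Seq (Set_ JJ (Cst 0))
    (While (Bin Div (var YY) (Cst 2))
      (Seq (Set_ YY (Bin Div (var YY) (Cst 2))) (Set_ JJ (succ_ (var JJ)))))).

(** The inequality [cheap], with the logarithm that [log_ratio] has left in [JJ]. *)
Definition cut_test (a : expr) : expr :=
  leE (Bin Mul (var DEL) (Get 0 (Cst 2)))
      (Bin Mul (Bin Mul (Bin Mul (Cst 4) (var HH)) a) (var JJ)).

Section ListLoops.
Variables (B : nat) (g : graph).
Hypothesis B_gt0 : 0 < B.
Notation n := (nv g).
Notation degr := (degr g).
Notation static := (static g).

Lemma wp_listloop se hi cond body M (Ls : seq nat) (P : pred nat) cb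
    (J : seq nat -> memory -> Prop) (Q : nat -> memory -> Prop) :
  hi != I1 ->
  (forall x, x \in Ls -> x < 2 ^ B) ->
  (forall l M1, J l M1 -> M1 hi 0 = size Ls) ->
  (forall l M1, J l M1 -> M1 I1 0 = size l -> size l < size Ls -> expr_val M1 se = nth 0 Ls (size l)) ->
  (forall l M1 a p, a \in [:: I1; VX] -> J l M1 -> J l (update M1 a 0 p)) ->
  (forall l x l' M1, J l M1 -> M1 VX 0 = x -> Ls = l ++ x :: l' ->
     (expr_val M1 cond != 0) = P x /\
     if P x then wp B body M1 (fun s M2 => [/\ s <= cb, M2 I1 0 = M1 I1 0 & J (rcons l x) M2])
     else J (rcons l x) M1) ->
  J [::] M ->
  (forall s M1, s <= (cb + 6) * (size Ls).+1 -> J Ls M1 -> Q s M1) ->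
  wp B (listloop se hi cond body) M Q.
Proof.
move=> hi1 LB Jhi Jse Jup hbody J0 hQ.
apply: (wp_for B_gt0 (J := fun i M1 => J (take i Ls) M1) (f := fun=> cb + 3) (N := size Ls)) => //.
- exact: Jhi J0.
- by rewrite take0.
- by move=> k M1 p; apply: Jup.
- move=> k M1 kL Jk i1.
  have sk : size (take k Ls) = k by rewrite size_takel // ltnW.
  have LE : Ls = take k Ls ++ nth 0 Ls k :: drop k.+1 Ls by rewrite -drop_nth // cat_take_drop.
  have vE : expr_val M1 se = nth 0 Ls k by rewrite (Jse _ _ Jk) ?sk.
  apply: wp_seq; wset; rewrite vE; first by move=> _; rewrite LB // mem_nth.
  have Jk' : J (take k Ls) (update M1 VX 0 (nth 0 Ls k)) by apply: Jup.
  have [] := hbody _ _ _ _ Jk' _ LE; first by upds.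
  rewrite -(take_nth 0 kL) => cE hb; wif; rewrite cE; move: hb; case: ifP => _ hb.
    apply: wp_conseq hb _ => s M2 [sl i2 J2].
    by split; [lia | rewrite i2; upds | exact: Jhi J2 | exact: J2].
  wskip; split; [lia | by upds | exact: Jhi hb | exact: hb].
move=> s M1 sl; rewrite take_size => J1; apply: hQ => //; apply: leq_trans sl _.
by rewrite sum_nat_const card_ord; lia.
Qed.

Lemma wp_scan_ball d M (Qs : seq nat) r (muf : nat -> nat) :
  static M -> qrep d Qs M -> (forall x, x \in Qs -> x < n) -> n < 2 ^ B -> M (LEV d) 0 = r ->
  (forall x, x < n -> M MU x = muf x) ->
  \sum_(x <- Qs) muf x < 2 ^ B -> \sum_(x <- Qs) degr d x < 2 ^ B ->
  wp B (scan_ball d) M (fun s M' =>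
    [/\ s <= 10 * (size Qs).+1, agree [:: AA d; DG d; I1; VX] M M',
     M' (AA d) 0 = \sum_(x <- Qs | M (LAM d) x <= r.+1) muf x &
     M' (DG d) 0 = \sum_(x <- Qs | M (LAM d) x <= r.+1) degr d x]).
Proof.
move=> st [ql qq] hQ nB lev muE muB dgB.
have psum (F : nat -> nat) (l : seq nat) x l' : Qs = l ++ x :: l' -> \sum_(y <- Qs) F y < 2 ^ B ->
    \sum_(y <- l | M (LAM d) y <= r.+1) F y + F x < 2 ^ B.
  move=> -> ; rewrite big_cat big_cons /=; apply: leq_trans; rewrite ltnS addnA.
  apply: leq_trans (leq_addr _ _); rewrite leq_add2r big_mkcond; apply: leq_sum => y _.
  by case: ifP.
apply: wp_seq; wset => /=; first by rewrite expn_gt0.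
apply: wp_seq; wset => /=; first by rewrite expn_gt0.
apply: (wp_listloop (Ls := Qs) (P := fun x => M (LAM d) x <= r.+1) (cb := 2)
  (J := fun l M1 => [/\ agree [:: AA d; DG d; I1; VX] M M1,
     M1 (AA d) 0 = \sum_(x <- l | M (LAM d) x <= r.+1) muf x &
     M1 (DG d) 0 = \sum_(x <- l | M (LAM d) x <= r.+1) degr d x])).
- by neqarr.
- by move=> x /hQ h; apply: ltn_trans h nB.
- by move=> l M1 [ag _ _]; rewrite ag //; neqarr.
- move=> l M1 [ag _ _] i1 il; rewrite /= i1 ag ?qq //; neqarr.
- move=> l M1 a p ha [ag h1 h2]; split.
  + by apply: agree_update => //; move: ha; rewrite !inE => /orP[->|->]; rewrite !orbT.
  + by rewrite updN //; clear -ha; move: ha; rewrite !inE => /orP[/eqP ->|/eqP ->]; neqarr.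
  + by rewrite updN //; clear -ha; move: ha; rewrite !inE => /orP[/eqP ->|/eqP ->]; neqarr.
- move=> l x l' M1 [ag h1 h2] vx LE.
  have xQ : x \in Qs by rewrite LE mem_cat mem_head orbT.
  split.
    by rewrite /in_ball condE /= vx (ag (LAM d)) ?(ag (LEV d)) ?lev ?addn1 //; neqarr.
  case: ifP => Px; last first.
    by split; rewrite // -cats1 big_cat big_cons big_nil /= Px addn0.
  have xn := hQ _ xQ.
  apply: wp_seq; wset => /=; rewrite vx (ag MU) ?muE ?h1; try neqarr; try exact: xn.
    by move=> _; apply: psum LE muB.
  wset => /=; upds; rewrite vx (ag (DEG d)) ?(st_deg st) ?h2; try neqarr; try exact: xn.
    by move=> _; apply: psum LE dgB.
  split; [by [] | by upds |].
  split; first by do 2 (apply: agree_update; first by rewrite !inE eqxx ?orbT).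
    by upds; rewrite -cats1 big_cat big_cons big_nil /= Px addn0.
  by upds; rewrite -cats1 big_cat big_cons big_nil /= Px addn0.
- split; [|by upds; rewrite big_nil|by upds; rewrite big_nil].
  by do 2 (apply: agree_update; first by rewrite !inE eqxx ?orbT).
move=> s M1 sl [h1 h2 h3]; split=> //.
move: sl; move: (size Qs) => z; lia.
Qed.

Lemma wp_scan_complement d M (Ls : seq nat) r (muf : nat -> nat) :
  (forall x, x \in Ls -> x < n) -> n < 2 ^ B -> M (LEV d) 0 = r ->
  M N1 0 = size Ls ->
  (forall i, i < size Ls -> M LL (M ST (M CQ 0) + i) = nth 0 Ls i) ->
  (forall x, x < n -> M MU x = muf x) ->
  \sum_(x <- Ls) muf x < 2 ^ B ->
  wp B (scan_complement d) M (fun s M' =>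
    [/\ s <= 10 * (size Ls).+1, agree [:: AC; I1; VX] M M' &
     M' AC 0 = \sum_(x <- Ls | (M COMP x == M CQ 0) && ~~ ball (M (LAM d)) r x) muf x]).
Proof.
move=> hL nB lev n1 llE muE muB.
apply: wp_seq; wset => /=; first by rewrite expn_gt0.
set P := fun x => (M COMP x == M CQ 0) && ~~ ball (M (LAM d)) r x.
apply: (wp_listloop (Ls := Ls) (P := P) (cb := 1)
  (J := fun l M1 => agree [:: AC; I1; VX] M M1 /\ M1 AC 0 = \sum_(x <- l | P x) muf x)).
- by [].
- by move=> x /hL h; apply: ltn_trans h nB.
- by move=> l M1 [ag _]; rewrite ag //; neqarr.
- move=> l M1 [ag _] i1 il; rewrite /= i1 (ag LL) ?(ag ST) ?(ag CQ) ?llE //; neqarr.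
- move=> l M1 a p ha [ag h1]; split.
  + by apply: agree_update => //; move: ha; rewrite !inE => /orP[->|->]; rewrite !orbT.
  + by rewrite updN //; clear -ha; move: ha; rewrite !inE => /orP[/eqP ->|/eqP ->]; neqarr.
- move=> l x l' M1 [ag h1] vx LE.
  have xL : x \in Ls by rewrite LE mem_cat mem_head orbT.
  split.
    rewrite /in_part /out_ball !condE /= vx (ag (LAM d)) ?(ag (LEV d)) ?(ag COMP) ?(ag CQ) ?lev ?addn1; try neqarr.
    by rewrite /P /ball; case: eqP => //= _; lia.
  case: ifP => Px; last first.
    by split; rewrite // -cats1 big_cat big_cons big_nil /= Px addn0.
  have xn := hL _ xL.
  wset => /=; rewrite vx (ag MU) ?muE ?h1; try neqarr; try exact: xn.
    move=> _; apply: leq_ltn_trans muB; rewrite LE big_cat big_cons /= addnA.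
    apply: leq_trans (leq_addr _ _); rewrite leq_add2r big_mkcond; apply: leq_sum => y _.
    by case: ifP.
  split; [by [] | by upds |].
  split; first by apply: agree_update; rewrite ?inE ?eqxx ?orbT.
  by upds; rewrite -cats1 big_cat big_cons big_nil /= Px addn0.
- split; [|by upds; rewrite big_nil].
  by apply: agree_update; rewrite ?inE ?eqxx ?orbT.
move=> s M1 sl [h1 h2]; split=> //.
move: sl; move: (size Ls) => z; lia.
Qed.

Definition moved (np top : nat) (F : seq nat) (M M' : memory) : Prop :=
  [/\ forall z, M' COMP z = if z \in F then np else M COMP z,
      forall j, M' LL j = if top <= j < top + size F then nth 0 F (j - top) else M LL j &
      M' TOP 0 = top + size F].

Lemma wp_move_vertex M M1 np top F x :
  M NP 0 = np -> M TOP 0 = top -> top + size F < 2 ^ B -> (top + size F).+1 < 2 ^ B ->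
  agree [:: COMP; LL; TOP; I1; VX] M M1 -> moved np top F M M1 -> M1 VX 0 = x ->
  wp B move_vertex M1 (fun s M2 => [/\ s <= 3, M2 I1 0 = M1 I1 0 &
    agree [:: COMP; LL; TOP; I1; VX] M M2 /\ moved np top (rcons F x) M M2]).
Proof.
move=> npE topE tB tB1 ag [h1 h2 h3] vx.
apply: wp_seq; wput => /=; first by move=> bM; apply: bM.
apply: wp_seq; wput => /=; upds; first by move=> bM; have := bM VX 0; upds.
rewrite h3 vx (ag NP) // npE.
wset => /=; upds; rewrite h3; first by rewrite addn1.
split; [by [] | by upds | split].
  by do !(apply: agree_update; first by rewrite !inE ?eqxx ?orbT).
split=> [z|j|]; upds.
- by rewrite /fupd mem_rcons inE h1; case: eqP.
- rewrite /fupd h2 size_rcons nth_rcons; move: (size F) (nth 0 F) => z nF.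
  case: (ltngtP j (top + z)) => jt.
  + have -> : j < top + z.+1 by lia.
    case: (leqP top j) => //= tj; have -> : j - top < z by lia.
    by [].
  + have -> : j < top + z.+1 = false by lia.
    by rewrite !andbF.
  + have -> : j < top + z.+1 by lia.
    by rewrite jt leq_addr addKn ltnn eqxx.
- by rewrite size_rcons addn1 addnS.
Qed.

(** The condition is evaluated after the vertices [F] have been moved. As [Ls] is free of
    repetitions, the vertex under consideration is not among them, so its own entry of [COMP] is
    still the old one. *)
Lemma wp_relabel (M : memory) se (hi : nat) cond (Ls : seq nat) (P : pred nat) np top :
  hi \notin [:: COMP; LL; TOP; I1; VX] -> (forall x, x \in Ls -> x < 2 ^ B) -> uniq Ls ->
  M hi 0 = size Ls -> M NP 0 = np -> M TOP 0 = top -> (top + size Ls) < 2 ^ B ->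
  (forall M1 F (l : seq nat), agree [:: COMP; LL; TOP; I1; VX] M M1 -> moved np top F M M1 -> M1 I1 0 = size l ->
     size l < size Ls -> expr_val M1 se = nth 0 Ls (size l)) ->
  (forall M1 F x, agree [:: COMP; LL; TOP; I1; VX] M M1 -> moved np top F M M1 -> M1 VX 0 = x ->
     x \in Ls -> x \notin F -> (expr_val M1 cond != 0) = P x) ->
  wp B (listloop se hi cond move_vertex) M (fun s M' =>
    [/\ s <= 9 * (size Ls).+1, agree [:: COMP; LL; TOP; I1; VX] M M' &
     moved np top [seq x <- Ls | P x] M M']).
Proof.
move=> hiN LB uL hiE npE topE tB seE condP.
apply: (wp_listloop (Ls := Ls) (P := P) (cb := 3)
  (J := fun l M1 => agree [:: COMP; LL; TOP; I1; VX] M M1 /\ moved np top [seq x <- l | P x] M M1)).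
- by apply: contraNneq hiN => ->.
- exact: LB.
- by move=> l M1 [ag _]; rewrite ag.
- by move=> l M1 [ag mv] i1 il; apply: seE ag mv i1 il.
- move=> l M1 a p ha [ag [h1 h2 h3]]; split.
    by apply: agree_update => //; move: ha; rewrite !inE => /orP[->|->]; rewrite !orbT.
  have aN b : b \in [:: COMP; LL; TOP] -> b != a.
    by clear -ha; move: ha; rewrite !inE => /orP[/eqP ->|/eqP ->] /or3P[] /eqP ->.
  by split=> *; rewrite updN ?aN.
- move=> l x l' M1 [ag mv] vx LE.
  have xL : x \in Ls by rewrite LE mem_cat mem_head orbT.
  have xF : x \notin [seq x <- l | P x].
    rewrite mem_filter negb_and; apply/orP; right.
    by move: uL; rewrite LE cat_uniq => /and3P[_ /norP[]].
  split; first exact: condP ag mv vx xL xF.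
  case: ifP => Px; last by rewrite filter_rcons Px.
  have sl : (size [seq x <- l | P x]) < size Ls.
    by rewrite LE size_cat /= -addSnnS; apply: leq_trans (leq_addr _ _); rewrite ltnS size_filter count_size.
  have t1 : top + size [seq x <- l | P x] < 2 ^ B by apply: leq_ltn_trans tB; rewrite leq_add2l ltnW.
  have t2 : (top + size [seq x <- l | P x]).+1 < 2 ^ B by apply: leq_ltn_trans tB; rewrite -addnS leq_add2l.
  apply: wp_conseq (wp_move_vertex npE topE t1 t2 ag mv vx) _ => s M2 [h1 h2 [h3 h4]].
  by split=> //; split=> //; rewrite filter_rcons Px.
- split=> //; split=> //= [j|]; last by rewrite addn0.
  by rewrite addn0; case: ltngtP.
by move=> s M1 sl [ag mv]; split.
Qed.

Lemma wp_cleanup d M (Qs : seq nat) : qrep d Qs M -> (forall x, x \in Qs -> x < 2 ^ B) ->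
  wp B (cleanup d) M (fun s M' => [/\ s <= 10 * (size Qs).+1,
    agree [:: LAM d; QL d; I1; VX] M M' &
    forall z, M' (LAM d) z = if z \in Qs then 0 else M (LAM d) z]).
Proof.
move=> [ql qq] LB; apply: wp_seq.
apply: (wp_listloop (Ls := Qs) (P := predT) (cb := 1)
  (J := fun l M1 => agree [:: LAM d; I1; VX] M M1 /\
     forall z, M1 (LAM d) z = if z \in l then 0 else M (LAM d) z)).
- by neqarr.
- exact: LB.
- by move=> l M1 [ag _]; rewrite ag //; neqarr.
- by move=> l M1 [ag _] i1 il; rewrite /= i1 ag ?qq //; neqarr.
- move=> l M1 a p ha [ag h1]; split.
    by apply: agree_update => //; move: ha; rewrite !inE => /orP[->|->]; rewrite !orbT.
  by move=> z; rewrite updN //; clear -ha; move: ha; rewrite !inE => /orP[/eqP ->|/eqP ->]; neqarr.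
- move=> l x l' M1 [ag h1] vx LE; split=> //=.
  wput => /=; first by rewrite expn_gt0.
  split; [by []|by upds|split].
    by apply: agree_update; rewrite ?inE ?eqxx ?orbT.
  by move=> z; upds; rewrite /fupd vx mem_rcons inE h1; case: eqP.
- by split.
move=> s M1 sl [ag h1]; wset => /=; first by rewrite expn_gt0.
split.
- by move: sl; move: (size Qs) => *; lia.
- apply: agree_update; first by rewrite !inE eqxx ?orbT.
  apply: agree_sub ag; by sublist.
- by move=> z; upds.
Qed.

Lemma wp_log_ratio a M V A : M VV 0 = V -> expr_val M a = A ->
  (bounded B M -> A < 2 ^ B) ->
  wp B (log_ratio a) M (fun s M' => [/\ s <= 3 * (trunc_log 2 (V %/ A)) + 3,
    agree [:: YY; JJ] M M' & M' JJ 0 = trunc_log 2 (V %/ A)]).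
Proof.
move=> vE aE aB; apply: (wp_bounded (B := B)) => bM.
have qB : V %/ A < 2 ^ B by apply: leq_ltn_trans (leq_div _ _) _; rewrite -vE.
apply: wp_seq; wset => /=; rewrite vE aE //.
apply: wp_seq; wset => /=; first by rewrite expn_gt0.
set y0 := V %/ A.
have lB : trunc_log 2 y0 < 2 ^ B.
  apply: leq_ltn_trans qB; rewrite -/y0; case: (posnP y0) => [->|y00]; first by rewrite trunc_log0.
  by apply: leq_trans (ltnW (ltn_expl _ (isT : 1 < 2))) (trunc_logP _ y00).
apply: (wp_while B_gt0 (I := fun k s M1 => exists y, [/\ agree [:: YY; JJ] M M1, M1 YY 0 = y, k = trunc_log 2 y,
   M1 JJ 0 + k = trunc_log 2 y0 & s = 3 * M1 JJ 0]) (k0 := trunc_log 2 y0)).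
- exists y0; upds; split=> //.
  by do !(apply: agree_update; first by rewrite !inE ?eqxx ?orbT).
- move=> k s M1 [y [ag yE kE je sE]] /=; rewrite yE divn2 => h.
  have y1 : 1 < y by move: h; case: (y) => [|[]].
  rewrite trunc_log2S // in kE.
  apply: wp_seq; wset => /=; rewrite yE divn2.
    move=> bM1; apply: leq_ltn_trans (bM1 YY 0); rewrite yE; lia.
  wset => /=; upds; first by move=> _; move: je lB; rewrite kE; lia.
  exists (trunc_log 2 y./2); first by rewrite kE.
  exists y./2; upds; split=> //; [|lia|lia].
  by do !(apply: agree_update; first by rewrite !inE ?eqxx ?orbT).
- move=> k s M1 [y [ag yE kE je sE]] /=; rewrite yE divn2 => h.
  have k0 : k = 0 by rewrite kE; move: h; case: (y) => [|[]].
  by split; [lia | by [] | lia].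
Qed.

End ListLoops.

(** * A single step of an exploration *)

Definition settle d : cmd :=
  Seq (scan_ball d) (Set_ (BIG d) (leE (succ_ (var VV)) (Bin Mul (Cst 2) (var (AA d))))).

Definition start d : cmd :=
  Seq (Put (LAM d) (var CX) (Cst 1)) (Seq (Put (QQ d) (Cst 0) (var CX))
    (Seq (Set_ (QL d) (Cst 1)) (Seq (Set_ (LEV d) (Cst 0)) (settle d)))).

(** [FND] is set to [d.+1], so that 0 is left for the case that no cut has been found. *)
Definition step d : cmd :=
  Seq (relax d) (Seq (measure d) (Seq (log_ratio (var (AA d)))
    (If (cut_test (var (AA d))) (Set_ FND (Cst d.+1))
      (Seq (Set_ (LEV d) (succ_ (var (LEV d)))) (settle d))))).

Notation step_mods d := [:: LAM d; QQ d; QL d; VY; NL; VX; VE; I1; N1; DEL; AA d; DG d; BIG d; LEV d; FND; YY; JJ].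

Section Step.
Variables (B : nat) (g : graph) (w : nat -> nat) (beta D Lm : nat).
Notation n := (nv g).
Notation m := (ne g).
Notation crosses := (crosses g).
Notation degr := (degr g).
Notation static := (static g).
Notation mu := (mu g w beta).
Notation vol := (vol g w beta).
Notation cutw := (cutw g w).
Notation closed := (closed g).
Notation explored := (explored g).
Notation small_queue := (small_queue g).
Notation h := (bits Lm).

(** Everything that a round computes fits into [B] bits. [b_Lm] bounds the binary logarithm of the
    ratio between the total volume and any nonzero volume, hence the number of levels. *)
Record bounds : Prop := Bounds {
  b_B : 0 < B;
  b_D : 0 < D;
  b_D2 : 2 * D + 2 < 2 ^ B;
  b_n : n < 2 ^ B;
  b_m : m < 2 ^ B;
  b_len : forall e, e < m -> 2 * D + 4 * elen g e + 2 < 2 ^ B;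
  b_vol : vol predT < 2 ^ B;
  b_w : \sum_(e < m) w e < 2 ^ B;
  b_Lm : forall U l, 0 < vol U -> vol U * 2 ^ l <= vol predT -> l <= Lm }.

Record round_static (M : memory) : Prop := RoundStatic {
  rs_static : static M;
  rs_D : M 0 2 = D;
  rs_wt : forall e, e < m -> M WT e = w e;
  rs_mu : forall x, x < n -> M MU x = mu x;
  rs_h : M HH 0 = h }.

Definition round_arrays := static_arrays ++ [:: WT; MU; HH].

Lemma round_static_agree xs M M' : all (fun a => a \notin xs) round_arrays ->
  agree xs M M' -> round_static M -> round_static M'.
Proof.
move=> hx ag [h1 h2 h3 h4 h5].
have nx a : a \in round_arrays -> a \notin xs by move/allP: hx => h /h.
split=> [|||x xn|]; rewrite ?(ag, nx) //; [|exact: h4..].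
by apply: static_agree ag h1; move: hx; rewrite all_cat => /andP[].
Qed.

Lemma sum_w_vol (F : nat -> nat) (P : pred nat) (Qs : seq nat) :
  uniq Qs -> (forall x, x \in Qs -> x < n) -> (forall x, P x -> x \in Qs) ->
  \sum_(x <- Qs | P x) F x = \sum_(x < n | P x) F x.
Proof.
move=> uQ Qn PQ; rewrite -(big_mkord P F) -[RHS]big_filter -big_filter.
apply: perm_big; apply: uniq_perm; [by rewrite filter_uniq | by rewrite filter_uniq ?iota_uniq |].
move=> x; rewrite !mem_filter mem_index_iota /=; case Px: (P x) => //=.
by rewrite PQ // Qn // PQ.
Qed.

Lemma sum_degr d (P : pred nat) : \sum_(x < n | P x) degr d x = \sum_(e < m | P (src g d e)) 1.
Proof.
rewrite (sum_src g d P (fun=> 1)); apply: eq_bigr => x _.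
by rewrite -(sum_adj g d x (fun=> 1)) sum1_size.
Qed.

Lemma sum_degr_le d (P : pred nat) : \sum_(x < n | P x) degr d x <= m.
Proof.
rewrite sum_degr big_mkcond -[X in _ <= X]card_ord -sum1_card.
by apply: leq_sum => e _; case: ifP.
Qed.

Hypothesis bd : bounds.

Lemma lg_le V (U : pred nat) : V <= vol predT -> 0 < vol U -> trunc_log 2 (V %/ vol U) <= Lm.
Proof.
move=> VV0 U0; case: (posnP (V %/ vol U)) => [->|q0]; first by rewrite trunc_log0.
apply: (b_Lm bd U0); apply: leq_trans VV0; apply: leq_trans (leq_divM V (vol U)).
by rewrite mulnC leq_mul2r trunc_logP ?orbT.
Qed.

Lemma lg_le0 V (U : pred nat) : V <= vol predT -> trunc_log 2 (V %/ vol U) <= Lm.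
Proof.
move=> VV0; case: (posnP (vol U)) => [->|]; [by rewrite divn0 trunc_log0 | exact: lg_le].
Qed.

Lemma vol_le U : vol U <= vol predT.
Proof. exact: vol_sub. Qed.

Lemma wp_measure d M C (Qs : seq nat) r :
  round_static M -> qrep d Qs M -> uniq Qs -> (forall x, (x \in Qs) = (0 < M (LAM d) x)) ->
  (forall x, x \in Qs -> x < n) ->
  C = (fun z => M COMP z == M CQ 0) -> M (LEV d) 0 = r ->
  wp B (measure d) M (fun s M' =>
    [/\ s <= 30 * (\sum_(x <- Qs | ball (M (LAM d)) r x) degr d x + size Qs + 1),
        agree [:: DEL; I1; VX; VE; VY] M M' & M' DEL 0 = cutw d C (ball (M (LAM d)) r)]).
Proof.
move=> rs qr uQ QE Qn CE lev; have B_gt0 := b_B bd.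
apply: wp_seq; wset => /=; first by rewrite expn_gt0.
set M0 := update _ _ _ _.
have ag0 : agree [:: DEL; I1; VX; VE; VY] M M0 by agr.
have rs0 : round_static M0 by apply: round_static_agree rs; [|exact: ag0].
have e0 a : a \notin [:: DEL; I1; VX; VE; VY] -> M0 a = M a by apply: ag0.
have lamE : M0 (LAM d) = M (LAM d) by rewrite e0 //; neqarr.
have QE' x : ball (M (LAM d)) r x -> x \in Qs by rewrite QE => /andP[].
have sumE : \sum_(e <- crosslist g d C (M (LAM d)) r Qs) w e = cutw d C (ball (M (LAM d)) r).
  exact: sum_crosslist.
apply: (wp_crossloop (g := g) B_gt0 (d := d) (C := C) (Qs := Qs) (r := r) (cb := 1) (xs := [:: DEL])
  (J := fun l M1 => agree [:: DEL; I1; VX; VE; VY] M M1 /\ M1 DEL 0 = \sum_(e <- l) w e)).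
- exact: rs_static rs0.
- by rewrite /qrep !e0 //; neqarr.
- by move=> x xQ; rewrite Qn // lamE -QE.
- by rewrite CE !e0.
- by rewrite e0 //; neqarr.
- by case: (d).
- by rewrite big_nil; split=> //; rewrite /M0; upds.
- move=> l M1 [ag _] a ha; rewrite ag //; rewrite /M0 updN //.
  by apply: contraNneq ha => ->.
- move=> l M1 a p ha [ag h1]; split.
    by apply: agree_update => //; rewrite inE ha orbT.
  by rewrite updN //; clear -ha; move: ha; rewrite !inE => /or4P[] /eqP ->.
- move=> l e l' M1 [ag h1] ve em ce; rewrite lamE => cE.
  have wE : M1 WT e = w e by rewrite ag // (rs_wt rs).
  wset => /=; rewrite ve h1 subn1 /= wE.
    move=> _; apply: leq_ltn_trans (b_w bd).
    apply: leq_trans (_ : cutw d C (ball (M (LAM d)) r) <= _).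
      rewrite -sumE cE big_cat big_cons /= addnA; exact: leq_addr.
    by rewrite /cutw big_mkcond; apply: leq_sum => i _; case: ifP.
  split=> //; first by agr.
  split; first by apply: agree_update.
  by upds; rewrite -cats1 big_cat big_cons big_nil /= addn0.
rewrite lamE => s M1 sl [ag h1]; rewrite -sumE -h1; split=> //.
move: sl; move: (\sum_(x <- Qs | _) _) (size Qs) => X z; lia.
Qed.

Lemma wp_mark d M C (Qs : seq nat) r row :
  round_static M -> qrep d Qs M -> (forall x, (x \in Qs) = (0 < M (LAM d) x)) ->
  (forall x, x \in Qs -> x < n) ->
  C = (fun z => M COMP z == M CQ 0) -> M (LEV d) 0 = r -> M ROW 0 = row ->
  wp B (mark d) M (fun s M' =>
    [/\ s <= 30 * (\sum_(x <- Qs | ball (M (LAM d)) r x) degr d x + size Qs + 1),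
        agree [:: 5; I1; VX; VE; VY] M M' &
        forall j, M' 5 j = if [&& row <= j, j - row < m & crosses d C (ball (M (LAM d)) r) (j - row)]
                           then 1 else M 5 j]).
Proof.
move=> rs qr QE Qn CE lev rowE; have B_gt0 := b_B bd.
have QE' x : ball (M (LAM d)) r x -> x \in Qs by rewrite QE => /andP[].
apply: (wp_crossloop (g := g) B_gt0 (d := d) (C := C) (Qs := Qs) (r := r) (cb := 1) (xs := [:: 5])
  (J := fun l M1 => agree [:: 5; I1; VX; VE; VY] M M1 /\
    forall j, M1 5 j = if (row <= j) && (j - row \in l) then 1 else M 5 j)).
- exact: rs_static rs.
- exact: qr.
- by move=> x xQ; rewrite Qn // -QE.
- by rewrite CE.
- by [].
- by case: (d).
- by split=> // j; rewrite andbF.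
- by move=> l M1 [].
- move=> l M1 a p ha [ag h1]; split.
    by apply: agree_update => //; rewrite inE ha orbT.
  by move=> j; rewrite updN //; clear -ha; move: ha; rewrite !inE => /or4P[] /eqP ->.
- move=> l e l' M1 [ag h1] ve em ce cE.
  wput => /=; first by have := b_n bd; have := b_B bd; case: (B) => // b; rewrite expnS; have := expn_gt0 2 b; lia.
  rewrite ve subn1 /= ag // rowE; split=> //; first by agr.
  split; first by apply: agree_update.
  move=> j; upds; rewrite /fupd mem_rcons inE h1.
  have -> : (j == row + e) = (row <= j) && (j - row == e) by apply/idP/idP; lia.
  by case: (row <= j); case: (_ == e).
move=> s M1 sl [ag h1]; split=> //.
  by move: sl; move: (\sum_(x <- Qs | _) _) (size Qs) => X z; lia.
by move=> j; rewrite h1 mem_crosslist.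
Qed.

Definition bvol C lam r := vol (predI C (ball lam r)).
Definition dgs d (U : pred nat) := \sum_(x < n | U x) degr d x.

(** [r] is the current radius, and [rc] the one up to which labels are closed. Between steps they
    are equal; once radius [r] has been scanned, [rc] is [r.+1]. *)
Record est d C v (M : memory) r rc (Qs : seq nat) : Prop := Est {
  e_q : qrep d Qs M;
  e_ex : explored d C v (M (LAM d)) Qs;
  e_cl : closed d C (M (LAM d)) rc;
  e_sq : small_queue d (M (LAM d)) rc Qs;
  e_lev : M (LEV d) 0 = r }.

Lemma est_agree xs d C v M M' r rc Qs :
  all (fun a => a \notin xs) [:: QQ d; QL d; LAM d; LEV d] -> agree xs M M' ->
  est d C v M r rc Qs -> est d C v M' r rc Qs.
Proof.
rewrite /= => /and5P[h1 h2 h3 h4 _] ag [[q1 q2] e2 e3 e4 e5].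
by split; rewrite /qrep ?(ag _ h1) ?(ag _ h2) ?(ag _ h3) ?(ag _ h4).
Qed.

(** All smaller radii have been tried in vain; by [cheap_ball], such a history cannot extend up to
    radius [D]. *)
Definition hist d C V lam r := forall s, s < r ->
  2 * bvol C lam s <= V /\ ~ cheap D h V (bvol C lam s) (cutw d C (ball lam s)).

Record dstate d C v V (M : memory) r : Prop := Dstate {
  d_est : exists Qs, est d C v M r r Qs;
  d_AA : M (AA d) 0 = bvol C (M (LAM d)) r;
  d_DG : M (DG d) 0 = dgs d (ball (M (LAM d)) r);
  d_BIG : M (BIG d) 0 = (V < 2 * bvol C (M (LAM d)) r);
  d_hist : hist d C V (M (LAM d)) r }.

Lemma dstate_agree xs d C v V M M' r :
  all (fun a => a \notin xs) [:: QQ d; QL d; LAM d; LEV d; AA d; DG d; BIG d] -> agree xs M M' ->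
  dstate d C v V M r -> dstate d C v V M' r.
Proof.
rewrite /= => /and5P[h1 h2 h3 h4 /and4P[h5 h6 h7 _]] ag [[Qs e1] e2 e3 e4 e5].
split; rewrite ?(ag _ h3) ?(ag _ h5) ?(ag _ h6) ?(ag _ h7) //.
by exists Qs; apply: est_agree ag e1; rewrite /= h1 h2 h3 h4.
Qed.

Lemma sum_explored d C v lam (Qs : seq nat) (P : pred nat) F : explored d C v lam Qs ->
  (forall x, P x -> 0 < lam x) -> \sum_(x <- Qs | P x) F x = \sum_(x < n | P x) F x.
Proof.
move=> ex hP; apply: sum_w_vol (ex_uniq ex) (ex_lt ex) _ => x /hP.
by rewrite -(ex_mem ex).
Qed.

Lemma sum_explored_ball d C v lam (Qs : seq nat) r F : explored d C v lam Qs ->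
  \sum_(x <- Qs | lam x <= r.+1) F x = \sum_(x < n | ball lam r x) F x.
Proof.
move=> ex; rewrite -(sum_explored F ex) => [|x /andP[]//].
rewrite big_seq_cond [RHS]big_seq_cond; apply: eq_bigl => x.
by rewrite /ball; case xQ: (x \in Qs) => //=; move: xQ; rewrite (ex_mem ex) => ->.
Qed.

Lemma bvol_ball d C v lam (Qs : seq nat) r : explored d C v lam Qs ->
  bvol C lam r = \sum_(x < n | ball lam r x) mu x.
Proof.
move=> ex; apply: eq_bigl => x /=; case bx: (ball lam r x); rewrite ?andbF // andbT.
by apply: (ex_C ex); rewrite (ex_mem ex); case/andP: bx.
Qed.

Lemma sum_seq_le (F : nat -> nat) d C v lam (Qs : seq nat) : explored d C v lam Qs ->
  \sum_(x <- Qs) F x <= \sum_(x < n) F x.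
Proof.
move=> ex; have -> : \sum_(x <- Qs) F x = \sum_(x <- Qs | 0 < lam x) F x.
  by rewrite big_seq [RHS]big_seq_cond; apply: eq_bigl => x; rewrite (ex_mem ex) andbb.
rewrite (sum_explored (P := fun x => 0 < lam x) F ex) // [X in X <= _]big_mkcond.
by apply: leq_sum => x _; case: ifP.
Qed.

Lemma est_size d C v M r rc Qs : est d C v M r rc Qs -> size Qs <= (dgs d (ball (M (LAM d)) rc)).+1.
Proof.
move=> [_ ex _ sq _]; apply: leq_trans sq _; rewrite ltnS.
rewrite (sum_explored (P := fun x => 0 < M (LAM d) x <= rc) _ ex) => [|x /andP[]//].
rewrite /dgs [X in X <= _]big_mkcond [X in _ <= X]big_mkcond; apply: leq_sum => x _.
by rewrite /ball; case: ifP => // hx; rewrite ifT //; lia.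
Qed.

Lemma est_size_pred d C v M r rc Qs : est d C v M r rc.+1 Qs -> size Qs <= (dgs d (ball (M (LAM d)) rc)).+1.
Proof.
move=> [_ ex _ sq _]; apply: leq_trans sq _; rewrite ltnS.
by rewrite (sum_explored (P := fun x => 0 < M (LAM d) x <= rc.+1) _ ex) => [|x /andP[]//].
Qed.

Lemma wp_settle d C v V M r Qs :
  round_static M -> est d C v M r r Qs -> M VV 0 = V -> hist d C V (M (LAM d)) r ->
  wp B (settle d) M (fun s M' =>
    [/\ s <= 10 * (size Qs).+1 + 1, agree [:: AA d; DG d; BIG d; I1; VX] M M' & dstate d C v V M' r]).
Proof.
move=> rs es vE hi; have B_gt0 := b_B bd; have [qr ex cl sq lev] := es.
have muB : \sum_(x <- Qs) mu x < 2 ^ B.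
  by apply: leq_ltn_trans (b_vol bd); apply: (sum_seq_le _ ex).
have dgB : \sum_(x <- Qs) degr d x < 2 ^ B.
  by apply: leq_ltn_trans (b_m bd); apply: leq_trans (sum_degr_le d predT); apply: (sum_seq_le _ ex).
apply: wp_seq; apply: wp_conseq (wp_scan_ball B_gt0 (rs_static rs) qr (ex_lt ex) (b_n bd) lev (rs_mu rs) muB dgB) _.
move=> s M1 [sl ag h1 h2].
have vE1 : M1 VV 0 = V by rewrite ag //; neqarr.
have lE1 : M1 (LAM d) = M (LAM d) by rewrite ag //; neqarr.
wset; first by move=> _ /=; have := b_B bd; case: (B) => // b; rewrite expnS; have := expn_gt0 2 b; lia.
have ag2 : agree [:: AA d; DG d; BIG d; I1; VX] M M1.
  by apply: agree_sub ag; sublist.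
split.
- by move: sl; move: (size Qs) => z; lia.
- by apply: agree_update => //; rewrite !inE eqxx !orbT.
split; upds; rewrite ?lE1.
- exists Qs; apply: est_agree es; last first.
    by apply: (@agree_update [:: AA d; DG d; BIG d; I1; VX]) ag2; rewrite !inE eqxx !orbT.
  by case: (d).
- by rewrite h1 (sum_explored_ball _ _ ex) (bvol_ball _ ex).
- by rewrite h2 (sum_explored_ball _ _ ex).
- rewrite /= vE1 h1 (sum_explored_ball _ _ ex) (bvol_ball _ ex).
  by case: ltnP; lia.
- by [].
Qed.

Lemma wp_start d C v V M :
  round_static M -> M CX 0 = v -> v < n -> C = (fun z => M COMP z == M CQ 0) -> C v ->
  (forall z, M (LAM d) z = 0) -> M VV 0 = V ->
  wp B (start d) M (fun s M' =>
    [/\ s <= 30, agree [:: LAM d; QQ d; QL d; LEV d; AA d; DG d; BIG d; I1; VX] M M' &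
        dstate d C v V M' 0]).
Proof.
move=> rs cx vn CE Cv l0 vE; have B_gt0 := b_B bd.
have lB : 1 < 2 ^ B by case: (B) B_gt0 => // b _; rewrite expnS; have := expn_gt0 2 b; lia.
apply: wp_seq; wput => /=; first by [].
rewrite cx.
apply: wp_seq; wput => /=; upds; rewrite cx; first by move=> _; apply: ltn_trans (b_n bd).
apply: wp_seq; wset => /=; first by [].
apply: wp_seq; wset => /=; first by rewrite expn_gt0.
set M1 := update _ _ _ _.
have ag : agree [:: LAM d; QQ d; QL d; LEV d; AA d; DG d; BIG d; I1; VX] M M1.
  by rewrite /M1; do !(apply: agree_update; first by rewrite !inE ?eqxx ?orbT).
have lE z : M1 (LAM d) z = (z == v) :> nat by rewrite /M1; upds; rewrite /fupd l0; case: eqP.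
have es : est d C v M1 0 0 [:: v].
  split.
  - by rewrite /qrep /M1; upds; split=> // -[] //; upds.
  - split=> //.
    + by move=> x; rewrite inE lE; case: eqP.
    + by move=> x; rewrite inE => /eqP ->.
    + by move=> x; rewrite inE => /eqP ->.
    + move=> x; rewrite inE => /eqP ->; exists 0; [exact: walk_nil | by rewrite lE eqxx].
    + by rewrite lE eqxx.
  - by move=> e em _ _; case: (M1 _ _).
  - by [].
  - by rewrite /M1; upds.
apply: wp_conseq (wp_settle (V := V) _ es _ _) _.
- by apply: round_static_agree ag rs; case: (d).
- by rewrite ag //; neqarr.
- by move=> s.
move=> s M2 [sl ag2 ds]; split=> //; first by move: sl => /=; lia.
apply: agree_trans ag _; apply: agree_sub ag2; by sublist.
Qed.

Definition step_bound := 200 * Lm.+1.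

(** The scan only changes labels above [r + 1], so the volume and the degree sum that [settle]
    computed for the ball of radius [r] are still valid for the test. The factor [Lm.+1] in
    [step_bound] pays for taking the logarithm by repeated halving. *)
Lemma wp_step d C v V M r :
  round_static M -> C = (fun z => M COMP z == M CQ 0) -> M VV 0 = V -> V <= vol predT ->
  dstate d C v V M r -> 2 * bvol C (M (LAM d)) r <= V -> r <= D ->
  wp B (step d) M (fun s M' =>
    [/\ s <= step_bound * (dgs d (ball (M (LAM d)) r)).+1, agree (step_mods d) M M',
        lower r (M (LAM d)) (M' (LAM d)) /\ M' (QL d) 0 <= (dgs d (ball (M (LAM d)) r)).+1 &
     [/\ M' FND 0 = d.+1, cheap D h V (bvol C (M' (LAM d)) r) (cutw d C (ball (M' (LAM d)) r)),
         M' (AA d) 0 = bvol C (M' (LAM d)) r & exists Qs, est d C v M' r r.+1 Qs] \/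
     M' FND 0 = M FND 0 /\ dstate d C v V M' r.+1]).
Proof.
move=> rs CE vE V0 [[Qs es] aE dE bE hi] big rD; have B_gt0 := b_B bd; have [qr ex cl sq lev] := es.
have rB e : e < m -> r.+1 + 4 * elen g e < 2 ^ B by move=> em; have := b_len bd em; lia.
apply: wp_seq; apply: wp_conseq (wp_relax B_gt0 (rs_static rs) (b_n bd) rB CE lev qr ex cl sq) _.
move=> s1 M1 [sl1 ag1 [Qs1 [qr1 ex1 cl1 sq1 lo]]].
rewrite (sum_explored (P := ball (M (LAM d)) r) (degr d) ex) in sl1; last by move=> x /andP[].
have {}sl1 : s1 <= 20 * (dgs d (ball (M (LAM d)) r)).+1 by exact: sl1.
have bE1 : ball (M1 (LAM d)) r = ball (M (LAM d)) r by exact: (lower_ball lo (leqnn _)).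
have rs1 : round_static M1 by apply: round_static_agree ag1 rs; case: (d).
have CE1 : C = (fun z => M1 COMP z == M1 CQ 0).
  by rewrite CE; apply/funext => z; rewrite !ag1 //; neqarr.
have lev1 : M1 (LEV d) 0 = r by rewrite ag1 //; neqarr.
have es1 : est d C v M1 r r.+1 Qs1 by [].
have sz1 := est_size_pred es1.
apply: wp_seq; apply: wp_conseq (wp_measure rs1 qr1 (ex_uniq ex1) (ex_mem ex1) (ex_lt ex1) CE1 lev1) _.
move=> s2 M2 [sl2 ag2 del2].
rewrite (sum_explored (P := ball (M1 (LAM d)) r) (degr d) ex1) in sl2; last by move=> x /andP[].
have {}sl2 : s2 <= 30 * (dgs d (ball (M1 (LAM d)) r) + size Qs1 + 1) by exact: sl2.
have aE2 : M2 (AA d) 0 = bvol C (M1 (LAM d)) r.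
  by rewrite ag2 ?(ag1 (AA d)) ?aE /bvol ?bE1 //; neqarr.
have vE2 : M2 VV 0 = V by rewrite ag2 ?ag1 //; neqarr.
have AB : M2 (AA d) 0 < 2 ^ B by rewrite aE2; apply: leq_ltn_trans (b_vol bd); apply: vol_le.
apply: wp_seq; apply: wp_conseq (wp_log_ratio B_gt0 (a := var (AA d)) vE2 (erefl _) (fun=> AB)) _.
move=> s3 M3 [sl3 ag3 jE].
have a3 a : a \notin [:: YY; JJ; DEL; I1; VX; VE; VY] -> M3 a = M1 a.
  by rewrite !inE => hA; rewrite ag3 ?ag2 // !inE; lia.
have ag13 : agree [:: YY; JJ; DEL; I1; VX; VE; VY] M1 M3 by exact: a3.
have rs3 : round_static M3 by apply: round_static_agree ag13 rs1.
have es3 : est d C v M3 r r.+1 Qs1 by apply: est_agree ag13 es1; case: (d).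
have lE3 : M3 (LAM d) = M1 (LAM d) by rewrite a3 //; neqarr.
have qlE3 : M3 (QL d) 0 = size Qs1 by rewrite a3 ?(proj1 qr1) //; neqarr.
have JL : M3 JJ 0 <= Lm by rewrite jE /= aE2; apply: lg_le0.
have ag03 : agree (step_mods d) M M3.
  apply: agree_trans (_ : agree (step_mods d) M M1) _.
    by apply: agree_sub ag1; sublist.
  by apply: agree_sub ag13; sublist.
have aE3 : M3 (AA d) 0 = bvol C (M3 (LAM d)) r by rewrite ag3 ?aE2 ?lE3 //; neqarr.
have tE : (expr_val M3 (cut_test (var (AA d))) != 0) = (cutw d C (ball (M3 (LAM d)) r) * D <=
   4 * h * bvol C (M3 (LAM d)) r * trunc_log 2 (V %/ bvol C (M3 (LAM d)) r)).
  by rewrite /cut_test leEv /= (rs_D rs3) (rs_h rs3) aE3 jE /= aE2 lE3 ag3 ?del2 //; neqarr.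
have s3l : s1 + s2 + s3 <= 100 * Lm.+1 * (dgs d (ball (M (LAM d)) r)).+1.
  move: sl1 sl2 sl3 sz1; rewrite -jE bE1; move: JL; move: (M3 JJ 0) (dgs _ _) (size Qs1) => J X z.
  have h1 : X.+1 <= Lm.+1 * X.+1 by apply: leq_pmull.
  have h2 : Lm.+1 <= Lm.+1 * X.+1 by apply: leq_pmulr.
  by rewrite -mulnA; move: (Lm.+1 * X.+1) h1 h2 => Y; clear; lia.
wif; rewrite tE; case: ifP => ch.
  wset => /=.
    by move=> _; have := b_D2 bd; have := b_D bd; case: (d) => /=; lia.
  split.
  - rewrite /step_bound; move: s3l; rewrite -!mulnA; move: (dgs _ _) => X.
    have : X.+1 <= Lm.+1 * X.+1 by apply: leq_pmull.
    by move: (Lm.+1 * X.+1) => Y; clear; lia.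
  - by apply: agree_update => //; rewrite !inE eqxx !orbT.
  - by upds; rewrite lE3; split=> //; rewrite qlE3 -bE1.
  left; split; upds => //.
  by exists Qs1; apply: est_agree es3; last (by apply: (@agree_update [:: FND])); case: (d).
apply: wp_seq; wset => /=; rewrite (e_lev es3) addn1.
  by move=> _; have := b_D2 bd; lia.
set M4 := update _ _ _ _.
have ag34 : agree [:: LEV d] M3 M4 by apply: agree_update; rewrite ?inE ?eqxx.
have lE4 : M4 (LAM d) = M1 (LAM d) by rewrite ag34 ?lE3 //; neqarr.
have rs4 : round_static M4 by apply: round_static_agree ag34 rs3; case: (d).
have es4 : est d C v M4 r.+1 r.+1 Qs1.
  split; rewrite ?lE4 // /qrep; last by rewrite /M4; upds.
  by rewrite !ag34 ?a3 //; neqarr.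
have vE4 : M4 VV 0 = V by rewrite ag34 ?ag3 //; neqarr.
have hi4 : hist d C V (M4 (LAM d)) r.+1.
  move=> s; rewrite ltnS leq_eqVlt lE4 => /orP[/eqP ->|sr].
    split; first by rewrite /bvol bE1.
    by move/negbT/negP: ch; rewrite lE3.
  have bs : ball (M1 (LAM d)) s = ball (M (LAM d)) s by exact: (lower_ball lo (ltnW sr)).
  by rewrite /bvol bs; apply: hi.
apply: wp_conseq (wp_settle rs4 es4 vE4 hi4) _ => s5 M5 [sl5 ag5 ds].
split.
- move: s3l sl5 sz1; rewrite /step_bound bE1; move: (dgs _ _) (size Qs1) => X z.
  have h1 : X.+1 <= Lm.+1 * X.+1 by apply: leq_pmull.
  by rewrite -!mulnA; move: (Lm.+1 * X.+1) h1 => Y; clear; lia.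
- apply: agree_trans ag03 _; apply: agree_trans (_ : agree _ M3 M4) _.
    by apply: agree_sub ag34; sublist.
  by apply: agree_sub ag5; sublist.
- have -> : M5 (LAM d) = M1 (LAM d) by rewrite ag5 ?lE4 //; neqarr.
  split=> //; have -> : M5 (QL d) = M3 (QL d) by rewrite ag5 ?ag34 //; neqarr.
  by rewrite qlE3 -bE1.
right; split=> //.
by rewrite ag5 ?ag34 ?a3 ?ag1 //; neqarr.
Qed.

End Step.

(** * Two-sided exploration *)

Definition explore : cmd :=
  While (andE (eqE (var FND) (Cst 0)) (leE (Bin Add (var (BIG false)) (var (BIG true))) (Cst 1)))
    (If (orE (var (BIG false)) (andE (eqE (var (BIG true)) (Cst 0)) (ltE (var (DG true)) (var (DG false)))))
      (step true) (step false)).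

Notation both_mods := [:: LAM true; QQ true; QL true; AA true; DG true; BIG true; LEV true;
  LAM false; QQ false; QL false; AA false; DG false; BIG false; LEV false;
  VY; NL; VX; VE; I1; N1; DEL; FND; YY; JJ].

Section Exploration.
Variables (B : nat) (g : graph) (w : nat -> nat) (beta D Lm : nat).
Notation n := (nv g).
Notation degr := (degr g).
Notation mu := (mu g w beta).
Notation vol := (vol g w beta).
Notation cutw := (cutw g w).
Notation h := (bits Lm).
Notation round_static := (round_static g w beta D Lm).
Notation dstate := (dstate g w beta D Lm).
Notation est := (est g).
Notation bvol := (bvol g w beta).
Notation dgs := (dgs g).
Hypothesis bd : bounds B g w beta D Lm.

Definition dtot x := degr false x + degr true x.
Definition degsum (U : pred nat) := \sum_(x < n | U x) dtot x.

Lemma dgs_degsum d (C U : pred nat) : (forall x, U x -> C x) -> dgs d U <= degsum C.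
Proof.
move=> UC; rewrite /dgs /degsum [X in X <= _]big_mkcond [X in _ <= X]big_mkcond; apply: leq_sum => x _.
by case: ifP => // /UC ->; rewrite /dtot; case: d; lia.
Qed.

Lemma ball_C d (C : pred nat) v lam Qs r x : explored g d C v lam Qs -> ball lam r x -> C x.
Proof. by move=> ex /andP[bx _]; apply: (ex_C ex); rewrite (ex_mem ex). Qed.

(** At radius [D], the history of failed tests would contradict [cheap_ball]. *)
Lemma dstate_lt d (C : pred nat) v V (M : memory) r : 0 < mu v -> C v -> v < n -> V <= vol predT ->
  dstate d C v V M r -> 2 * bvol C (M (LAM d)) r <= V -> r <= D -> r < D.
Proof.
move=> mv Cv vn Vle [[Qs [_ ex cl _ _]] _ _ _ hi] big; rewrite leq_eqVlt => /orP[/eqP rD|//].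
subst r; have [||r0 r0D ch] := cheap_ball (b_D bd) cl _ _ (fun U => @lg_le B g w beta D Lm bd V U Vle).
- rewrite /vol (bigD1 (Ordinal vn)) /=; first by apply: leq_trans mv _; apply: leq_addr.
  by rewrite Cv /ball (ex_root ex).
- by move=> s sD; have [] := hi s sD.
by have [] := hi r0 r0D.
Qed.

Definition explore_bound := (2 * D + 2) * (step_bound Lm + 5).

Record found (d : bool) (C : pred nat) v V (M : memory) r s : Prop := Found {
  f_FND : M FND 0 = d.+1;
  f_r : r < D;
  f_cheap : cheap D h V (bvol C (M (LAM d)) r) (cutw d C (ball (M (LAM d)) r));
  f_small : 2 * bvol C (M (LAM d)) r <= V;
  f_AA : M (AA d) 0 = bvol C (M (LAM d)) r;
  f_est : exists Qs, est d C v M r r.+1 Qs;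
  f_est' : exists r' rc' Qs', est (~~ d) C v M r' rc' Qs';
  f_QL : forall d', M (QL d') 0 <= (dgs d (ball (M (LAM d)) r)).+1;
  f_s : s <= explore_bound * (dgs d (ball (M (LAM d)) r)).+1 }.

(** A side whose ball is big is frozen. For each other side, the time so far is at most the number
    of steps times [K] times the degree sum of its ball plus one, and both queue lengths are at most
    that degree sum plus one. This is preserved, because a step is taken on the non-big side of
    smaller degree sum and costs no more than the ball before its growth. In the end, the ball that
    is cut pays or, if both are big, the whole part. *)
Lemma wp_explore (C : pred nat) v V (M : memory) :
  round_static M -> C = (fun z => M COMP z == M CQ 0) -> M VV 0 = V -> V <= vol predT ->
  0 < mu v -> C v -> v < n ->
  (forall d, dstate d C v V M 0) -> M FND 0 = 0 -> (forall d, M (QL d) 0 = 1) ->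
  wp B explore M (fun s M' => agree both_mods M M' /\
     ((exists d r, found d C v V M' r s) \/
      [/\ M' FND 0 = 0, s <= explore_bound * (degsum C).+1 &
        forall d, exists2 r, r <= D & dstate d C v V M' r /\ V < 2 * bvol C (M' (LAM d)) r])).
Proof.
move=> rs CE vE Vle mv Cv vn ds0 fnd0 ql0; have B_gt0 := b_B bd.
pose K := step_bound Lm + 4.
pose I k s (M' : memory) := agree both_mods M M' /\
  ((exists d r, found d C v V M' r s.+1 /\ s.+1 <= explore_bound * (dgs d (ball (M' (LAM d)) r)).+1) \/
   exists rr : bool -> nat, [/\ M' FND 0 = 0, k = 2 * D + 1 - rr false - rr true,
     forall d, rr d <= D /\ dstate d C v V M' (rr d),
     s <= (rr false + rr true) * K * (degsum C).+1 &
     forall d, M' (BIG d) 0 = 0 -> s <= (rr false + rr true) * K * (M' (DG d) 0).+1 /\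
        forall d', M' (QL d') 0 <= (M' (DG d) 0).+1]).
apply: (wp_while B_gt0 (I := I) (k0 := 2 * D + 1)).
- split=> //; right; exists (fun=> 0); split=> //; first by lia.
  by move=> d _; split=> // d'; rewrite ql0.
- move=> k s M1 [ag [[d [r [fd _]]]|[rr [fE kE dsr sC sd]]]]; rewrite !condE /=.
    by rewrite (f_FND fd).
  rewrite fE /= => bigs.
  have rs1 : round_static M1 by apply: round_static_agree ag rs.
  have CE1 : C = (fun z => M1 COMP z == M1 CQ 0).
    by rewrite CE; apply/funext => z; rewrite !ag.
  have vE1 : M1 VV 0 = V by rewrite ag.
  have main d : M1 (BIG d) 0 = 0 -> (M1 (BIG (~~ d)) 0 = 0 -> M1 (DG d) 0 <= M1 (DG (~~ d)) 0) ->
      wp B (step d) M1 (fun s' M' => exists2 k', k' < k & I k' (s + s'.+1).+1 M').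
    move=> bd0 dgle; have [rD ds] := dsr d.
    have big : 2 * bvol C (M1 (LAM d)) (rr d) <= V.
      by have := d_BIG ds; rewrite bd0; case: ltnP.
    have rlt := dstate_lt mv Cv vn Vle ds big rD.
    have [sdd qld] := sd d bd0.
    have rsum : rr false + rr true = rr d + rr (~~ d) by case: (d); rewrite // addnC.
    have r'D := (dsr (~~ d)).1.
    apply: wp_conseq (wp_step bd rs1 CE1 vE1 Vle ds big rD) _ => s' M2 [sl ag2 [lo qlE] alt].
    have dgE := d_DG ds; rewrite -dgE in sl qlE.
    have agM : agree both_mods M M2.
      by apply: agree_trans ag _; apply: agree_sub ag2; sublist.
    have oth a : a \in [:: QQ (~~ d); QL (~~ d); LAM (~~ d); LEV (~~ d); AA (~~ d); DG (~~ d); BIG (~~ d)] -> M2 a = M1 a.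
      by move=> ha; rewrite ag2 //; clear -ha; move: a ha; apply/allP; case: d.
    have sK : s + s'.+1 < (rr d + rr (~~ d)).+1 * K * (M1 (DG d) 0).+1.
      move: sdd sl; rewrite rsum /K; move: (M1 (DG d) 0) (step_bound Lm) (rr d + rr (~~ d)) => X k1 z; clear; nia.
    have XC : M1 (DG d) 0 <= degsum C.
      rewrite dgE; apply: dgs_degsum => x; have [[Qs [_ ex _ _ _]] _ _ _ _] := ds; exact: (ball_C ex).
    have bE2 : ball (M2 (LAM d)) (rr d) = ball (M1 (LAM d)) (rr d) by exact: (lower_ball lo (leqnn _)).
    have [Qsn esn] := d_est (dsr (~~ d)).2.
    have oag : agree (step_mods d) M1 M2 by [].
    case: alt => [[f2 ch aE2 [Qs es2]]|[f2 ds2]].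
      exists 0; first by rewrite kE; lia.
      split=> //; left; exists d, (rr d).
      have sK2 : (s + s'.+1).+2 <= explore_bound * (dgs d (ball (M2 (LAM d)) (rr d))).+1.
        rewrite bE2 -dgE; apply: leq_ltn_trans sK _; rewrite /explore_bound /K.
        have : (rr d + rr (~~ d)).+1 <= 2 * D by lia.
        by move: (M1 (DG d) 0) (step_bound Lm) (rr d + rr (~~ d)) => X k1 z; clear; nia.
      split=> //; split=> //.
      - by rewrite /bvol bE2.
      - by exists Qs.
      - exists (rr (~~ d)), (rr (~~ d)), Qsn.
        by apply: est_agree ag2 esn; case: (d).
      - move=> d'; rewrite bE2 -dgE; case: (eqVneq d' d) => [->//|d'd].
        have -> : d' = ~~ d by case: (d') (d) d'd => [] [].
        by rewrite oth ?qld // !inE eqxx !orbT.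
    have ds2' : dstate (~~ d) C v V M2 (rr (~~ d)).
      by apply: dstate_agree ag2 (dsr (~~ d)).2; case: (d).
    exists k.-1; first by rewrite kE; lia.
    split=> //; right; exists (fun d' => if d' == d then (rr d).+1 else rr d'); split.
    + by rewrite f2.
    + by rewrite kE; case: (d) rsum rlt r'D => /= *; lia.
    + move=> d'; case: eqP => [->|d'd]; first by split.
      have -> : d' = ~~ d by case: (d') (d) d'd => [] [].
      by split.
    + have -> : (if false == d then (rr d).+1 else rr false) + (if true == d then (rr d).+1 else rr true) =
         (rr d + rr (~~ d)).+1 by case: (d) => /=; lia.
      apply: leq_trans sK _; by rewrite leq_mul2l ltnS XC orbT.
    + have -> : (if false == d then (rr d).+1 else rr false) + (if true == d then (rr d).+1 else rr true) =
         (rr d + rr (~~ d)).+1 by case: (d) => /=; lia.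
      move=> d2 b2.
      have dgX : M1 (DG d) 0 <= M2 (DG d2) 0.
        case: (eqVneq d2 d) => [->|d2d].
          rewrite dgE (d_DG ds2) -bE2; rewrite /dgs [X in X <= _]big_mkcond [X in _ <= X]big_mkcond.
          apply: leq_sum => x _; case: ifP => // bx; rewrite ifT //; exact: ball_sub bx.
        have d2E : d2 = ~~ d by case: (d2) (d) d2d => [] [].
        rewrite d2E oth; last by rewrite !inE eqxx !orbT.
        by apply: dgle; rewrite -(oth (BIG (~~ d))) -?d2E // !inE eqxx !orbT.
      split.
        by apply: leq_trans sK _; rewrite leq_mul2l ltnS dgX orbT.
      move=> d'; case: (eqVneq d' d) => [->|d'd].
        by apply: leq_trans qlE _; rewrite ltnS.
      have -> : d' = ~~ d by case: (d') (d) d'd => [] [].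
      rewrite oth; last by rewrite !inE eqxx !orbT.
      by apply: leq_trans (qld _) _; rewrite ltnS.
  wif; rewrite !condE /=.
  have b01 d : M1 (BIG d) 0 <= 1 by rewrite (d_BIG (dsr d).2); case: ltnP.
  have [bf bt] := (b01 false, b01 true).
  case: ifP => ch.
    by apply: main => /=; [lia | lia].
  by apply: main => /=; [lia | lia].
- move=> k s M1 [ag [[d [r [fd sK]]]|[rr [fE kE dsr sC sd]]]] hE; split=> //.
    left; exists d, r; move: fd => [*]; by split.
  right; move/eqP: hE; rewrite -[_ == _]negbK !condE /= fE /=.
  move=> hE.
  have big d : V < 2 * bvol C (M1 (LAM d)) (rr d).
    have [b1 b2] := (d_BIG (dsr false).2, d_BIG (dsr true).2).
    move: hE; rewrite b1 b2; case: d; case: ltnP => // h1; case: ltnP => //= h2.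
  split=> //.
    apply: leq_ltn_trans sC _; rewrite /explore_bound /K.
    have := (dsr false).1; have := (dsr true).1; move: (degsum C) (step_bound Lm) (rr true) (rr false) => X k1 z z'; clear; nia.
  by move=> d; have [rD ds] := dsr d; exists (rr d).
Qed.

End Exploration.

(** * Carving parts *)

Inductive reach (g : graph) (cut : pred nat) (x : nat) : nat -> Prop :=
  | reach_refl : reach g cut x x
  | reach_step e : e < ne g -> ~~ cut e -> reach g cut x (src g false e) -> reach g cut x (src g true e).

Definition scc g cut x y := reach g cut x y /\ reach g cut y x.

Lemma reach_trans g cut x y z : reach g cut x y -> reach g cut y z -> reach g cut x z.
Proof. by move=> h; elim=> // e em ce _ h2; apply: reach_step. Qed.

Lemma reach_mono g (cut cut' : pred nat) x y : (forall e, e < ne g -> cut e -> cut' e) ->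
  reach g cut' x y -> reach g cut x y.
Proof.
move=> h; elim=> [|e em ce _ IH]; first exact: reach_refl.
by apply: reach_step => //; apply: contra ce; apply: h.
Qed.

Lemma scc_sym g cut x y : scc g cut x y -> scc g cut y x.
Proof. by case. Qed.

(** A closed walk through [x] and [y] that meets both [U] and its complement crosses the boundary in
    either direction, and all of its vertices lie in the component of [x], hence in [C]. Removing
    the edges of one direction is thus enough. *)
Lemma scc_split g (cut : pred nat) d (C U : pred nat) x y :
  (forall z, scc g cut x z -> C z) ->
  (forall e, e < ne g -> crosses g d C U e -> cut e) ->
  scc g cut x y -> U x = U y.
Proof.
move=> hC hcut.
have one a b (W : pred nat) : (forall z, scc g cut a z -> C z) ->
   (forall e, e < ne g -> crosses g false C W e -> cut e) -> scc g cut a b -> W a -> W b.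
  move=> aC hc [ab ba] Wa; elim: ab ba => [//|e em ce az IH] ba.
  have step : reach g cut (src g false e) (src g true e) by apply: reach_step => //; apply: reach_refl.
  have za := reach_trans step ba.
  have := IH za => Wz; apply/negPn/negP => nW; move/negP: ce; apply; apply: hc => //.
  rewrite /crosses /= Wz nW !aC //; split=> //; exact: reach_trans az step.
have sC z : scc g cut x y -> scc g cut y z -> C z.
  move=> [h1 h2] [h3 h4]; apply: hC; split; [exact: reach_trans h1 h3 | exact: reach_trans h4 h2].
move=> xy; case: d hcut => hcut.
  (* For backward balls the cut edges enter [U], that is, they leave its complement. *)
  have hcut' e : e < ne g -> crosses g false C (predC U) e -> cut e.
    move=> em /and4P[c1 c2 u1 u2]; apply: hcut => //; rewrite /crosses /=.
    by move: u1 u2; rewrite /= negbK c1 c2 => -> ->.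
  have h1 := one x y (predC U) hC hcut' xy.
  have h2 := one y x (predC U) (fun z => sC z xy) hcut' (scc_sym xy).
  by move: h1 h2 => /=; case: (U x) (U y) => [] [] //= h1 h2; [have := h2 isT | have := h1 isT].
have h1 := one x y U hC hcut xy.
have h2 := one y x U (fun z => sC z xy) hcut (scc_sym xy).
by case: (U x) (U y) h1 h2 => [] [] h1 h2 //; [have := h1 isT | have := h2 isT].
Qed.

Section Partition.
Variables (g : graph) (w : nat -> nat) (beta D Lm row : nat).
Notation n := (nv g).
Notation m := (ne g).
Notation mu := (mu g w beta).
Notation vol := (vol g w beta).
Notation h := (bits Lm).
Notation dtot := (dtot g).

Definition part (M : memory) q : pred nat := fun x => M COMP x == q.

Definition cut_row (M : memory) : pred nat := fun e => M 5 (row + e) != 0.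

Definition core (C : pred nat) : Prop := exists v, forall x, C x ->
  forall d, exists2 l, walk g d v x l & 2 * l <= D.

Definition segment (M : memory) q (Ls : seq nat) : Prop :=
  [/\ M EN q = M ST q + size Ls, M EN q <= M TOP 0,
      forall i, i < size Ls -> M LL (M ST q + i) = nth 0 Ls i,
      uniq Ls & (forall x, M COMP x = q -> x \in Ls) /\ (forall x, x \in Ls -> x < n)].

(** [lv] is a ghost variable: the volume bound of part [q] is smaller than the total volume by a
    factor of at least [2 ^ lv q]. In [p_cost] a vertex owns [4 * h * mu x] for each level that it
    may still rise; a cheap cut of volume [A] that lifts its vertices by [j] levels is paid with the
    [4 * h * A * j] that they release. [T0] is the output table before the round, which changes only
    in the current row. *)
Record pinv (T0 : nat -> nat) (M : memory) (lv : nat -> nat) : Prop := Pinv {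
  p_np : 0 < M NP 0;
  p_comp : forall x, M COMP x < M NP 0 /\ (M COMP x != 0) = (x < n) && (0 < mu x);
  p_seg : forall q, 0 < q < M NP 0 -> exists Ls, segment M q Ls;
  p_vol : forall q, 0 < q < M NP 0 -> vol (part M q) <= M VOL q /\ M VOL q * 2 ^ lv q <= vol predT;
  p_core : forall q, 0 < q < M NP 0 -> M DONE q != 0 -> core (part M q);
  p_scc : forall x y, scc g (cut_row M) x y -> M COMP x = M COMP y;
  p_cost : D * \sum_(e < m | cut_row M e) w e + 4 * h * \sum_(x < n | M COMP x != 0) mu x * (Lm - lv (M COMP x))
           <= 4 * h * vol predT * Lm;
  p_row : forall j, M 5 j = if (row <= j) && (j - row < m) then nat_of_bool (M 5 j != 0) else T0 j }.

Record carved (X : pred nat) A (cutp : pred nat) (F : seq nat) (M M' : memory) : Prop := Carved {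
  c_comp : forall z, M' COMP z = if X z then M NP 0 else M COMP z;
  c_uniq : uniq F;
  c_mem : forall x, (x \in F) = X x;
  c_LL : forall j, M' LL j = if M TOP 0 <= j < M TOP 0 + size F then nth 0 F (j - M TOP 0) else M LL j;
  c_TOP : M' TOP 0 = M TOP 0 + size F;
  c_NP : M' NP 0 = (M NP 0).+1;
  c_ST : M' ST = fupd (M ST) (M NP 0) (M TOP 0);
  c_EN : M' EN = fupd (M EN) (M NP 0) (M TOP 0 + size F);
  c_VOL : M' VOL = fupd (M VOL) (M NP 0) A;
  c_DONE : M' DONE = fupd (M DONE) (M NP 0) 0;
  c_cut : forall j, M' 5 j = if [&& row <= j, j - row < m & cutp (j - row)] then 1 else M 5 j }.

Definition live (M : memory) x := (M COMP x != 0) && (M DONE (M COMP x) == 0).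

(* Every live vertex is still to be scanned at most once per remaining level. *)
Definition tpot (M : memory) (lv : nat -> nat) :=
  \sum_(x < n | live M x) (dtot x).+1 * (Lm.+1 - lv (M COMP x)).

(** Total length of the segments of live parts, stale entries included. It pays for scanning a whole
    segment, which happens only when the part becomes a core. *)
Definition spot (M : memory) := \sum_(q < M NP 0 | (0 < q) && (M DONE q == 0)) (M EN q - M ST q).

Hypothesis b_Lm' : forall U l, 0 < vol U -> vol U * 2 ^ l <= vol predT -> l <= Lm.

Lemma lv_le T0 M lv x : pinv T0 M lv -> M COMP x != 0 -> lv (M COMP x) <= Lm.
Proof.
move=> pi cx; have [lt e] := p_comp pi x; move: (cx); rewrite e => /andP[xn mx].
have [v1 v2] : vol (part M (M COMP x)) <= M VOL (M COMP x) /\ M VOL (M COMP x) * 2 ^ lv (M COMP x) <= vol predT.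
  by apply: (p_vol pi); rewrite lt lt0n cx.
have vx : 0 < vol (part M (M COMP x)).
  rewrite /vol (bigD1 (Ordinal xn)) /=; last by rewrite /part.
  by apply: leq_trans mx _; apply: leq_addr.
by apply: (b_Lm' vx); apply: leq_trans v2; rewrite leq_mul2r v1 orbT.
Qed.

Section Carve.
Variables (T0 : nat -> nat) (M M' : memory) (lv : nat -> nat) (q A : nat) (d : bool) (U : pred nat) (F : seq nat).
Hypotheses (pi : pinv T0 M lv) (q_lt : 0 < q < M NP 0) (dq : M DONE q = 0).
Let C := part M q.
Variable X : pred nat.
Hypothesis XE : (X = predI C U) \/ (X = predI C (predC U)).
Hypothesis cv : carved X A (crosses g d C U) F M M'.
Hypothesis AE : A = vol X.
Hypothesis A2 : 2 * A <= M VOL q.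
Hypothesis ch : cheap D h (M VOL q) A (cutw g w d C U).
Let j := trunc_log 2 (M VOL q %/ A).
Let np := M NP 0.
Let lv' := fupd lv np (lv q + j).

Lemma carve_XC x : X x -> M COMP x = q.
Proof. by case: XE => -> /andP[/eqP]. Qed.

Lemma carve_pos x : X x -> 0 < A.
Proof.
move=> Xx; have cx : M COMP x != 0 by rewrite (carve_XC Xx); lia.
have [lt e] := p_comp pi x; move: (cx); rewrite e => /andP[xn mx].
by rewrite AE /vol (bigD1 (Ordinal xn)) //=; apply: leq_trans mx _; apply: leq_addr.
Qed.

Lemma carve_pow : A * 2 ^ j <= M VOL q.
Proof.
rewrite /j; case: (posnP (M VOL q %/ A)) => [->|q0].
  by rewrite trunc_log0 muln1; lia.
rewrite mulnC; apply: leq_trans (leq_divM (M VOL q) A).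
by rewrite leq_mul2r trunc_logP ?orbT.
Qed.

Lemma carve_j x : X x -> 0 < j.
Proof.
move=> Xx; have A0 := carve_pos Xx; rewrite /j -(trunc_expnK 1 (isT : 1 < 2)) /=.
by apply: leq_trunc_log; rewrite leq_divRL.
Qed.

Lemma carve_vol : A * 2 ^ (lv q + j) <= vol predT.
Proof.
have [_ h2] := p_vol pi q_lt; apply: leq_trans h2.
by rewrite expnD [2 ^ lv q * _]mulnC mulnA leq_mul2r carve_pow orbT.
Qed.

Lemma carve_lv x : X x -> lv q + j <= Lm.
Proof. by move=> Xx; apply: (b_Lm' (U := X)); rewrite -AE; [exact: carve_pos Xx | exact: carve_vol]. Qed.

Lemma lv'E x : lv' (M' COMP x) = if X x then lv q + j else lv (M COMP x).
Proof.
rewrite (c_comp cv); case: ifP => _; first by rewrite /lv' fupdE.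
by rewrite /lv' fupdN //; have [] := p_comp pi x; rewrite -/np; lia.
Qed.

Lemma comp'_neq0 x : (M' COMP x != 0) = (M COMP x != 0).
Proof.
rewrite (c_comp cv); case: ifP => // Xx; rewrite (carve_XC Xx).
by have := p_np pi; rewrite !lt0n; lia.
Qed.

Lemma cut_row' e : e < m -> cut_row M' e = cut_row M e || crosses g d C U e.
Proof.
move=> em; rewrite /cut_row (c_cut cv) leq_addr addKn em /=.
by case: (crosses _ _ _ _ _); rewrite ?orbT ?orbF.
Qed.

Lemma part'E q' x : q' != np -> part M' q' x -> part M q' x.
Proof. by rewrite /part (c_comp cv); case: ifP => // _ /negbTE; rewrite eq_sym => ->. Qed.

Lemma pinv_carve : pinv T0 M' lv'.
Proof.
have [p1 p2 p3 p4 p5 p6 p7 p8] := pi.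
have npN q' : q' < np -> q' != np by lia.
split.
- by rewrite (c_NP cv).
- move=> x; rewrite comp'_neq0; split; last by have [] := p2 x.
  by rewrite (c_comp cv) (c_NP cv); have [] := p2 x; case: ifP; lia.
- move=> q'; rewrite (c_NP cv) ltnS => /andP[q0]; rewrite leq_eqVlt => /orP[/eqP ->|q1].
    exists F; split; rewrite ?(c_EN cv) ?(c_ST cv) ?(c_TOP cv) ?fupdE //.
    + move=> i iF; rewrite (c_LL cv) leq_addr ltn_add2l iF /= addKn //.
    + exact: c_uniq cv.
    + split=> x; rewrite (c_mem cv).
        rewrite (c_comp cv); case: ifP => // _ cx; have [] := p2 x; lia.
      by case: (p2 x) => _ e Xx; have := carve_XC Xx => cx; move: e; rewrite cx; case: (x < n) => //; lia.
  have [|Ls [s1 s2 s3 s4 [s5 s6]]] := p3 q'; first by rewrite q0.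
  exists Ls; split; rewrite ?(c_EN cv) ?(c_ST cv) ?(c_TOP cv) ?fupdN ?npN //.
  + by apply: leq_trans s2 _; apply: leq_addr.
  + move=> i iL; rewrite (c_LL cv) ifF ?s3 //; move: s1 s2 iL; move: (size Ls) (size F) => *; lia.
  + split=> // x cx; apply: s5; apply/eqP; apply: (part'E (npN _ q1)).
    by rewrite /part cx.
- move=> q'; rewrite (c_NP cv) ltnS => /andP[q0]; rewrite leq_eqVlt => /orP[/eqP ->|q1].
    rewrite (c_VOL cv) /lv' !fupdE; split; last exact: carve_vol.
    rewrite AE; apply: vol_sub => x; rewrite /part (c_comp cv); case: ifP => // _.
    by have [] := p2 x; lia.
  rewrite (c_VOL cv) /lv' !fupdN ?npN //; have [|v1 v2] := p4 q'; first by rewrite q0.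
  by split=> //; apply: leq_trans v1; apply: vol_sub => x; apply: part'E; apply: npN.
- move=> q'; rewrite (c_NP cv) ltnS => /andP[q0]; rewrite leq_eqVlt => /orP[/eqP ->|q1].
    by rewrite (c_DONE cv) fupdE.
  rewrite (c_DONE cv) fupdN ?npN // => dn; have [|v hv] := p5 q' _ dn; first by rewrite q0.
  by exists v => x /(part'E (npN _ q1)); apply: hv.
- move=> x y xy.
  have sub z z' : scc g (cut_row M') z z' -> scc g (cut_row M) z z'.
    by case=> a b; split; [apply: reach_mono a | apply: reach_mono b] => e em ce; rewrite cut_row' // ce.
  have cxy := p6 x y (sub _ _ xy).
  rewrite !(c_comp cv) -cxy; case: (boolP (C x)) => Cx; last first.
    have nX z : M COMP z = M COMP x -> X z = false.
      by move=> zx; apply/negP => /carve_XC; rewrite zx => cx; move: Cx; rewrite /C /part cx eqxx.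
    by rewrite !nX.
  (* By the old invariant the component lies within [C], and all edges of [C] that leave [U] in
     direction [d] are cut now. *)
  have Uxy : U x = U y.
    apply: (scc_split (cut := cut_row M') (d := d) (C := C)) xy.
      by move=> z /sub /p6; rewrite /C /part => <-.
    by move=> e em ce; rewrite cut_row' // ce orbT.
  have Cy : C y by rewrite /C /part -cxy.
  by case: XE => -> /=; rewrite Cx Cy Uxy.
- set S1 := \sum_(e < m | cut_row M e) w e in p7; set S2 := \sum_(x < n | _) _ in p7.
  have e1 : \sum_(e < m | cut_row M' e) w e <= S1 + cutw g w d C U.
    rewrite /S1 /cutw [X in X <= _]big_mkcond [X in _ <= X + _]big_mkcond [X in _ <= _ + X]big_mkcond.
    rewrite -big_split; apply: leq_sum => e _; rewrite cut_row' //.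
    by case: (cut_row M e); case: (crosses _ _ _ _ _) => //=; lia.
  (* Each vertex of [X] rises by [j] levels, without exceeding [Lm], and so releases exactly
     [mu x * j]. *)
  have e2 : \sum_(x < n | M' COMP x != 0) mu x * (Lm - lv' (M' COMP x)) + A * j <= S2.
    rewrite AE /vol big_distrl /= /S2 [X in X + _ <= _]big_mkcond [X in _ + X <= _]big_mkcond.
    rewrite [X in _ <= X]big_mkcond -big_split; apply: leq_sum => x _ /=.
    rewrite comp'_neq0 lv'E; case: (boolP (X x)) => Xx; last first.
      by rewrite addn0; case: ifP.
    rewrite (carve_XC Xx); have -> : q != 0 by lia.
    have := carve_lv Xx; move: (lv q) => l hl.
    apply: leq_trans (_ : mu x * (Lm - (l + j) + j) <= _); first by rewrite mulnDr.
    by apply: leq_mul => //; lia.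
  move: ch; rewrite /cheap -/j => ch'.
  have e3 : D * \sum_(e < m | cut_row M' e) w e <= D * S1 + 4 * h * (A * j).
    apply: leq_trans (leq_mul (leqnn D) e1) _; rewrite mulnDr leq_add2l mulnC.
    by apply: leq_trans ch' _; rewrite !mulnA.
  have e4 : 4 * h * (\sum_(x < n | M' COMP x != 0) mu x * (Lm - lv' (M' COMP x))) + 4 * h * (A * j) <= 4 * h * S2.
    by rewrite -mulnDr leq_mul2l e2 orbT.
  move: e3 e4 p7; set a1 := D * _; set a2 := 4 * h * (\sum_(x < n | _) _); set a3 := 4 * h * (A * j).
  move=> e3 e4; apply: leq_trans; apply: leq_trans (leq_add e3 (leqnn _)) _.
  by rewrite -addnA leq_add2l addnC.
- move=> i; rewrite (c_cut cv); case: ifP => [/and3P[-> -> _]|_] //.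
Qed.

(** As [2 * A] is at most the volume bound of the part, every carved vertex rises by at least one
    level and releases its [(dtot x).+1]. *)
Lemma tpot_carve : tpot M' lv' + \sum_(x < n | X x) (dtot x).+1 <= tpot M lv.
Proof.
have [p1 p2 p3 p4 p5 p6 p7 p8] := pi.
rewrite /tpot [X in X + _ <= _]big_mkcond [X in _ + X <= _]big_mkcond [X in _ <= X]big_mkcond -big_split.
apply: leq_sum => x _ /=; rewrite /live comp'_neq0 lv'E (c_comp cv) (c_DONE cv).
case: (boolP (X x)) => Xx; last first.
  by rewrite fupdN ?addn0 //; have [] := p2 x; lia.
rewrite fupdE eqxx andbT (carve_XC Xx) dq eqxx andbT; have -> : q != 0 by lia.
have := carve_lv Xx; have := carve_j Xx; move: (lv q) => l h1 h2.
apply: leq_trans (_ : (dtot x).+1 * (Lm.+1 - (l + j) + 1) <= _); first by rewrite mulnDr muln1.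
by apply: leq_mul => //; lia.
Qed.

Lemma size_carved : size F <= \sum_(x < n | X x) (dtot x).+1.
Proof.
have FX x : X x -> x < n.
  move=> Xx; have [_ e] := p_comp pi x; move: e; rewrite (carve_XC Xx).
  by case: (x < n) => //; lia.
have -> : size F = \sum_(x < n | X x) 1.
  rewrite -(sum_w_vol (g := g) (fun=> 1) (c_uniq cv)) => [|x|x]; rewrite ?(c_mem cv) //; last exact: FX.
  by rewrite -sum1_size big_seq [RHS]big_seq_cond; apply: eq_bigl => x; rewrite (c_mem cv) andbb.
exact: leq_sum.
Qed.

Lemma spot_carve : spot M' = spot M + size F.
Proof.
have np0 := p_np pi.
rewrite /spot (c_NP cv) big_mkcond big_ord_recr /= (c_DONE cv) fupdE np0 eqxx /=.
rewrite (c_EN cv) (c_ST cv) !fupdE addKn; congr (_ + _).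
rewrite [RHS]big_mkcond; apply: eq_bigr => i _.
have iN : i != M NP 0 :> nat by have := ltn_ord i; lia.
by rewrite !fupdN.
Qed.

End Carve.

Section Finish.
Variables (T0 : nat -> nat) (M M' : memory) (lv : nat -> nat) (q : nat).
Hypotheses (pi : pinv T0 M lv) (q_lt : 0 < q < M NP 0) (dq : M DONE q = 0).
Hypothesis ag : agree [:: DONE] M M'.
Hypothesis dE : M' DONE = fupd (M DONE) q 1.

Lemma pinv_done : core (part M q) -> pinv T0 M' lv.
Proof.
move=> hc; have [p1 p2 p3 p4 p5 p6 p7 p8] := pi.
have a5 : M' 5 = M 5 by apply: ag.
have cE : M' COMP = M COMP by apply: ag.
have pE q' : part M' q' = part M q' by rewrite /part cE.
have rE : cut_row M' = cut_row M by rewrite /cut_row a5.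
have nE : M' NP = M NP by apply: ag.
split; rewrite ?a5 ?cE ?nE ?rE //.
- move=> q' /p3 [Ls [s1 s2 s3 s4 s5]]; exists Ls; rewrite /segment cE.
  by rewrite !(@ag EN, @ag ST, @ag LL, @ag TOP).
- by move=> q'; rewrite pE (@ag VOL) //; apply: p4.
- move=> q' q'l; rewrite pE dE /fupd; case: (eqVneq q' q) => [-> _|_]; [exact: hc | exact: p5].
Qed.

(** Levels are at most [Lm], so each vertex of the part still owns one unit, thanks to [Lm.+1] in
    [tpot]. *)
Lemma tpot_done : tpot M' lv + \sum_(x < n | part M q x) (dtot x).+1 <= tpot M lv.
Proof.
rewrite /tpot [X in X + _ <= _]big_mkcond [X in _ + X <= _]big_mkcond [X in _ <= X]big_mkcond -big_split.
apply: leq_sum => x _ /=; rewrite /live /part (@ag COMP) // dE /fupd.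
case: (eqVneq (M COMP x) q) => cx; rewrite ?addn0 //=.
rewrite andbF add0n cx dq eqxx andbT; have -> : q != 0 by lia.
have cx0 : M COMP x != 0 by rewrite cx; lia.
by apply: leq_pmulr; have := lv_le pi cx0; rewrite cx; lia.
Qed.

Lemma spot_done : spot M' + (M EN q - M ST q) = spot M.
Proof.
have [q0 qn] := andP q_lt.
rewrite /spot (@ag NP) // (@ag EN) // (@ag ST) // dE.
rewrite [RHS](bigD1 (Ordinal qn)) /=; last by rewrite q0 dq.
rewrite addnC; congr (_ + _); apply: eq_bigl => i; rewrite /fupd -val_eqE /=.
by case: (eqVneq (nat_of_ord i) q) => _ /=; rewrite ?andbF ?andbT.
Qed.

End Finish.
End Partition.

(** * Cutting along complements of large balls *)

Definition double_D := Bin Mul (Cst 2) (Get 0 (Cst 2)).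

(** In the scaled lengths, radius [2 * D] stands for [D / 2]. No cuts are tested on the way. *)
Definition finish d : cmd :=
  While (ltE (var (LEV d)) double_D) (Seq (relax d) (Set_ (LEV d) (succ_ (var (LEV d))))).

Definition try_complement d : cmd :=
  Seq (measure d) (Seq (scan_complement d) (log_ratio (var AC))).

Definition select d : cmd :=
  Seq (Set_ (LEV d) (Get 0 (Cst 2))) (Seq (try_complement d)
    (While (Bin Defs.Sub (Cst 1) (cut_test (var AC)))
      (Seq (Set_ (LEV d) (succ_ (var (LEV d)))) (try_complement d)))).

(** The cut is recorded before the relabelling, since [mark] tests membership in the old part. *)
Definition carve d (relabel : cmd) (a : expr) : cmd :=
  Seq (Put ST (var NP) (var TOP)) (Seq (mark d) (Seq relabel
    (Seq (Put EN (var NP) (var TOP)) (Seq (Put VOL (var NP) a)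
      (Seq (Put DONE (var NP) (Cst 0)) (Set_ NP (succ_ (var NP)))))))).

Notation carve_mods := [:: 5; ST; EN; VOL; DONE; NP; COMP; LL; TOP; I1; VX; VE; VY].

Notation select_mods d := [:: LEV d; DEL; AC; I1; VX; VE; VY; YY; JJ].

Section Large.
Variables (B : nat) (g : graph) (w : nat -> nat) (beta D Lm : nat).
Notation n := (nv g).
Notation m := (ne g).
Notation degr := (degr g).
Notation mu := (mu g w beta).
Notation vol := (vol g w beta).
Notation cutw := (cutw g w).
Notation h := (bits Lm).
Notation round_static := (round_static g w beta D Lm).
Notation est := (est g).
Notation degsum := (degsum g).
Hypothesis bd : bounds B g w beta D Lm.

Lemma sum_ball_degsum d (C : pred nat) v lam (Qs : seq nat) r : explored g d C v lam Qs ->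
  \sum_(x <- Qs | ball lam r x) degr d x <= degsum C.
Proof.
move=> ex; rewrite (sum_explored (P := ball lam r) (degr d) ex) => [|x /andP[]//].
by apply: (@dgs_degsum g d C (ball lam r)) => x; apply: ball_C ex.
Qed.

Lemma wp_finish d (C : pred nat) v (M : memory) r (Qs : seq nat) :
  round_static M -> C = (fun z => M COMP z == M CQ 0) -> est d C v M r r Qs -> r <= 2 * D ->
  wp B (finish d) M (fun s M' =>
    [/\ s <= 2 * D * (20 * (degsum C).+1 + 3) + 2,
        agree [:: LAM d; QQ d; QL d; VY; NL; VX; VE; I1; N1; LEV d] M M',
        exists Qs', est d C v M' (2 * D) (2 * D) Qs' &
        forall s, s <= r -> ball (M' (LAM d)) s = ball (M (LAM d)) s]).
Proof.
move=> rs CE es rD; have B_gt0 := b_B bd.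
set c := 20 * (degsum C).+1 + 3.
pose I k s (M' : memory) := agree [:: LAM d; QQ d; QL d; VY; NL; VX; VE; I1; N1; LEV d] M M' /\
  exists r' Qs', [/\ r <= r' <= 2 * D, k = 2 * D - r', s <= (r' - r) * c, est d C v M' r' r' Qs' &
    forall s, s <= r -> ball (M' (LAM d)) s = ball (M (LAM d)) s].
apply: (wp_while B_gt0 (I := I) (k0 := 2 * D - r)).
- by split=> //; exists r, Qs; split=> //; rewrite leqnn.
- move=> k s M1 [ag [r' [Qs' [rr kE sE es' bE]]]].
  have rs1 : round_static M1 by apply: round_static_agree ag rs; case: (d).
  rewrite condE /= (e_lev es') (rs_D rs1) => r'D.
  have CE1 : C = (fun z => M1 COMP z == M1 CQ 0).
    by rewrite CE; apply/funext => z; rewrite !ag //; neqarr.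
  have [qr ex cl sq lev] := es'.
  have rB e : e < m -> r'.+1 + 4 * elen g e < 2 ^ B by move=> em; have := b_len bd em; lia.
  apply: wp_seq; apply: wp_conseq (wp_relax B_gt0 (rs_static rs1) (b_n bd) rB CE1 lev qr ex cl sq) _.
  move=> s1 M2 [sl1 ag1 [Qs2 [qr2 ex2 cl2 sq2 lo]]].
  have lev2 : M2 (LEV d) 0 = r' by rewrite ag1 //; neqarr.
  wset => /=; rewrite lev2 addn1; first by move=> _; have := b_D2 bd; lia.
  exists (2 * D - r'.+1); first by lia.
  split.
    apply: agree_update; first by rewrite !inE eqxx !orbT.
    by apply: agree_trans ag _; apply: agree_sub ag1; sublist.
  exists r'.+1, Qs2; split=> //; first by lia.
  + have := sum_ball_degsum r' ex; move: sl1 sE; rewrite /c.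
    move: (\sum_(x <- _ | _) _) (degsum C) => a1 a2 h1 h2 h3.
    have -> : r'.+1 - r = (r' - r).+1 by lia.
    by rewrite mulSn; move: ((r' - r) * _) h2 => z; lia.
  + by split; [rewrite /qrep; upds; exact: qr2 | by upds | by upds | by upds | upds; lia].
  + move=> s' sr; upds; rewrite (lower_ball lo) ?bE //; lia.
- move=> k s M1 [ag [r' [Qs' [rr kE sE es' bE]]]].
  have rs1 : round_static M1 by apply: round_static_agree ag rs; case: (d).
  rewrite /= (e_lev es') (rs_D rs1) => /eqP; rewrite subn_eq0 => r'D.
  have r'E : r' = 2 * D by lia.
  split=> //; last by exists Qs'; rewrite -{1 2}r'E.
  apply: leq_trans (_ : (r' - r) * c + 2 <= _); first by lia.
  by rewrite leq_add2r leq_mul2r r'E; apply/orP; right; lia.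
Qed.

Lemma wp_try_complement d (C : pred nat) (M : memory) (Qs Ls : seq nat) r V :
  round_static M -> qrep d Qs M -> uniq Qs -> (forall x, (x \in Qs) = (0 < M (LAM d) x)) ->
  (forall x, x \in Qs -> x < n) -> C = (fun z => M COMP z == M CQ 0) -> M (LEV d) 0 = r ->
  segment g M (M CQ 0) Ls -> M N1 0 = size Ls -> M VV 0 = V -> V <= vol predT ->
  wp B (try_complement d) M (fun s M' =>
   [/\ s <= 30 * (\sum_(x <- Qs) degr d x + size Qs).+1 + 10 * (size Ls).+1 + 3 * Lm + 3,
       agree [:: DEL; AC; I1; VX; VE; VY; YY; JJ] M M',
       M' DEL 0 = cutw d C (ball (M (LAM d)) r),
       M' AC 0 = vol (predI C (predC (ball (M (LAM d)) r))) &
       M' JJ 0 = trunc_log 2 (V %/ vol (predI C (predC (ball (M (LAM d)) r))))]).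
Proof.
move=> rs qr uQ QE Qn CE lev [sg1 sg2 sg3 sg4 [sg5 sg6]] n1 vE Vle; have B_gt0 := b_B bd.
apply: wp_seq; apply: wp_conseq (wp_measure bd rs qr uQ QE Qn CE lev) _ => s1 M1 [sl1 ag1 del1].
have rs1 : round_static M1 by apply: round_static_agree ag1 rs.
have e1 a : a \notin [:: DEL; I1; VX; VE; VY] -> M1 a = M a by apply: ag1.
have lamE : M1 (LAM d) = M (LAM d) by rewrite e1 //; neqarr.
have llE i : i < size Ls -> M1 LL (M1 ST (M1 CQ 0) + i) = nth 0 Ls i by rewrite !e1 //; apply: sg3.
have acE : \sum_(x <- Ls | (M1 COMP x == M1 CQ 0) && ~~ ball (M1 (LAM d)) r x) mu x =
    vol (predI C (predC (ball (M (LAM d)) r))).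
  rewrite lamE !e1 // CE; apply: (sum_w_vol (g := g) mu (P := fun x => (M COMP x == M CQ 0) && ~~ ball (M (LAM d)) r x)) => //.
  by move=> x /andP[/eqP /sg5].
have lev1 : M1 (LEV d) 0 = r by rewrite e1 //; neqarr.
have n11 : M1 N1 0 = size Ls by rewrite e1.
have muB : \sum_(x <- Ls) mu x < 2 ^ B.
  apply: leq_ltn_trans (b_vol bd).
  have -> : \sum_(x <- Ls) mu x = \sum_(x <- Ls | x \in Ls) mu x by rewrite big_seq.
  rewrite (sum_w_vol (g := g) mu (P := fun x => x \in Ls)) // /vol [X in X <= _]big_mkcond.
  by apply: leq_sum => x _; case: ifP.
apply: wp_seq; apply: wp_conseq (wp_scan_complement B_gt0 sg6 (b_n bd) lev1 n11 llE (rs_mu rs1) muB) _.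
move=> s2 M2 [sl2 ag2 ac2]; rewrite acE in ac2.
have vE2 : M2 VV 0 = V by rewrite ag2 ?e1 //.
have AB : M2 AC 0 < 2 ^ B by rewrite ac2; apply: leq_ltn_trans (b_vol bd); apply: vol_le.
apply: wp_conseq (wp_log_ratio B_gt0 (a := var AC) vE2 (erefl _) (fun=> AB)) _ => s3 M3 [sl3 ag3 jE].
move: sl3 jE; rewrite /= ac2 => sl3 jE.
split.
- have JL := lg_le0 bd (predI C (predC (ball (M (LAM d)) r))) Vle.
  have sub : \sum_(x <- Qs | ball (M (LAM d)) r x) degr d x <= \sum_(x <- Qs) degr d x.
    by rewrite big_mkcond; apply: leq_sum => x _; case: ifP.
  move: sl1 sl2 sl3 JL sub; move: (trunc_log 2 _) (\sum_(x <- Qs | _) _) (\sum_(x <- Qs) _) (size Qs) (size Ls).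
  clear; lia.
- apply: agree_trans (agree_sub _ ag1) _; first by sublist.
  apply: agree_trans (agree_sub _ ag2) _; first by sublist.
  by apply: agree_sub ag3; sublist.
- by rewrite ag3 ?ag2.
- by rewrite ag3.
- by [].
Qed.

(** Radii are tried upwards from [D]; the search ends at the latest at the radius that
    [cheap_complement] provides. *)
Lemma wp_select d (C : pred nat) (M : memory) (Qs Ls : seq nat) V :
  round_static M -> qrep d Qs M -> uniq Qs -> (forall x, (x \in Qs) = (0 < M (LAM d) x)) ->
  (forall x, x \in Qs -> x < n) -> C = (fun z => M COMP z == M CQ 0) ->
  segment g M (M CQ 0) Ls -> M N1 0 = size Ls -> M VV 0 = V -> V <= vol predT ->
  closed g d C (M (LAM d)) (2 * D) ->
  (forall r, D <= r < 2 * D -> 2 * vol (predI C (predC (ball (M (LAM d)) r))) <= V) ->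
  wp B (select d) M (fun s M' =>
   [/\ s <= D.+1 * (30 * (\sum_(x <- Qs) degr d x + size Qs).+1 + 10 * (size Ls).+1 + 3 * Lm + 6),
       agree (select_mods d) M M' &
       exists r, [/\ D <= r < 2 * D, M' (LEV d) 0 = r,
         M' AC 0 = vol (predI C (predC (ball (M (LAM d)) r))) &
         cheap D h V (vol (predI C (predC (ball (M (LAM d)) r)))) (cutw d C (ball (M (LAM d)) r))]]).
Proof.
move=> rs qr uQ QE Qn CE sg n1 vE Vle cl hV; have B_gt0 := b_B bd.
have [rstar rsD chs] := cheap_complement (b_D bd) cl hV (fun U => @lg_le B g w beta D Lm bd V U Vle).
pose K := 30 * (\sum_(x <- Qs) degr d x + size Qs).+1 + 10 * (size Ls).+1 + 3 * Lm + 3.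
have -> : 30 * (\sum_(x <- Qs) degr d x + size Qs).+1 + 10 * (size Ls).+1 + 3 * Lm + 6 = K + 3 by rewrite /K; lia.
pose X r := predI C (predC (ball (M (LAM d)) r)).
pose P r (M2 : memory) := [/\ agree (select_mods d) M M2, M2 (LEV d) 0 = r,
  M2 DEL 0 = cutw d C (ball (M (LAM d)) r), M2 AC 0 = vol (X r) & M2 JJ 0 = trunc_log 2 (V %/ vol (X r))].
have try1 M1 r : agree (select_mods d) M M1 -> M1 (LEV d) 0 = r ->
    wp B (try_complement d) M1 (fun s M2 => s <= K /\ P r M2).
  move=> ag lev.
  have rs1 : round_static M1 by apply: round_static_agree ag rs; case: (d).
  have lE : M1 (LAM d) = M (LAM d) by rewrite ag //; neqarr.
  have qr1 : qrep d Qs M1 by rewrite /qrep !ag //; neqarr.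
  have QE1 x : (x \in Qs) = (0 < M1 (LAM d) x) by rewrite lE.
  have CE1 : C = (fun z => M1 COMP z == M1 CQ 0) by rewrite CE !ag //; neqarr.
  have sg1 : segment g M1 (M1 CQ 0) Ls by rewrite /segment !ag //; neqarr.
  have n11 : M1 N1 0 = size Ls by rewrite ag //; neqarr.
  have vE1 : M1 VV 0 = V by rewrite ag //; neqarr.
  apply: wp_conseq (wp_try_complement rs1 qr1 uQ QE1 Qn CE1 lev sg1 n11 vE1 Vle) _ => s M2 [sl ag2 d2 a2 j2].
  rewrite lE in d2 a2 j2; split=> //; split=> //.
    by apply: agree_trans ag _; apply: agree_sub ag2; sublist.
  by rewrite ag2 //; neqarr.
have tE r M2 : P r M2 -> (expr_val M2 (Bin Defs.Sub (Cst 1) (cut_test (var AC))) != 0) =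
    ~~ (cutw d C (ball (M (LAM d)) r) * D <= 4 * h * vol (X r) * trunc_log 2 (V %/ vol (X r))).
  move=> [ag lev de ae je].
  have hE : M2 HH 0 = h by rewrite ag ?(rs_h rs) //; neqarr.
  have DE : M2 0 2 = D by rewrite ag ?(rs_D rs) //; neqarr.
  by rewrite /= de ae je hE DE; move: (_ * D) (4 * _ * _ * _) => a1 a2; clear; lia.
apply: wp_seq; wset => /=; rewrite (rs_D rs); first by have := b_D2 bd; lia.
have ag0 : agree (select_mods d) M (update M (LEV d) 0 D) by apply: agree_update; rewrite ?inE ?eqxx.
apply: wp_seq; apply: wp_conseq (try1 _ D ag0 _) _; first by upds.
move=> s1 M1 [sl1 P1].
pose I k s (M2 : memory) := exists r, [/\ D <= r <= rstar, k = rstar - r, s <= (r - D) * (K + 2) & P r M2].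
apply: (wp_while B_gt0 (I := I) (k0 := rstar - D)).
- by exists D; split=> //; lia.
- move=> k s M2 [r [rr kE sl P2]]; rewrite (tE _ _ P2) => nch.
  have rlt : r < rstar.
    rewrite ltn_neqAle; case/andP: rr => _ ->; rewrite andbT.
    by apply: contra nch => /eqP ->.
  have [ag lev _ _ _] := P2.
  apply: wp_seq; wset => /=; rewrite lev; first by have := b_D2 bd; lia.
  rewrite addn1.
  have ag3 : agree (select_mods d) M (update M2 (LEV d) 0 r.+1) by apply: agree_update; rewrite ?inE ?eqxx.
  apply: wp_conseq (try1 _ r.+1 ag3 _) _; first by upds.
  move=> s' M3 [sl3 P3]; exists (rstar - r.+1); first by lia.
  exists r.+1; split=> //; first by lia.
  have -> : r.+1 - D = (r - D).+1 by lia.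
  by rewrite mulSn; move: ((r - D) * _) sl => z; clear -sl3; lia.
- move=> k s M2 [r [rr kE sl P2]] /eqP; rewrite -[_ == _]negbK (tE _ _ P2) negbK => chr.
  have [ag lev de ae je] := P2; split=> //; last by exists r; split=> //; lia.
  have h1 : (r - D) * (K + 2) <= D * (K + 2) by rewrite leq_mul2r; apply/orP; right; lia.
  apply: leq_trans (_ : 1 + (K + (D * (K + 2) + 1)) <= _); first by lia.
  by rewrite mulSn; move: (K); clear; nia.
Qed.

(** Stated for an arbitrary list [Ls] and test [cond], so as to serve both for balls, listed by the
    queue, and for complements, listed by the segment of the part. *)
Lemma wp_carve d (C : pred nat) (M : memory) (Qs Ls : seq nat) r row (se : expr) (hi : nat) (cond a : expr)
    (P X : pred nat) A :
  round_static M -> qrep d Qs M -> (forall x, (x \in Qs) = (0 < M (LAM d) x)) ->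
  (forall x, x \in Qs -> x < n) -> C = (fun z => M COMP z == M CQ 0) -> M (LEV d) 0 = r -> M ROW 0 = row ->
  hi \notin [:: COMP; LL; TOP; I1; VX; VE; VY; 5; ST] -> (forall x, x \in Ls -> x < n) -> uniq Ls -> M hi 0 = size Ls ->
  M CQ 0 < M NP 0 -> M TOP 0 + size Ls < 2 ^ B -> (M NP 0).+1 < 2 ^ B ->
  (forall M2 F (l : seq nat), agree [:: 5; ST; COMP; LL; TOP; I1; VX; VE; VY] M M2 ->
     M2 ST (M CQ 0) = M ST (M CQ 0) -> moved (M NP 0) (M TOP 0) F M M2 ->
     M2 I1 0 = size l -> size l < size Ls -> expr_val M2 se = nth 0 Ls (size l)) ->
  (forall M2 F x, agree [:: 5; ST; COMP; LL; TOP; I1; VX; VE; VY] M M2 ->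
     moved (M NP 0) (M TOP 0) F M M2 -> M2 VX 0 = x -> x \in Ls -> x \notin F ->
     (expr_val M2 cond != 0) = P x) ->
  (forall M2, agree carve_mods M M2 -> expr_val M2 a = A) -> A < 2 ^ B ->
  (forall x, X x = (x \in Ls) && P x) ->
  wp B (carve d (listloop se hi cond move_vertex) a) M (fun s M' =>
   [/\ s <= 30 * (\sum_(x <- Qs | ball (M (LAM d)) r x) degr d x + size Qs + 1) + 9 * (size Ls).+1 + 5,
       agree carve_mods M M' &
       exists F, carved g row X A (crosses g d C (ball (M (LAM d)) r)) F M M']).
Proof.
move=> rs qr QE Qn CE lev rowE hiN LB uL hiE cqlt topB npB seE condP aE AB XE; have B_gt0 := b_B bd.
apply: wp_seq; wput => /=; first by move=> bM; apply: bM.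
set M1 := update _ _ _ _.
have ag1 : agree [:: ST] M M1 by apply: agree_update; rewrite ?inE ?eqxx.
have rs1 : round_static M1 by apply: round_static_agree ag1 rs.
have lE1 : M1 (LAM d) = M (LAM d) by rewrite ag1 //; neqarr.
have qr1 : qrep d Qs M1 by rewrite /qrep !ag1 //; neqarr.
have QE1 x : (x \in Qs) = (0 < M1 (LAM d) x) by rewrite lE1.
have CE1 : C = (fun z => M1 COMP z == M1 CQ 0) by rewrite CE !ag1 //; neqarr.
have lev1 : M1 (LEV d) 0 = r by rewrite ag1 //; neqarr.
have row1 : M1 ROW 0 = row by rewrite ag1.
have st1 : M1 ST = fupd (M ST) (M NP 0) (M TOP 0) by rewrite /M1 updE.
apply: wp_seq; apply: wp_conseq (wp_mark bd rs1 qr1 QE1 Qn CE1 lev1 row1) _ => s2 M2 [sl2 ag2 c2].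
rewrite lE1 in sl2 c2.
have e2 a0 : a0 \notin [:: 5; ST; I1; VX; VE; VY] -> M2 a0 = M a0.
  by rewrite !inE => hA; rewrite ag2 ?ag1 // !inE; lia.
have st2 : M2 ST = fupd (M ST) (M NP 0) (M TOP 0) by rewrite ag2.
have hiN2 : hi \notin [:: COMP; LL; TOP; I1; VX].
  by apply: contra hiN; rewrite !inE; do 4 (case/orP => [->|]; rewrite ?orbT //); move=> ->; rewrite !orbT.
have hi2 : M2 hi 0 = size Ls.
  rewrite e2 //; apply: contra hiN; rewrite !inE.
  by do 5 (case/orP => [->|]; rewrite ?orbT //); move=> ->; rewrite !orbT.
have ag3X M3 : agree [:: COMP; LL; TOP; I1; VX] M2 M3 -> agree [:: 5; ST; COMP; LL; TOP; I1; VX; VE; VY] M M3.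
  by move=> ag3 b; rewrite !inE => hb; rewrite ag3 ?e2 // !inE; lia.
have mvX M3 F : moved (M NP 0) (M TOP 0) F M2 M3 -> moved (M NP 0) (M TOP 0) F M M3.
  by case=> h1 h2 h3; split=> // z; rewrite ?h1 ?h2 !e2.
apply: wp_seq; apply: wp_conseq (wp_relabel (Ls := Ls) (P := P) (np := M NP 0) (top := M TOP 0) B_gt0 hiN2 _ uL hi2 _ _ topB _ _) _.
- by move=> x /LB xn; apply: ltn_trans xn (b_n bd).
- by rewrite e2.
- by rewrite e2.
- move=> M3 F l ag3 mv i1 il; apply: seE i1 il; [exact: ag3X ag3 | | exact: mvX mv].
  by rewrite ag3 // st2 fupdN //; lia.
- by move=> M3 F x ag3 mv vx xL xF; apply: condP vx xL xF; [exact: ag3X ag3 | exact: mvX mv].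
move=> s3 M3 [sl3 ag3 mv]; have {}mv := mvX _ _ mv.
have [h1 h2 h3] := mv; have ag03 := ag3X _ ag3.
set F := [seq x <- Ls | P x] in h1 h2 h3.
have np3 : M3 NP 0 = M NP 0 by rewrite ag03.
apply: wp_seq; wput => /=; rewrite h3.
  by move=> _; apply: leq_ltn_trans topB; rewrite leq_add2l size_filter count_size.
rewrite np3; set M4 := update _ _ _ _.
have ag04 : agree carve_mods M M4.
  by apply: agree_update; [rewrite !inE | apply: agree_sub ag03; sublist].
apply: wp_seq; wput => /=; rewrite (aE _ ag04) //.
have np4 : M4 NP 0 = M NP 0 by rewrite /M4; upds.
rewrite np4.
apply: wp_seq; wput => /=; first by rewrite expn_gt0.
upds; rewrite np4; wset => /=; upds; rewrite np4 ?addn1 //.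
split.
- move: sl2 sl3; move: (\sum_(x <- _ | _) _) (size Qs) (size Ls); clear; lia.
- by do 3 (apply: agree_update; first by rewrite !inE ?eqxx ?orbT); exact: ag04.
exists F; split; rewrite ?np3 /M4; upds => //.
- move=> z; rewrite h1 XE; congr (if _ then _ else _).
  by rewrite /F mem_filter andbC.
- by rewrite filter_uniq.
- by move=> x; rewrite /F mem_filter andbC XE.
- by rewrite ag3 // st2.
- by rewrite (ag03 EN).
- by rewrite (ag03 VOL).
- by rewrite (ag03 DONE).
- by move=> j; rewrite (ag3 5) // c2 (ag1 5).
Qed.

End Large.

(** * Processing one part *)

Definition split_off d : cmd :=
  Seq (select d) (carve d (relabel_complement d) (var AC)).

(** The length of the segment is stored in [N1] only after both explorations, because [relax] uses
    [N1] as well. *)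
Definition large : cmd :=
  Seq (finish false) (Seq (finish true)
    (Seq (Set_ N1 (Bin Defs.Sub (Get EN (var CQ)) (Get ST (var CQ))))
      (Seq (split_off false) (Seq (split_off true) (Put DONE (var CQ) (Cst 1)))))).

Definition small : cmd :=
  If (eqE (var FND) (Cst 1)) (carve false (relabel_ball false) (var (AA false)))
    (carve true (relabel_ball true) (var (AA true))).

Definition process : cmd :=
  Seq (Set_ CQ (Get COMP (var CX))) (Seq (Set_ VV (Get VOL (var CQ))) (Seq (Set_ FND (Cst 0))
    (Seq (start false) (Seq (start true) (Seq explore
      (Seq (If (var FND) small large)
        (Seq (cleanup false) (cleanup true)))))))).

Notation part_arrays := [:: 5; ST; EN; VOL; DONE; NP; COMP; LL; TOP].

Notation large_mods := [:: 5; ST; EN; VOL; DONE; NP; COMP; LL; TOP;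
  LAM false; QQ false; QL false; LEV false; LAM true; QQ true; QL true; LEV true;
  VY; NL; VX; VE; I1; N1; DEL; AC; YY; JJ].

Section Process.
Variables (B : nat) (g : graph) (w : nat -> nat) (beta D Lm row : nat).
Notation n := (nv g).
Notation degr := (degr g).
Notation vol := (vol g w beta).
Notation cutw := (cutw g w).
Notation h := (bits Lm).
Notation round_static := (round_static g w beta D Lm).
Notation dstate := (dstate g w beta D Lm).
Notation est := (est g).
Notation bvol := (bvol g w beta).
Notation dgs := (dgs g).
Notation degsum := (degsum g).
Notation dtot := (dtot g).
Notation pinv := (pinv g w beta D Lm row).
Notation tpot := (tpot g Lm).
Hypothesis bd : bounds B g w beta D Lm.

Lemma pinv_agree xs T0 M M' lv : all (fun a => a \notin xs) part_arrays -> agree xs M M' ->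
  pinv T0 M lv -> pinv T0 M' lv.
Proof.
move=> /allP hx ag; have e a : a \in part_arrays -> M' a = M a by move=> /hx; apply: ag.
case=> p1 p2 p3 p4 p5 p6 p7 p8.
have rE : cut_row row M' = cut_row row M by rewrite /cut_row e.
have pE q' : part M' q' = part M q' by rewrite /part e.
split; rewrite ?rE.
- by rewrite e.
- by move=> x; rewrite !e.
- move=> q; rewrite e // => /p3 [Ls [s1 s2 s3 s4 s5]]; exists Ls; rewrite /segment.
  by rewrite !(e EN, e ST, e LL, e TOP, e COMP).
- by move=> q; rewrite pE !e //; apply: p4.
- by move=> q; rewrite pE !e //; apply: p5.
- by move=> x y; rewrite !e //; apply: p6.
- by rewrite !e.
- by move=> j; rewrite e.
Qed.

Lemma tpot_agree xs M M' lv : all (fun a => a \notin xs) part_arrays -> agree xs M M' ->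
  tpot M' lv = tpot M lv.
Proof.
move=> /allP hx ag; have e a : a \in part_arrays -> M' a = M a by move=> /hx; apply: ag.
by rewrite /tpot /live !e.
Qed.

Lemma spot_agree xs M M' : all (fun a => a \notin xs) part_arrays -> agree xs M M' ->
  spot M' = spot M.
Proof.
move=> /allP hx ag; have e a : a \in part_arrays -> M' a = M a by move=> /hx; apply: ag.
by rewrite /spot !e.
Qed.

(** [x] still occurs at a position from [i] onwards in the segment of its current part, so the
    traversal of [LL] is going to meet it there. *)
Definition pending (M : memory) i x := exists j,
  [/\ i <= j, M ST (M COMP x) <= j < M EN (M COMP x) & M LL j = x].

(** The first case is that of a moved vertex: its new entry lies beyond the old end of [LL], hence
    beyond every position reached so far. *)
Definition pend_le (M M' : memory) := forall x, live M' x ->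
  (forall i, i <= M TOP 0 -> pending M' i x) \/
  [/\ live M x, M' COMP x = M COMP x & forall i, pending M i x -> pending M' i x].

Lemma pend_le_trans M1 M2 M3 : M1 TOP 0 <= M2 TOP 0 -> pend_le M1 M2 -> pend_le M2 M3 -> pend_le M1 M3.
Proof.
move=> top h1 h2 x l3; have [h|[l2 c2 h]] := h2 x l3.
  by left=> i hi; apply: h; apply: leq_trans top.
have [h'|[l1 c1 h']] := h1 x l2; first by left=> i /h'; apply: h.
by right; split; rewrite ?c2 // => i /h'; apply: h.
Qed.

Lemma pend_le_agree xs M M' : all (fun a => a \notin xs) part_arrays -> agree xs M M' -> pend_le M M'.
Proof.
move=> /allP hx ag; have e a : a \in part_arrays -> M' a = M a by move=> /hx; apply: ag.
by move=> x; rewrite /live /pending !e // => l; right.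
Qed.

Lemma pend_le_carve T0 M M' lv q (X : pred nat) A cutp F : pinv T0 M lv -> 0 < q < M NP 0 ->
  (forall x, X x -> M COMP x = q) -> carved g row X A cutp F M M' -> pend_le M M'.
Proof.
move=> pi q_lt XC cv x l'; have [p1 p2 p3 _ _ _ _ _] := pi.
have c' := c_comp cv x; case: (boolP (X x)) c' => Xx c'.
  left=> i hi; exists (M TOP 0 + index x F).
  have xF : x \in F by rewrite (c_mem cv).
  have iF : index x F < size F by rewrite index_mem.
  rewrite c' (c_ST cv) (c_EN cv) !fupdE (c_LL cv) leq_addr ltn_add2l iF /= addKn nth_index //.
  by split=> //; apply: leq_trans hi _; apply: leq_addr.
have [lt _] := p2 x; have cN : M COMP x != M NP 0 by lia.
move: l'; rewrite /live c' (c_DONE cv) fupdN // => l; right; split=> // i [j [ij sj lj]].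
have cx0 : 0 < M COMP x by rewrite lt0n; case/andP: l.
have [|Ls [s1 s2 _ _ _]] := p3 (M COMP x); first by rewrite cx0.
exists j; rewrite c' (c_ST cv) (c_EN cv) !fupdN // (c_LL cv) ifF //.
by case/andP: sj => _ jE; apply/negP => /andP[tj _]; move: (leq_ltn_trans tj (leq_trans jE s2)); rewrite ltnn.
Qed.

Lemma pend_le_done M M' q : agree [:: DONE] M M' -> M' DONE = fupd (M DONE) q 1 -> pend_le M M'.
Proof.
move=> ag dE x; rewrite /live /pending (ag COMP) // dE /fupd (ag ST) // (ag EN) // (ag LL) //.
case: (eqVneq (M COMP x) q) => _; first by case/andP.
by move=> l; right; split.
Qed.

Lemma dgs_lt d (C : pred nat) lam r v : C v -> ball lam r v -> v < n ->
  (dgs d (ball lam r)).+1 <= \sum_(x < n | ball lam r x) (dtot x).+1.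
Proof.
move=> Cv bv vn; rewrite /dgs (bigD1 (Ordinal vn)) //= [X in _ <= X](bigD1 (Ordinal vn)) //=.
have h1 : degr d v <= dtot v by rewrite /dtot; case: d; lia.
have h2 : \sum_(i < n | ball lam r i && (i != Ordinal vn)) degr d i <=
          \sum_(i < n | ball lam r i && (i != Ordinal vn)) (dtot i).+1.
  by apply: leq_sum => x _; rewrite /dtot; case: (d); lia.
by rewrite addSn ltnS; apply: leq_add.
Qed.

(** The root belongs to its ball and therefore leaves [q], which ensures that the traversal of [LL]
    makes progress. *)
Lemma wp_small T0 d v V (M : memory) lv r q s0 :
  round_static M -> pinv T0 M lv -> M ROW 0 = row -> M CQ 0 = q -> 0 < q < M NP 0 -> M DONE q = 0 ->
  M VOL q = V -> V <= vol predT -> v < n -> M COMP v = q ->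
  (M NP 0).+1 < 2 ^ B -> M TOP 0 + n < 2 ^ B ->
  found g w beta D Lm d (part M q) v V M r s0 ->
  wp B (carve d (relabel_ball d) (var (AA d))) M (fun s M' =>
    [/\ agree carve_mods M M' , M' COMP v != q &
    exists lv', [/\ pinv T0 M' lv', pend_le M M' /\ M' NP 0 = (M NP 0).+1,
    tpot M' lv' + \sum_(x < n | ball (M (LAM d)) r x) (dtot x).+1 <= tpot M lv,
    spot M' <= spot M + \sum_(x < n | ball (M (LAM d)) r x) (dtot x).+1 /\
    M' TOP 0 <= M TOP 0 + \sum_(x < n | ball (M (LAM d)) r x) (dtot x).+1 /\ M TOP 0 <= M' TOP 0 &
    s <= 100 * (dgs d (ball (M (LAM d)) r)).+1]]).
Proof.
move=> rs pi rowE cqE q_lt dq vE Vle vn cvE npB topB fd; have B_gt0 := b_B bd.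
set C := part M q; set U := ball (M (LAM d)) r.
have [Qs es] := f_est fd; have [qr ex cl sq lev] := es.
have CE : C = (fun z => M COMP z == M CQ 0) by rewrite cqE.
have bC x : U x -> C x by apply: ball_C ex.
have XE : U = predI C U by apply/funext => x /=; case Ux: (U x); rewrite ?andbF // bC.
have szQ := explored_size ex.
have AE : M (AA d) 0 = vol U by rewrite (f_AA fd) /bvol -/U -XE.
have sz := est_size_pred es.
apply: wp_conseq (wp_carve bd (Ls := Qs) (P := fun x => M (LAM d) x <= r.+1) (X := U) (A := vol U) rs qr (ex_mem ex) (ex_lt ex) CE lev rowE
   _ (ex_lt ex) (ex_uniq ex) (proj1 qr) _ _ npB _ _ _ _ _) _.
- by case: (d).
- by rewrite cqE; case/andP: q_lt.
- by apply: leq_ltn_trans topB; rewrite leq_add2l.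
- move=> M2 F l ag _ _ i2 il; rewrite /= i2 (ag (QQ d)); last by neqarr.
  by case: qr => _ ->.
- move=> M2 F x ag _ vx _ _; rewrite /in_ball condE /= vx (ag (LAM d)) ?(ag (LEV d)); try neqarr.
  by rewrite lev addn1.
- by move=> M2 ag; rewrite /= ag ?AE //; neqarr.
- by apply: leq_ltn_trans (b_vol bd); apply: vol_le.
- by move=> x; rewrite /U /ball (ex_mem ex).
move=> s M' [sl ag [F cv]].
have dq' : M DONE q = 0 := dq.
have A2 : 2 * vol U <= M VOL q by rewrite vE {1}XE; exact: f_small fd.
have ch : cheap D h (M VOL q) (vol U) (cutw d C U).
  by rewrite vE {1}XE; exact: f_cheap fd.
have XE' : U = predI C U \/ U = predI C (predC U) by left.
have bL := @b_Lm _ _ _ _ _ _ bd.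
split=> //.
  have [h1 _] := p_comp pi v.
  rewrite (c_comp cv) -/U ifT; last by rewrite /U /ball (ex_root ex).
  by lia.
exists (fupd lv (M NP 0) (lv q + trunc_log 2 (M VOL q %/ vol U))); split.
- exact: (pinv_carve bL pi q_lt dq XE' cv (erefl _) A2 ch).
- split; last exact: c_NP cv.
  by apply: (pend_le_carve pi q_lt _ cv) => x /bC /eqP.
- exact: (tpot_carve bL pi q_lt dq XE' cv (erefl _) A2 ch).
- split; first by rewrite (spot_carve pi q_lt dq cv (erefl _) A2 ch) leq_add2l; exact: (size_carved pi q_lt dq XE' cv (erefl _) A2 ch).
  rewrite (c_TOP cv) leq_add2l leq_addr; split=> //; exact: (size_carved pi q_lt dq XE' cv (erefl _) A2 ch).
rewrite (sum_explored (P := ball (M (LAM d)) r) (degr d) ex) in sl; last by move=> x /andP[].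
have {}sl : s <= 30 * (dgs d U + size Qs + 1) + 9 * (size Qs).+1 + 5 by exact: sl.
move: sl sz; rewrite -/U; move: (size Qs) (dgs d U); clear; lia.
Qed.

Lemma vol_split (C U : pred nat) : vol (predI C U) + vol (predI C (predC U)) = vol C.
Proof.
rewrite /vol [RHS](bigID (fun x : 'I_n => U x)) /=; congr (_ + _); exact: eq_bigl.
Qed.

(** A ball and its complement share a volume of at most [V]; once the ball has more than half of
    [V], the complements of all larger balls have less. *)
Lemma big_complement (C : pred nat) V lam lam' r r' : vol C <= V -> V < 2 * bvol C lam r ->
  ball lam' r = ball lam r -> r <= r' ->
  2 * vol (predI C (predC (ball lam' r'))) <= V.
Proof.
move=> CV big bE rr.
have := vol_split C (ball lam r).
have : vol (predI C (predC (ball lam' r'))) <= vol (predI C (predC (ball lam r))).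
  apply: vol_sub => x /= /andP[-> /=]; apply: contra; rewrite -bE; exact: ball_sub.
move: big; rewrite /bvol; lia.
Qed.

Lemma sum_queue_degsum d (C : pred nat) v lam (Qs : seq nat) : explored g d C v lam Qs ->
  \sum_(x <- Qs) degr d x <= degsum C.
Proof.
move=> ex; have -> : \sum_(x <- Qs) degr d x = \sum_(x <- Qs | 0 < lam x) degr d x.
  by rewrite big_seq [RHS]big_seq_cond; apply: eq_bigl => x; rewrite (ex_mem ex) andbb.
rewrite (sum_explored (P := fun x => 0 < lam x) (degr d) ex) //.
apply: (@dgs_degsum g d C (fun x => 0 < lam x)) => x; rewrite -(ex_mem ex); exact: (ex_C ex).
Qed.

Lemma est_size_degsum d (C : pred nat) v M r rc Qs : est d C v M r rc Qs -> size Qs <= (degsum C).+1.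
Proof.
move=> es; apply: leq_trans (est_size es) _; rewrite ltnS; apply: dgs_degsum => x; exact: (ball_C (e_ex es)).
Qed.

Definition zsum (C : pred nat) := \sum_(x < n | C x) (dtot x).+1.

(** [C0] is the part in which the labels were computed. When the second complement is cut, the part
    has already lost the first one; the labels are still closed in what remains and volumes only
    shrink, so [cheap_complement] applies. *)
Lemma wp_complement T0 d v V (M : memory) lv q Qs (lam : nat -> nat) Y dC (C0 : pred nat) rc :
  round_static M -> pinv T0 M lv -> M ROW 0 = row -> M CQ 0 = q -> 0 < q < M NP 0 -> M DONE q = 0 ->
  M VOL q = V -> M VV 0 = V -> V <= vol predT -> M N1 0 = Y -> Y = M EN q - M ST q ->
  (M NP 0).+1 < 2 ^ B -> M TOP 0 + n < 2 ^ B ->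
  est d C0 v M rc (2 * D) Qs -> (forall x, part M q x -> C0 x) -> degsum C0 <= dC -> lam = M (LAM d) ->
  (forall r, D <= r < 2 * D -> 2 * vol (predI C0 (predC (ball lam r))) <= V) ->
  wp B (split_off d) M (fun s M' =>
    [/\ agree [:: 5; ST; EN; VOL; DONE; NP; COMP; LL; TOP; LEV d; VX; VE; VY; I1; DEL; AC; YY; JJ] M M',
     M' NP 0 = (M NP 0).+1,
     s <= 130 * (D.+1 * (dC + Y + Lm + 3)) &
     exists (r : nat) (lv' : nat -> nat) (X : pred nat), [/\ r < 2 * D, (forall x, part M' q x = part M q x && ball lam r x),
       X = predI (part M q) (predC (ball lam r)),
       [/\ pinv T0 M' lv', pend_le M M', M' DONE q = 0, M' VOL q = V & M' EN q - M' ST q = Y] &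
       [/\ tpot M' lv' + zsum X <= tpot M lv, spot M' <= spot M + zsum X &
           [/\ M' TOP 0 <= M TOP 0 + zsum X, M' TOP 0 <= M TOP 0 + n & M TOP 0 <= M' TOP 0]]]]).
Proof.
move=> rs pi rowE cqE q_lt dq volE vE Vle n1E YE npB topB es CC dCle lamE hV; have B_gt0 := b_B bd.
have [qr ex cl sq lev] := es.
set C := part M q.
have CE : C = (fun z => M COMP z == M CQ 0) by rewrite cqE.
have [Ls sg] := p_seg pi q_lt.
have [sg1 sg2 sg3 sg4 [sg5 sg6]] := sg.
have szL : size Ls = Y by rewrite YE sg1 addKn.
have cl' : closed g d C (M (LAM d)) (2 * D).
  by move=> e em c1 c2; apply: cl => //; apply: CC.
have hV' r : D <= r < 2 * D -> 2 * vol (predI C (predC (ball (M (LAM d)) r))) <= V.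
  move=> rD; apply: leq_trans (hV _ rD); rewrite leq_mul2l /= lamE; apply: vol_sub => x /= /andP[/CC ->] //.
have sgq : segment g M (M CQ 0) Ls by rewrite cqE.
have n1L : M N1 0 = size Ls by rewrite n1E szL.
apply: wp_seq; apply: wp_conseq (wp_select bd rs qr (ex_uniq ex) (ex_mem ex) (ex_lt ex) CE sgq n1L vE Vle cl' hV') _.
move=> s1 M1 [sl1 ag1 [r [rD lev1 ac1 ch1]]].
have e1 a : a \notin [:: LEV d; DEL; AC; I1; VX; VE; VY; YY; JJ] -> M1 a = M a by apply: ag1.
have rs1 : round_static M1 by apply: round_static_agree ag1 rs; case: (d).
have lE1 : M1 (LAM d) = M (LAM d) by rewrite e1 //; neqarr.
have pE1 : part M1 q = C by rewrite /C /part e1 //; neqarr.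
have pi1 : pinv T0 M1 lv by apply: pinv_agree ag1 pi; case: (d).
have cq1 : M1 CQ 0 = q by rewrite e1 //; neqarr.
have np1 : M1 NP = M NP by rewrite e1 //; neqarr.
have top1 : M1 TOP = M TOP by rewrite e1 //; neqarr.
have q_lt1 : 0 < q < M1 NP 0 by rewrite np1.
have [Ls1 sgL] := p_seg pi1 q_lt1.
have [k1 k2 k3 k4 [k5 k6]] := sgL.
have en1 : M1 EN = M EN by rewrite e1 //; neqarr.
have st1 : M1 ST = M ST by rewrite e1 //; neqarr.
have szL1 : size Ls1 = Y by rewrite YE -en1 -st1 k1 addKn.
set U := ball (M (LAM d)) r.
set X : pred nat := predI C (predC U).
have sz1n : size Ls1 <= n.
  rewrite -[X in _ <= X](size_iota 0); apply: uniq_leq_size k4 _ => x /k6.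
  by rewrite mem_iota.
apply: wp_conseq (wp_carve bd (d := d) (C := C) (M := M1) (Qs := Qs) (Ls := Ls1) (r := r) (row := row)
  (P := fun x => (M COMP x == q) && ~~ U x) (X := X) (A := vol X)
  rs1 _ _ (ex_lt ex) _ lev1 _ _ k6 k4 _ _ _ _ _ _ _ _ _) _.
- by rewrite /qrep !e1 //; neqarr.
- by move=> x; rewrite lE1 (ex_mem ex).
- by rewrite /C /part e1 ?cq1 //; neqarr.
- by rewrite e1 //; neqarr.
- by [].
- by rewrite e1 ?n1E ?szL1 //; neqarr.
- by rewrite cq1; case/andP: q_lt1.
- by rewrite top1; apply: leq_ltn_trans topB; rewrite leq_add2l.
- by rewrite np1.
- move=> M2 F l ag stE [_ h2 _] i2 il.
  rewrite /= i2 (ag CQ) // stE cq1 h2 ifF ?k3 //.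
  move: k2; rewrite k1 => k2; apply/negP => /andP[h3 _]; move: (leq_trans k2 h3).
  by rewrite leq_add2l leqNgt il.
- move=> M2 F x ag [h1 _ _] vx xL xF.
  rewrite /in_part /out_ball !condE /= vx h1 (negbTE xF) (ag CQ) // cq1 (ag (LAM d)) ?(ag (LEV d)); try neqarr.
  rewrite lE1 lev1 addn1 (e1 COMP); last by neqarr.
  by rewrite /U /ball; case: (_ == q) => //=; lia.
- by move=> M2 ag; rewrite /= ag // ac1.
- by apply: leq_ltn_trans (b_vol bd); apply: vol_le.
- move=> x; rewrite /X /= /C /part; case: (eqVneq (M COMP x) q) => cx; rewrite ?andbF //=.
  by rewrite k5 // (e1 COMP) //; neqarr.
move=> s2 M2 [sl2 ag2 [F cv]].
rewrite lE1 -/U in cv sl2.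
have cv' : carved g row X (vol X) (crosses g d (part M1 q) U) F M1 M2 by rewrite pE1.
have XE : X = predI (part M1 q) U \/ X = predI (part M1 q) (predC U) by right; rewrite pE1.
have vol1 : M1 VOL q = V by rewrite e1 //; neqarr.
have dq1 : M1 DONE q = 0 by rewrite e1 //; neqarr.
have A2 : 2 * vol X <= M1 VOL q by rewrite vol1; apply: hV'.
have ch : cheap D h (M1 VOL q) (vol X) (cutw d (part M1 q) U) by rewrite vol1 pE1.
have bL := @b_Lm _ _ _ _ _ _ bd.
have XC x : X x -> M1 COMP x = q by case/andP=> cx _; apply/eqP; rewrite -[_ == _]/(part M1 q x) pE1.
have sub1 : all (fun a => a \notin [:: LEV d; DEL; AC; I1; VX; VE; VY; YY; JJ]) part_arrays by case: (d).
have sF := size_carved pi1 q_lt1 dq1 XE cv' (erefl _) A2 ch.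
have qN : q != M1 NP 0 by lia.
split.
- apply: agree_trans (agree_sub _ ag1) _; first by sublist.
  by apply: agree_sub ag2; sublist.
- by rewrite (c_NP cv) np1.
- have h1 := sum_ball_degsum r ex; have h2 := sum_queue_degsum ex; have h3 := est_size_degsum es.
  move: sl1 sl2 h1 h2 h3 dCle; rewrite szL szL1 -/U.
  move: (\sum_(x <- Qs | _) _) (\sum_(x <- Qs) _) (size Qs) (degsum C0) => a1 a2 a3 a4.
  move=> sl1 sl2 h1 h2 h3 h4.
  have sl1' : s1 <= D.+1 * (60 * (dC + Y + Lm + 3)).
    by apply: leq_trans sl1 _; rewrite leq_mul2l; apply/orP; right; lia.
  have sl2' : s2 <= D.+1 * (60 * (dC + Y + Lm + 3)).
    by apply: leq_trans (leq_pmull _ (ltn0Sn D)); lia.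
  move: sl1' sl2'; rewrite !(mulnCA D.+1); move: (D.+1 * _) => W; clear; lia.
exists r, (fupd lv (M1 NP 0) (lv q + trunc_log 2 (M1 VOL q %/ vol X))), X; split=> //.
- by case/andP: rD.
- move=> x; rewrite /part (c_comp cv) np1 lamE -/U.
  case: (boolP (X x)) => [/andP[/= cx ux]|nx].
    rewrite (negbTE ux) andbF; apply/negbTE; lia.
  rewrite (e1 COMP); last by neqarr.
  move: nx; rewrite /X /= negb_and negbK /C /part; case: (_ == q) => //=.
- by rewrite lamE.
- split.
  + exact: (pinv_carve bL pi1 q_lt1 dq1 XE cv' (erefl _) A2 ch).
  + apply: (@pend_le_trans _ M1); [by rewrite top1 | exact: pend_le_agree sub1 ag1 |].
    exact: (pend_le_carve pi1 q_lt1 XC cv').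
  + by rewrite (c_DONE cv) fupdN.
  + by rewrite (c_VOL cv) fupdN.
  + by rewrite (c_EN cv) (c_ST cv) !fupdN // YE !e1 //; neqarr.
- rewrite -(tpot_agree lv sub1 ag1) -(spot_agree sub1 ag1) -top1; split.
  + exact: (tpot_carve bL pi1 q_lt1 dq1 XE cv' (erefl _) A2 ch).
  + by rewrite (spot_carve pi1 q_lt1 dq1 cv' (erefl _) A2 ch) leq_add2l.
  + rewrite (c_TOP cv') !leq_add2l leq_addr; split=> //.
    rewrite -[X in _ <= X](size_iota 0); apply: uniq_leq_size (c_uniq cv') _ => x.
    rewrite mem_iota (c_mem cv') => /XC cx; apply: k6; exact: k5.
Qed.

Lemma wp_large T0 v V (M : memory) lv q Y :
  round_static M -> pinv T0 M lv -> M ROW 0 = row -> M CQ 0 = q -> 0 < q < M NP 0 -> M DONE q = 0 ->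
  M VOL q = V -> M VV 0 = V -> V <= vol predT -> Y = M EN q - M ST q ->
  (M NP 0).+2 < 2 ^ B -> M TOP 0 + n + n < 2 ^ B -> v < n -> M COMP v = q ->
  (forall d, exists2 r, r <= D & dstate d (part M q) v V M r /\ V < 2 * bvol (part M q) (M (LAM d)) r) ->
  wp B large M (fun s M' =>
    [/\ agree large_mods M M', M' DONE q != 0, M' NP 0 = (M NP 0).+2,
     (forall d, exists Qs, [/\ qrep d Qs M', forall x, (x \in Qs) = (0 < M' (LAM d) x),
        forall x, x \in Qs -> x < n & size Qs <= zsum (part M q)]) &
     exists lv', [/\ pinv T0 M' lv', pend_le M M',
       tpot M' lv' + zsum (part M q) <= tpot M lv,
       spot M' + Y <= spot M + zsum (part M q) /\
       M' TOP 0 <= M TOP 0 + zsum (part M q) /\ M TOP 0 <= M' TOP 0 &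
       s <= 1000 * (D.+1 * (zsum (part M q) + Y + Lm + 3))]]).
Proof.
move=> rs pi rowE cqE q_lt dq volE vE Vle YE npB topB vn cvE hd; have B_gt0 := b_B bd.
set C := part M q; set Z := zsum C.
have Cv : C v by apply/eqP.
have dCZ : (degsum C).+1 <= Z.
  rewrite /Z /zsum /degsum (bigD1 (Ordinal vn)) //= [X in _ <= X](bigD1 (Ordinal vn)) //= addSn ltnS; apply: leq_add => //.
  by apply: leq_sum.
have CE : C = (fun z => M COMP z == M CQ 0) by rewrite cqE.
have volC : vol C <= V by rewrite -volE; have [] := p_vol pi q_lt.
have [rF rFD [dsF bigF]] := hd false; have [rT rTD [dsT bigT]] := hd true.
have [QF0 esF0] := d_est dsF; have [QT0 esT0] := d_est dsT.
have rF2 : rF <= 2 * D by lia.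
have rT2 : rT <= 2 * D by lia.
apply: wp_seq; apply: wp_conseq (wp_finish bd rs CE esF0 rF2) _ => s1 M1 [sl1 ag1 [QF esF] bF].
have e1 a : a \notin [:: LAM false; QQ false; QL false; VY; NL; VX; VE; I1; N1; LEV false] -> M1 a = M a by apply: ag1.
have rs1 : round_static M1 by apply: round_static_agree ag1 rs.
have CE1 : C = (fun z => M1 COMP z == M1 CQ 0) by rewrite CE !e1.
have esT1 : est true C v M1 rT rT QT0 by apply: est_agree ag1 esT0.
apply: wp_seq; apply: wp_conseq (wp_finish bd rs1 CE1 esT1 rT2) _ => s2 M2 [sl2 ag2 [QT esT] bT].
have e2 a : a \notin [:: LAM true; QQ true; QL true; VY; NL; VX; VE; I1; N1; LEV true] -> M2 a = M1 a by apply: ag2.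
have esF2 : est false C v M2 (2 * D) (2 * D) QF by apply: est_agree ag2 esF.
apply: wp_seq; wset => /=; rewrite !(e2 EN, e2 ST, e2 CQ, e1 EN, e1 ST, e1 CQ) // cqE -YE.
  move=> bM; rewrite YE; have := bM EN q; rewrite e2 // e1 //; lia.
set M3 := update _ _ _ _.
have ag3 : agree [:: N1] M2 M3 by apply: agree_update; rewrite ?inE ?eqxx.
have ag03 : agree [:: LAM false; QQ false; QL false; LAM true; QQ true; QL true; VY; NL; VX; VE; I1; N1; LEV false; LEV true] M M3.
  apply: agree_trans (agree_sub _ ag1) _; first by sublist.
  apply: agree_trans (agree_sub _ ag2) _; first by sublist.
  by apply: agree_sub ag3; sublist.
have e3 a : a \notin [:: LAM false; QQ false; QL false; LAM true; QQ true; QL true; VY; NL; VX; VE; I1; N1; LEV false; LEV true] -> M3 a = M a.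
  exact: ag03.
have rs3 : round_static M3 by apply: round_static_agree ag03 rs.
have pi3 : pinv T0 M3 lv by apply: pinv_agree ag03 pi.
have lF3 : M3 (LAM false) = M1 (LAM false) by rewrite ag3 ?e2.
have lT3 : M3 (LAM true) = M2 (LAM true) by rewrite ag3.
have esF3 : est false C v M3 (2 * D) (2 * D) QF by apply: est_agree ag3 esF2.
have esT3 : est true C v M3 (2 * D) (2 * D) QT by apply: est_agree ag3 esT.
have pE3 : part M3 q = C by rewrite /C /part e3.
have hF r : D <= r < 2 * D -> 2 * vol (predI C (predC (ball (M3 (LAM false)) r))) <= V.
  by move=> rD; rewrite lF3; apply: (big_complement volC bigF (bF _ (leqnn _))); lia.
have hT r : D <= r < 2 * D -> 2 * vol (predI C (predC (ball (M3 (LAM true)) r))) <= V.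
  move=> rD; rewrite lT3; apply: (big_complement volC bigT (lam := M (LAM true)) (r := rT)); last by lia.
  by rewrite bT // e1.
have q_lt3 : 0 < q < M3 NP 0 by rewrite e3.
apply: wp_seq; apply: wp_conseq (wp_complement (T0 := T0) (d := false) (v := v) (V := V) (lv := lv) (q := q) (Qs := QF)
  (lam := M1 (LAM false)) (Y := Y) (dC := degsum C) (C0 := C) (rc := 2 * D) rs3 pi3 _ _ q_lt3 _ _ _ Vle _ _ _ _ esF3 _ _ _ _) _.
- by rewrite e3.
- by rewrite e3.
- by rewrite e3.
- by rewrite e3.
- by rewrite e3.
- by rewrite /M3; upds.
- by rewrite !e3.
- by rewrite e3 // ltnW.
- by rewrite e3 //; apply: leq_ltn_trans topB; rewrite leq_addr.
- by move=> x; rewrite pE3.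
- by [].
- by rewrite lF3.
- by move=> r rD; rewrite -lF3; apply: hF.
move=> s4 M4 [ag4 np4 sl4 [r4 [lv4 [X4 [r4D pE4 X4E [pi4 pend4 dq4 vol4 YE4] [tp4 sp4 [top4 top4n top4']]]]]]].
have ag4' : agree [:: 5; ST; EN; VOL; DONE; NP; COMP; LL; TOP; LEV false; VX; VE; VY; I1; DEL; AC; YY; JJ] M3 M4 by exact: ag4.
have rs4 : round_static M4 by apply: round_static_agree ag4' rs3.
have esT4 : est true C v M4 (2 * D) (2 * D) QT by apply: est_agree ag4' esT3.
have esF4 : explored g false C v (M4 (LAM false)) QF by rewrite ag4' //; exact: e_ex esF3.
rewrite pE3 in X4E pE4.
have np3 : M3 NP = M NP by rewrite e3.
have q_lt4 : 0 < q < M4 NP 0 by rewrite np4 np3; lia.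
have top3 : M3 TOP = M TOP by rewrite e3.
apply: wp_seq; apply: wp_conseq (wp_complement (T0 := T0) (d := true) (v := v) (V := V) (lv := lv4) (q := q) (Qs := QT)
  (lam := M2 (LAM true)) (Y := Y) (dC := degsum C) (C0 := C) (rc := 2 * D) rs4 pi4 _ _ q_lt4 dq4 vol4 _ Vle _ _ _ _ esT4 _ _ _ _) _.
- by rewrite ag4' // e3.
- by rewrite ag4' // e3.
- by rewrite ag4' // e3.
- by rewrite ag4' // /M3; upds.
- by [].
- by rewrite np4 np3.
- by apply: leq_ltn_trans topB; rewrite leq_add2r -top3.
- by move=> x; rewrite pE4 => /andP[].
- by [].
- by rewrite ag4' // lT3.
- by move=> r rD; rewrite -lT3; apply: hT.
move=> s5 M5 [ag5 np5 sl5 [r5 [lv5 [X5 [r5D pE5 X5E [pi5 pend5 dq5 vol5 YE5] [tp5 sp5 [top5 top5n top5']]]]]]].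
have ag5' : agree [:: 5; ST; EN; VOL; DONE; NP; COMP; LL; TOP; LEV true; VX; VE; VY; I1; DEL; AC; YY; JJ] M4 M5 by exact: ag5.
have B1 : 1 < 2 ^ B by have := b_D2 bd; lia.
wput => //=.
have cq5 : M5 CQ 0 = q by rewrite ag5' // ag4' // e3.
rewrite cq5; set M6 := update _ _ _ _.
have ag6 : agree [:: DONE] M5 M6 by apply: agree_update; rewrite ?inE ?eqxx.
have dE6 : M6 DONE = fupd (M5 DONE) q 1 by rewrite /M6; upds.
have q_lt5 : 0 < q < M5 NP 0 by rewrite np5; lia.
have bL := @b_Lm _ _ _ _ _ _ bd.
(* Both complements and the core form a partition of the part, so the released potentials add up to
   [Z]. *)
have zsplit : zsum X4 + zsum X5 + zsum (part M5 q) = Z.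
  rewrite /Z /zsum [in LHS]big_mkcond [X in _ + X + _]big_mkcond [X in _ + X]big_mkcond [RHS]big_mkcond.
  rewrite -!big_split; apply: eq_bigr => x _ /=.
  rewrite pE5 X5E X4E /= pE4; case: (C x) => //=.
  by case: (ball _ _ _) => //=; case: (ball _ _ _) => //=; lia.
have tp6 := tpot_done bL pi5 q_lt5 dq5 ag6 dE6.
have sp6 := spot_done q_lt5 dq5 ag6 dE6.
(* The remaining vertices have labels of at most [2 * D] in both directions, and [4 * l < lam x]
   gives [2 * l <= D]. *)
have hcore : core g D (part M5 q).
  exists v => x; rewrite pE5 pE4 => /andP[/andP[Cx b4] b5]; case.
    have xT : x \in QT by rewrite (ex_mem (e_ex esT4)) ag4' // lT3; case/andP: b5.
    have [l wl hl] := ex_walk (e_ex esT4) xT.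
    by exists l => //; move: hl b5; rewrite ag4' // lT3 /ball; lia.
  have xF : x \in QF by rewrite (ex_mem esF4) ag4' // lF3; case/andP: b4.
  have [l wl hl] := ex_walk esF4 xF.
  by exists l => //; move: hl b4; rewrite ag4' // lF3 /ball; lia.
have pi6 := pinv_done pi5 ag6 dE6 hcore.
have ag06 : agree large_mods M M6.
  apply: agree_trans (agree_sub _ ag03) _; first by sublist.
  apply: agree_trans (agree_sub _ ag4') _; first by sublist.
  apply: agree_trans (agree_sub _ ag5') _; first by sublist.
  by apply: agree_sub ag6; sublist.
have sub3 : all (fun a => a \notin [:: LAM false; QQ false; QL false; LAM true; QQ true; QL true; VY; NL; VX; VE; I1; N1; LEV false; LEV true]) part_arrays by [].
split=> //.
- by rewrite dE6 fupdE.
- by rewrite ag6 // np5 np4 np3.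
- case.
    exists QT; split; rewrite /qrep ?ag6 // ?ag5' //; [exact: e_q esT4 | exact: ex_mem (e_ex esT4) | exact: ex_lt (e_ex esT4) |].
    by apply: leq_trans (est_size_degsum esT4) _.
  exists QF; split; rewrite /qrep ?ag6 // ?ag5' //; [rewrite !ag4' //; exact: e_q esF3 | exact: ex_mem esF4 | exact: ex_lt esF4 |].
  by apply: leq_trans (est_size_degsum esF3) _.
exists lv5; split=> //.
- apply: (@pend_le_trans _ M3); [by rewrite top3 | exact: pend_le_agree sub3 ag03 |].
  apply: (@pend_le_trans _ M4) => //.
  by apply: (@pend_le_trans _ M5) => //; apply: pend_le_done ag6 dE6.
- move: tp4 tp5 tp6 zsplit; rewrite -(tpot_agree lv sub3 ag03) -/(zsum (part M5 q)); clear; lia.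
- move: sp4 sp5 sp6 zsplit top4 top5 top4' top5'; rewrite (ag6 TOP) // top3 (spot_agree sub3 ag03) YE5; clear; lia.
- set W := D.+1 * (Z + Y + Lm + 3).
  have hW4 : D.+1 * (degsum C + Y + Lm + 3) <= W by rewrite leq_mul2l; apply/orP; right; lia.
  have hW1 : 2 * D * (20 * (degsum C).+1 + 3) + 2 <= 46 * W.
    have h1 : 2 * D * (20 * (degsum C).+1 + 3) <= 2 * D.+1 * (23 * Z) by apply: leq_mul; lia.
    have h2 : D.+1 * Z + 3 <= W.
      have -> : W = D.+1 * Z + D.+1 * (Y + Lm + 3) by rewrite -mulnDr !addnA.
      by rewrite leq_add2l; apply: leq_trans (leq_pmull _ (ltn0Sn D)); lia.
    by apply: leq_trans (_ : 46 * (D.+1 * Z) + 2 <= _); lia.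
  move: sl1 sl2 sl4 sl5.
  move: hW4 hW1; move: (2 * D * _) (D.+1 * (degsum C + _ + _ + _)) (W); clear; lia.
Qed.

End Process.

(** * Amortised time of processing a part *)

Notation process_mods := [:: 5; ST; EN; VOL; DONE; NP; COMP; LL; TOP;
  LAM true; QQ true; QL true; AA true; DG true; BIG true; LEV true;
  LAM false; QQ false; QL false; AA false; DG false; BIG false; LEV false;
  VY; NL; VX; VE; I1; N1; DEL; AC; FND; YY; JJ; CQ; VV].

Section Process_entry.
Variables (B : nat) (g : graph) (w : nat -> nat) (beta D Lm row : nat).
Notation n := (nv g).
Notation mu := (mu g w beta).
Notation vol := (vol g w beta).
Notation round_static := (round_static g w beta D Lm).
Notation dstate := (dstate g w beta D Lm).
Notation est := (est g).
Notation dgs := (dgs g).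
Notation degsum := (degsum g).
Notation pinv := (pinv g w beta D Lm row).
Notation tpot := (tpot g Lm).
Notation zsum := (zsum g).
Hypothesis bd : bounds B g w beta D Lm.

Definition process_bound := explore_bound D Lm + 5000 * D.+1 * Lm.+1.

(** Potential for the running time. What is released in [tpot] pays for the work and for the growth
    of [spot] and [TOP]; [spot] pays for the scanned segment; the last term pays in advance for the
    visits to the entries of [LL]. *)
Definition phi (M : memory) lv := 3 * process_bound * tpot M lv + process_bound * spot M + 10 * M TOP 0.

Lemma wp_cleanup_zero d M (Qs : seq nat) : qrep d Qs M -> (forall x, (x \in Qs) = (0 < M (LAM d) x)) ->
  (forall x, x \in Qs -> x < n) ->
  wp B (cleanup d) M (fun s M' => [/\ s <= 10 * (size Qs).+1, agree [:: LAM d; QL d; I1; VX] M M' &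
    forall z, M' (LAM d) z = 0]).
Proof.
move=> qr QE Qn; have B_gt0 := b_B bd.
apply: wp_conseq (wp_cleanup B_gt0 qr _) _.
  by move=> x /Qn xn; apply: ltn_trans xn (b_n bd).
move=> s M' [sl ag lE]; split=> // z; rewrite lE QE; case: posnP => //.
Qed.

Definition cleanable (M : memory) z := forall d, exists Qs : seq nat, [/\ qrep d Qs M,
  forall x, (x \in Qs) = (0 < M (LAM d) x), forall x, x \in Qs -> x < n & size Qs <= z].

(** Common form of both outcomes: [Z] is the released potential, and [Y] the length of the segment
    that was scanned, which is 0 if a ball has been cut off. *)
Lemma wp_carve_part T0 v V (M : memory) lv q s0 :
  round_static M -> pinv T0 M lv -> M ROW 0 = row -> M CQ 0 = q -> 0 < q < M NP 0 -> M DONE q = 0 ->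
  M VOL q = V -> M VV 0 = V -> V <= vol predT -> v < n -> M COMP v = q ->
  (M NP 0).+2 < 2 ^ B -> M TOP 0 + n + n < 2 ^ B ->
  (exists d r, found g w beta D Lm d (part M q) v V M r s0) \/
  [/\ M FND 0 = 0, s0 <= explore_bound D Lm * (degsum (part M q)).+1 &
        forall d, exists2 r, r <= D & dstate d (part M q) v V M r /\ V < 2 * bvol g w beta (part M q) (M (LAM d)) r] ->
  wp B (If (var FND) small large) M (fun s M' =>
    [/\ agree large_mods M M',
     M' COMP v != q \/ M' DONE q != 0 &
     exists lv' Z Y, [/\ pinv T0 M' lv', pend_le M M',
       [/\ tpot M' lv' + Z <= tpot M lv, spot M' + Y <= spot M + Z, 0 < Z,
           M' TOP 0 <= M TOP 0 + Z & M TOP 0 <= M' TOP 0],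
       cleanable M' Z.+1 &
       M' NP 0 <= (M NP 0).+2 /\
       s0 + s <= (explore_bound D Lm + 100) * Z + 1000 * (D.+1 * (Z + Y + Lm + 3)) + 2]]).
Proof.
move=> rs pi rowE cqE q_lt dq volE vE Vle vn cvE npB topB hf; have B_gt0 := b_B bd.
have npB1 : (M NP 0).+1 < 2 ^ B by apply: ltnW.
have topB1 : M TOP 0 + n < 2 ^ B by apply: leq_ltn_trans topB; rewrite leq_addr.
case: hf => [[d [r fd]]|[f0 sl0 hd]].
  wif; rewrite /= (f_FND fd) /=.
  have main : wp B (carve d (relabel_ball d) (var (AA d))) M (fun s M' =>
    [/\ agree large_mods M M',
     M' COMP v != q \/ M' DONE q != 0 &
     exists lv' Z Y, [/\ pinv T0 M' lv', pend_le M M',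
       [/\ tpot M' lv' + Z <= tpot M lv, spot M' + Y <= spot M + Z, 0 < Z,
           M' TOP 0 <= M TOP 0 + Z & M TOP 0 <= M' TOP 0],
       cleanable M' Z.+1 &
       M' NP 0 <= (M NP 0).+2 /\
       s0 + s.+2 <= (explore_bound D Lm + 100) * Z + 1000 * (D.+1 * (Z + Y + Lm + 3)) + 2]]).
    apply: wp_conseq (wp_small bd rs pi rowE cqE q_lt dq volE Vle vn cvE npB1 topB1 fd) _.
    move=> s M' [ag cv' [lv' [pi' [pl np'] tp [sp [top top']] sl]]].
    have [Qs es] := f_est fd; have ex := e_ex es.
    have Cv : part M q v by apply/eqP.
    have bv : ball (M (LAM d)) r v by rewrite /ball (ex_root ex).
    have XZ := dgs_lt d Cv bv vn.
    set Z := \sum_(x < n | _) _ in tp sp top XZ.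
    split.
    - by apply: agree_sub ag; sublist.
    - by left.
    exists lv', Z, 0; split=> //.
    - by rewrite addn0; split=> //; apply: leq_trans XZ.
    - have [r' [rc' [Qs' es']]] := f_est' fd.
      have QLd d' : M (QL d') 0 <= Z.+1.
        by apply: leq_trans (f_QL fd d') _; apply: leq_trans XZ _.
      have main d' r2 rc2 Q2 : est d' (part M q) v M r2 rc2 Q2 -> exists Qs : seq nat, [/\ qrep d' Qs M',
          forall x, (x \in Qs) = (0 < M' (LAM d') x), forall x, x \in Qs -> x < n & size Qs <= Z.+1].
        case=> qr2 ex2 _ _ _; exists Q2; rewrite /qrep !ag; try neqarr.
        split; [exact: qr2 | exact: ex_mem ex2 | exact: ex_lt ex2 |].
        by have [<- _] := qr2.
      move=> d'; case: (eqVneq d' d) => [->|d'd]; first exact: main es.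
      have -> : d' = ~~ d by case: (d') (d) d'd => [] [].
      exact: main es'.
    - split; first by rewrite np'.
      have h1 := f_s fd; apply: leq_trans (_ : (explore_bound D Lm + 100) * Z + 2 <= _); last first.
        by rewrite leq_add2r leq_addr.
      have h2 : explore_bound D Lm * (dgs d (ball (M (LAM d)) r)).+1 <= explore_bound D Lm * Z by rewrite leq_mul2l XZ orbT.
      clear -h1 h2 sl XZ; lia.
  wif; rewrite condE /= (f_FND fd); move: main; case: (d) => /= main.
    by apply: wp_conseq main _ => s M' hs.
  by apply: wp_conseq main _ => s M' hs.
wif; rewrite /= f0 /=.
have YE : M EN q - M ST q = M EN q - M ST q by [].
apply: wp_conseq (wp_large bd rs pi rowE cqE q_lt dq volE vE Vle YE npB topB vn cvE hd) _.
move=> s M' [ag dn np' cl [lv' [pi' pl tp [sp [top top']] sl]]].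
set C := part M q in sl0 cl tp sp top sl.
have Cv : C v by apply/eqP.
have dCZ : (degsum C).+1 <= zsum C.
  rewrite /zsum /degsum (bigD1 (Ordinal vn)) //= [X in _ <= X](bigD1 (Ordinal vn)) //= addSn ltnS; apply: leq_add => //.
  by apply: leq_sum.
split=> //; first by right.
exists lv', (zsum C), (M EN q - M ST q); split=> //.
- by split=> //; apply: leq_trans dCZ.
- move=> d; have [Qs [h1 h2 h3 h4]] := cl d; exists Qs; split=> //.
  by apply: leq_trans h4 _.
- split; first by rewrite np'.
  have h1 : explore_bound D Lm * (degsum C).+1 <= explore_bound D Lm * zsum C by rewrite leq_mul2l dCZ orbT.
  clear -sl0 sl h1 dCZ; move: (D.+1 * _) sl => a1 sl; lia.
Qed.

(** A call creates at most two parts and appends at most [Z] entries to [LL], while [tpot] drops by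
    at least [Z > 0]. Hence [NP + 2 * tpot] and [TOP + tpot] never increase, which keeps part
    numbers and positions within the word size. *)
Lemma wp_process T0 v (M : memory) lv q :
  round_static M -> pinv T0 M lv -> M ROW 0 = row -> M CX 0 = v -> M COMP v = q -> q != 0 -> M DONE q = 0 ->
  (M NP 0).+2 < 2 ^ B -> M TOP 0 + n + n < 2 ^ B -> (forall d z, M (LAM d) z = 0) ->
  wp B process M (fun s M' =>
    [/\ agree process_mods M M', M' COMP v != q \/ M' DONE q != 0, (forall d z, M' (LAM d) z = 0) &
     exists lv', [/\ pinv T0 M' lv', pend_le M M', phi M' lv' + s <= phi M lv,
        M' NP 0 + 2 * tpot M' lv' <= M NP 0 + 2 * tpot M lv &
        M' TOP 0 + tpot M' lv' <= M TOP 0 + tpot M lv /\ M TOP 0 <= M' TOP 0]]).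
Proof.
move=> rs pi rowE cx cvE q0 dq npB topB lam0; have B_gt0 := b_B bd.
have [lt e] := p_comp pi v; have /andP[vn mv] : (v < n) && (0 < mu v) by rewrite -e cvE.
have q_lt : 0 < q < M NP 0 by rewrite lt0n q0 -cvE lt.
set V := M VOL q; set C := part M q.
have Cv : C v by apply/eqP.
have [vol1 vol2] := p_vol pi q_lt.
have Vle : V <= vol predT by apply: leq_trans vol2; rewrite leq_pmulr // expn_gt0.
apply: wp_seq; wset => /=; first by move=> bM; apply: bM.
rewrite cx cvE; apply: wp_seq; wset => /=; upds; first by move=> bM; have := bM VOL q; upds.
apply: wp_seq; wset => /=; first by rewrite expn_gt0.
set M1 := update _ _ _ _.
have ag1 : agree [:: CQ; VV; FND] M M1 by agr.
have cq1 : M1 CQ 0 = q by rewrite /M1; upds.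
have vv1 : M1 VV 0 = V by rewrite /M1; upds.
have fnd1 : M1 FND 0 = 0 by rewrite /M1; upds.
have CE1 : C = (fun z => M1 COMP z == M1 CQ 0) by rewrite cq1 ag1.
have rs1 : round_static M1 by apply: round_static_agree ag1 rs.
have cx1 : M1 CX 0 = v by rewrite ag1.
apply: wp_seq; apply: wp_conseq (wp_start bd (d := false) rs1 cx1 vn CE1 Cv _ vv1) _.
  by move=> z; rewrite ag1.
move=> s2 M2 [sl2 ag2 ds2].
have rs2 : round_static M2 by apply: round_static_agree ag2 rs1.
have e2 a : a \notin [:: LAM false; QQ false; QL false; LEV false; AA false; DG false; BIG false; I1; VX] -> M2 a = M1 a by apply: ag2.
have CE2 : C = (fun z => M2 COMP z == M2 CQ 0) by rewrite CE1 !e2.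
apply: wp_seq; apply: wp_conseq (wp_start bd (d := true) (M := M2) (v := v) (V := V) rs2 _ vn CE2 Cv _ _) _.
- by rewrite e2.
- by move=> z; rewrite e2 // ag1.
- by rewrite e2.
move=> s3 M3 [sl3 ag3 ds3].
have e3 a : a \notin [:: LAM true; QQ true; QL true; LEV true; AA true; DG true; BIG true; I1; VX] -> M3 a = M2 a by apply: ag3.
have rs3 : round_static M3 by apply: round_static_agree ag3 rs2.
have CE3 : C = (fun z => M3 COMP z == M3 CQ 0) by rewrite CE2 !e3.
have ds3' d : dstate d C v V M3 0.
  by case: d; [exact: ds3 | apply: dstate_agree ag3 ds2].
have vv3 : M3 VV 0 = V by rewrite e3 // e2.
have fnd3 : M3 FND 0 = 0 by rewrite e3 // e2.
have ql3 d : M3 (QL d) 0 = 1.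
  have [Qs [[qlE _] ex _ sq _]] := d_est (ds3' d).
  have sz := sq; rewrite /small_queue big1 in sz; last by move=> x /andP[h1 h2]; lia.
  rewrite qlE; apply/eqP; rewrite eqn_leq sz /=; have : v \in Qs by rewrite (ex_mem ex) (ex_root ex).
  by case: (Qs).
apply: wp_seq; apply: wp_conseq (wp_explore bd rs3 CE3 vv3 Vle mv Cv vn ds3' fnd3 ql3) _.
move=> s4 M4 [ag4 alt].
have ag04 : agree [:: LAM true; QQ true; QL true; AA true; DG true; BIG true; LEV true;
  LAM false; QQ false; QL false; AA false; DG false; BIG false; LEV false;
  VY; NL; VX; VE; I1; N1; DEL; FND; YY; JJ; CQ; VV] M M4.
  apply: agree_trans (agree_sub _ ag1) _; first by sublist.
  apply: agree_trans (agree_sub _ ag2) _; first by sublist.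
  apply: agree_trans (agree_sub _ ag3) _; first by sublist.
  by apply: agree_sub ag4; sublist.
have sub4 : all (fun a => a \notin [:: LAM true; QQ true; QL true; AA true; DG true; BIG true; LEV true;
  LAM false; QQ false; QL false; AA false; DG false; BIG false; LEV false;
  VY; NL; VX; VE; I1; N1; DEL; FND; YY; JJ; CQ; VV]) part_arrays by [].
have rs4 : round_static M4 by apply: round_static_agree ag04 rs.
have pi4 : pinv T0 M4 lv by apply: pinv_agree sub4 ag04 pi.
have pE4 : part M4 q = C by rewrite /C /part ag04.
have cq4 : M4 CQ 0 = q by rewrite ag4 // e3 // e2.
have vv4 : M4 VV 0 = V by rewrite ag4 // e3 // e2.
rewrite -pE4 in alt.
apply: wp_seq; apply: wp_conseq (wp_carve_part (T0 := T0) (v := v) (V := V) (lv := lv) (q := q) rs4 pi4 _ cq4 _ _ _ vv4 Vle vn _ _ _ alt) _;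
  try by rewrite ag04.
move=> s5 M5 [ag5 rsl [lv' [Z [Y [pi5 pl5 [tp5 sp5 Z0 top5 top5'] cl5 [np5 sl5]]]]]].
have [QF [qF1 qF2 qF3 qF4]] := cl5 false.
apply: wp_seq; apply: wp_conseq (wp_cleanup_zero qF1 qF2 qF3) _ => s6 M6 [sl6 ag6 l6].
have [QT [qT1 qT2 qT3 qT4]] := cl5 true.
apply: wp_conseq (wp_cleanup_zero (d := true) (M := M6) (Qs := QT) _ _ qT3) _.
- by rewrite /qrep !ag6.
- by move=> x; rewrite ag6.
move=> s7 M7 [sl7 ag7 l7].
have ag57 : agree [:: LAM false; QL false; LAM true; QL true; I1; VX] M5 M7.
  apply: agree_trans (agree_sub _ ag6) _; first by sublist.
  by apply: agree_sub ag7; sublist.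
have sub7 : all (fun a => a \notin [:: LAM false; QL false; LAM true; QL true; I1; VX]) part_arrays by [].
split.
- apply: agree_trans (agree_sub _ ag04) _; first by sublist.
  apply: agree_trans (agree_sub _ ag5) _; first by sublist.
  by apply: agree_sub ag57; sublist.
- by rewrite !ag57.
- by case=> z; [exact: l7 | rewrite ag7].
exists lv'; split.
- exact: pinv_agree sub7 ag57 pi5.
- apply: (@pend_le_trans _ M4); [by rewrite ag04 | exact: pend_le_agree sub4 ag04 |].
  by apply: (@pend_le_trans _ M5) => //; apply: pend_le_agree sub7 ag57.
- rewrite /phi (tpot_agree g Lm lv' sub7 ag57) (spot_agree sub7 ag57) (ag57 TOP) //.
  rewrite (tpot_agree g Lm lv sub4 ag04) in tp5; rewrite (spot_agree sub4 ag04) in sp5; rewrite (ag04 TOP) // in top5.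
  have k6 : process_bound * (tpot M5 lv' + Z) <= process_bound * tpot M lv by rewrite leq_mul2l tp5 orbT.
  have k6' : process_bound * (spot M5 + Y) <= process_bound * (spot M + Z) by rewrite leq_mul2l sp5 orbT.
  (* The work of the call together with the prepayment for at most [Z] new entries of [LL]. *)
  have hs : 3 + s2 + s3 + (s4 + s5) + s6 + s7 + 10 * Z <= process_bound * (Z + Y).
    pose Q := Lm.+1 * (Z + Y); pose R := D.+1 * Q.
    have q1 : Z + Y <= Q by apply: leq_pmull.
    have q2 : Lm.+1 <= Q by apply: leq_pmulr; lia.
    have r1 : Q <= R by apply: leq_pmull.
    have r2 : D.+1 * (Z + Y + Lm + 3) <= D.+1 * (4 * Q) by rewrite leq_mul2l /=; lia.
    have -> : process_bound * (Z + Y) = explore_bound D Lm * Z + explore_bound D Lm * Y + 5000 * R.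
      by rewrite /process_bound /R /Q mulnDl mulnDr -!mulnA.
    move: r2; rewrite (mulnCA D.+1) -/R => r2.
    clear -q1 q2 r1 r2 sl2 sl3 sl5 sl6 sl7 qF4 qT4 Z0.
    move: (D.+1 * _) r2 sl5 (size QF) (size QT) qF4 qT4 sl6 sl7 => P r2 sl5 zF zT; lia.
  clear -k6 k6' hs top5; rewrite -!(mulnA 3 process_bound); lia.
- rewrite (tpot_agree g Lm lv' sub7 ag57) (ag57 NP) //; rewrite (tpot_agree g Lm lv sub4 ag04) in tp5.
  rewrite (ag04 NP) // in np5; move: np5 tp5 Z0; clear; lia.
rewrite (tpot_agree g Lm lv' sub7 ag57) (ag57 TOP) //; rewrite (tpot_agree g Lm lv sub4 ag04) in tp5.
rewrite (ag04 TOP) // in top5 top5'; move: top5 top5' tp5 Z0; clear; lia.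
Qed.

End Process_entry.

(** * Decomposing the graph once *)

Definition comp_of_entry := Get COMP (var CX).

(** An entry is stale if its position lies outside the segment of the part to which its vertex
    belongs now. *)
Definition entry_active : expr :=
  andE comp_of_entry (andE (eqE (Get DONE comp_of_entry) (Cst 0))
    (andE (leE (Get ST comp_of_entry) (var CI)) (ltE (var CI) (Get EN comp_of_entry)))).

Definition decompose : cmd :=
  Seq (Set_ CI (Cst 0))
    (While (ltE (var CI) (var TOP))
      (Seq (Set_ CX (Get LL (var CI)))
        (Seq (If entry_active process Skip) (Set_ CI (succ_ (var CI)))))).

Notation decompose_mods := [:: 5; ST; EN; VOL; DONE; NP; COMP; LL; TOP;
  LAM true; QQ true; QL true; AA true; DG true; BIG true; LEV true;
  LAM false; QQ false; QL false; AA false; DG false; BIG false; LEV false;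
  VY; NL; VX; VE; I1; N1; DEL; AC; FND; YY; JJ; CQ; VV; CI; CX].

Section Decompose.
Variables (B : nat) (g : graph) (w : nat -> nat) (beta D Lm row : nat).
Notation n := (nv g).
Notation round_static := (round_static g w beta D Lm).
Notation pinv := (pinv g w beta D Lm row).
Notation tpot := (tpot g Lm).
Notation phi := (phi g D Lm).
Hypothesis bd : bounds B g w beta D Lm.

(** [LL] is a work list that grows while it is traversed; [TOP + tpot - i] is a variant. Beyond the
    last position nothing is pending, so no vertex is live and every part is a core. *)
Lemma wp_decompose T0 (M : memory) lv :
  round_static M -> pinv T0 M lv -> M ROW 0 = row -> (forall d z, M (LAM d) z = 0) ->
  (forall x, live M x -> pending M 0 x) ->
  M NP 0 + 2 * tpot M lv + 2 < 2 ^ B -> M TOP 0 + tpot M lv + n + n < 2 ^ B ->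
  wp B decompose M (fun s M' =>
    [/\ agree decompose_mods M M', (forall d z, M' (LAM d) z = 0), s <= phi M lv + 2 &
     exists2 lv', pinv T0 M' lv' & forall x, M' COMP x != 0 -> M' DONE (M' COMP x) != 0]).
Proof.
move=> rs pi rowE lam0 pend npB topB; have B_gt0 := b_B bd.
apply: wp_seq; wset => /=; first by rewrite expn_gt0.
set M0 := update _ _ _ _.
have ag0 : agree [:: CI] M M0 by apply: agree_update; rewrite ?inE ?eqxx.
pose I k s (M' : memory) := [/\ agree decompose_mods M M', (forall d z, M' (LAM d) z = 0) &
  exists lv' i, [/\ pinv T0 M' lv', M' CI 0 = i /\ i <= M' TOP 0, (forall x, live M' x -> pending M' i x),
    k = M' TOP 0 + tpot M' lv' - i /\ phi M' lv' + s <= phi M lv + 10 * i &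
    M' NP 0 + 2 * tpot M' lv' <= M NP 0 + 2 * tpot M lv /\ M' TOP 0 + tpot M' lv' <= M TOP 0 + tpot M lv]].
apply: (wp_while B_gt0 (I := I) (k0 := M TOP 0 + tpot M lv)).
- have sub0 : all (fun a => a \notin [:: CI]) part_arrays by [].
  split.
  + by apply: agree_sub ag0; sublist.
  + by move=> d z; rewrite ag0 ?lam0 //; neqarr.
  exists lv, 0; rewrite /phi (tpot_agree g Lm lv sub0 ag0) (spot_agree sub0 ag0) (ag0 TOP) // (ag0 NP) //; split.
  + exact: pinv_agree sub0 ag0 pi.
  + by split; rewrite /M0; upds.
  + by move=> x; rewrite /live /pending !ag0 //; apply: pend.
  + by rewrite subn0 muln0 !addn0.
  + by [].
- move=> k s M1 [ag lam1 [lv1 [i [pi1 [iE iT] pend1 [kE sE] [np1 top1]]]]].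
  rewrite condE /= iE => iT'.
  have rs1 : round_static M1 by apply: round_static_agree ag rs.
  apply: wp_seq; wset => /=; first by move=> bM; apply: bM.
  rewrite iE; set x := M1 LL i.
  set M2 := update _ _ _ _.
  have ag2 : agree [:: CX] M1 M2 by apply: agree_update; rewrite ?inE ?eqxx.
  have sub2 : all (fun a => a \notin [:: CX]) part_arrays by [].
  have e2 a : a \notin [:: CX] -> M2 a = M1 a by apply: ag2.
  have cx2 : M2 CX 0 = x by rewrite /M2; upds.
  have pi2 : pinv T0 M2 lv1 by apply: pinv_agree sub2 ag2 pi1.
  have rs2 : round_static M2 by apply: round_static_agree ag2 rs1.
  have ag02 : agree decompose_mods M M2.
    by apply: agree_trans ag _; apply: agree_sub ag2; sublist.
  have tp2 := tpot_agree g Lm lv1 sub2 ag2.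
  have iB : i.+1 < 2 ^ B by lia.
  apply: wp_seq; wif; rewrite /entry_active !andEv !condE.
  have -> : expr_val M2 comp_of_entry = M1 COMP x by rewrite /= cx2 e2.
  have -> : expr_val M2 (Get DONE comp_of_entry) = M1 DONE (M1 COMP x) by rewrite /= cx2 !e2.
  have -> : expr_val M2 (Get ST comp_of_entry) = M1 ST (M1 COMP x) by rewrite /= cx2 !e2.
  have -> : expr_val M2 (Get EN comp_of_entry) = M1 EN (M1 COMP x) by rewrite /= cx2 !e2.
  rewrite /= (e2 CI) // iE; case: ifP => act; last first.
    wskip; wset => /=; rewrite (e2 CI) // iE addn1 //.
    set M3 := update _ _ _ _.
    have ag3 : agree [:: CI] M2 M3 by apply: agree_update; rewrite ?inE ?eqxx.
    have ag13 : agree [:: CI; CX] M1 M3.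
      by apply: agree_trans (agree_sub _ ag2) (agree_sub _ ag3); sublist.
    have sub3 : all (fun a => a \notin [:: CI; CX]) part_arrays by [].
    have tp3 := tpot_agree g Lm lv1 sub3 ag13.
    exists (k.-1); first by lia.
    split.
    + by apply: agree_trans ag02 _; apply: agree_sub ag3; sublist.
    + by move=> d z; rewrite ag13 ?lam1 //; neqarr.
    exists lv1, i.+1; rewrite /phi tp3 (spot_agree sub3 ag13) (ag13 TOP) // (ag13 NP) //; split.
    + exact: pinv_agree sub3 ag13 pi1.
    + by split; [rewrite /M3; upds; lia | lia].
    + move=> y; rewrite /live /pending !ag13 // => ly; have [j [ij sj lj]] := pend1 y ly.
      exists j; split=> //; move: ij; rewrite leq_eqVlt => /orP[/eqP ji|//].
      move: act; rewrite /x ji lj; by case/andP: ly => -> -> /=; rewrite sj.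
    + by split; [rewrite kE; lia | rewrite /phi in sE; lia].
    + by [].
  have /and4P[c0 d0 st0 en0] := act.
  have lam2 d z : M2 (LAM d) z = 0 by rewrite e2 ?lam1 //; neqarr.
  have npB2 : (M2 NP 0).+2 < 2 ^ B by rewrite e2 //; lia.
  have topB2 : M2 TOP 0 + n + n < 2 ^ B by rewrite e2 //; lia.
  have row2 : M2 ROW 0 = row by rewrite ag02.
  have c2 : M2 COMP x = M1 COMP x by rewrite e2.
  have d2 : M2 DONE (M1 COMP x) = 0 by rewrite e2 //; apply/eqP.
  apply: wp_conseq (wp_process bd rs2 pi2 row2 cx2 c2 c0 d2 npB2 topB2 lam2) _.
  move=> s3 M3 [ag3 res lam3 [lv3 [pi3 pl3 ph3 np3 [top3 top3']]]].
  have ci3 : M3 CI 0 = i by rewrite ag3 // e2.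
  wset => /=; rewrite ci3 addn1 //; set M4 := update _ _ _ _.
  have ag4 : agree [:: CI] M3 M4 by apply: agree_update; rewrite ?inE ?eqxx.
  have sub4 : all (fun a => a \notin [:: CI]) part_arrays by [].
  have tp4 := tpot_agree g Lm lv3 sub4 ag4.
  rewrite tp2 (e2 NP) // in np3; rewrite tp2 (e2 TOP) // in top3; rewrite (e2 TOP) // in top3'.
  exists (M3 TOP 0 + tpot M3 lv3 - i.+1); first by lia.
  split.
  + apply: agree_trans ag02 _; apply: agree_trans (agree_sub _ ag3) _; first by sublist.
    by apply: agree_sub ag4; sublist.
  + by move=> d z; rewrite ag4 ?lam3 //; neqarr.
  exists lv3, i.+1; rewrite tp4 /phi tp4 (spot_agree sub4 ag4) (ag4 TOP) // (ag4 NP) //; split.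
  + exact: pinv_agree sub4 ag4 pi3.
  + by split; [rewrite /M4; upds; lia | lia].
  + move=> y; rewrite /live /pending !ag4 // => ly.
    have [hp|[ly2 cy hp]] := pl3 y ly; first by apply: hp; rewrite e2.
    have ly1 : live M1 y by move: ly2; rewrite /live !e2.
    have [j [ij sj lj]] := pend1 y ly1.
    have pj : pending M3 j y by apply: hp; exists j; rewrite !e2.
    move: ij; rewrite leq_eqVlt => /orP[/eqP ji|ij]; last first.
      by case: pj => j' [h1 h2 h3]; exists j'; split=> //; apply: leq_trans h1.
    (* The entry just processed: its vertex has left the part, or the part has become a core, so it
       cannot be live and unmoved. *)
    have xy : x = y by rewrite /x ji.
    have c31 : M3 COMP y = M1 COMP y by rewrite cy e2.
    case: res; rewrite xy => hr; first by rewrite c31 eqxx in hr.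
    by case/andP: ly => _; rewrite c31 (negbTE hr).
  + split; first by [].
    move: ph3; rewrite /phi tp2 (spot_agree sub2 ag2) (e2 TOP) // => ph3.
    move: sE; rewrite /phi; move: ph3; clear; lia.
  + by split; lia.
- move=> k s M1 [ag lam1 [lv1 [i [pi1 [iE iT] pend1 [kE sE] _]]]] /=; rewrite iE => /eqP; rewrite subn_eq0 => Ti.
  have iTE : i = M1 TOP 0 by lia.
  split=> //; first by move: sE; rewrite {1}/phi iTE; lia.
  exists lv1 => // x cx; apply/negP => dx.
  have lx : live M1 x by rewrite /live cx dx.
  have [j [ij /andP[_ jE] _]] := pend1 x lx.
  have [|Ls [_ s2 _ _ _]] := p_seg pi1 (q := M1 COMP x).
    by have [lt _] := p_comp pi1 x; rewrite lt lt0n cx.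
  by move: (leq_trans jE s2) ij; rewrite iTE => h1 h2; move: (leq_ltn_trans h2 h1); rewrite ltnn.
Qed.

End Decompose.

(** * Rounds of the multiplicative weights method *)

Notation NE := 60.
Notation N0 := 62.
Notation WS := 63.
Notation BET := 64.
Notation TB := 65.
Notation L0A := 66.

Definition reset_vertices : cmd :=
  For I1 N0 (Seq (Set_ VX (Get L0A (var I1))) (Seq (Put COMP (var VX) (Cst 1))
    (Seq (Put MU (var VX) (Cst 0)) (Put LL (var I1) (var VX))))).

Definition weighted_length := Bin Mul (Get WT (var I1)) (Get LEN (var I1)).

Definition sum_lengths : cmd :=
  Seq (Set_ WS (Cst 0)) (For I1 NE (Set_ WS (Bin Add (var WS) weighted_length))).

Definition set_mu : cmd :=
  Seq (Put VOL (Cst 1) (Cst 0))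
    (For I1 NE (Seq (Set_ YY (Bin Add (Bin Mul (Cst 4) weighted_length) (var BET)))
      (Seq (Put MU (Get 1 (var I1)) (Bin Add (Get MU (Get 1 (var I1))) (var YY)))
        (Seq (Put MU (Get 2 (var I1)) (Bin Add (Get MU (Get 2 (var I1))) (var YY)))
          (Put VOL (Cst 1) (Bin Add (Get VOL (Cst 1)) (Bin Mul (Cst 2) (var YY)))))))).

(** [RM] is the number of cuts modulo the length; the weight doubles whenever this remainder wraps
    around to 0. *)
Definition reweight : cmd :=
  For I1 NE (If (Get 5 (Bin Add (var ROW) (var I1)))
    (If (eqE (succ_ (Get RM (var I1))) (Get LEN (var I1)))
      (Seq (Put RM (var I1) (Cst 0)) (Put WT (var I1) (Bin Mul (Cst 2) (Get WT (var I1)))))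
      (Put RM (var I1) (succ_ (Get RM (var I1)))))
    Skip).

Lemma divmod_succ c l : 0 < l -> if (c %% l).+1 == l then c.+1 %/ l = (c %/ l).+1 /\ c.+1 %% l = 0
  else c.+1 %/ l = c %/ l /\ c.+1 %% l = (c %% l).+1.
Proof.
move=> l0; have lt := ltn_pmod c l0; have e := divn_eq c l.
case: eqP => h.
  have -> : c.+1 = (c %/ l).+1 * l by rewrite mulSn; lia.
  by rewrite mulnK // modnMl.
have lt2 : (c %% l).+1 < l by lia.
have -> : c.+1 = c %/ l * l + (c %% l).+1 by rewrite addnS -e.
by split; [rewrite divnMDl // (divn_small lt2) addn0 | rewrite modnMDl modn_small].
Qed.

Section Setup.
Variables (B : nat) (g : graph).
Hypothesis B_gt0 : 0 < B.
Notation n := (nv g).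
Notation m := (ne g).

Lemma wp_reset_vertices (M : memory) (L0 : seq nat) :
  M N0 0 = size L0 -> (forall i, i < size L0 -> M L0A i = nth 0 L0 i) ->
  wp B reset_vertices M (fun s M' => [/\ s <= 6 * size L0 + 2, agree [:: COMP; MU; LL; I1; VX] M M',
    forall z, M' COMP z = (if z \in L0 then 1 else M COMP z), forall z, M' MU z = (if z \in L0 then 0 else M MU z) &
    forall i, i < size L0 -> M' LL i = nth 0 L0 i]).
Proof.
move=> n0 la.
apply: (wp_for B_gt0 (J := fun i M1 => [/\ agree [:: COMP; MU; LL; I1; VX] M M1,
    forall z, M1 COMP z = (if z \in take i L0 then 1 else M COMP z), forall z, M1 MU z = (if z \in take i L0 then 0 else M MU z) &
    forall j, j < i -> M1 LL j = nth 0 L0 j]) (f := fun=> 4) (N := size L0)) => //.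
- by split=> // z; rewrite take0.
- move=> k M1 p [ag h1 h2 h3]; split=> *; upds; auto.
  by apply: agree_update => //; rewrite !inE ?eqxx ?orbT.
- move=> k M1 kL [ag h1 h2 h3] i1.
  have B2 : 1 < 2 ^ B by case: (B) B_gt0 => // b _; rewrite expnS; have := expn_gt0 2 b; lia.
  apply: wp_seq; wset => /=; first by move=> bM; apply: bM.
  rewrite i1 (ag L0A) // la //; set x := nth 0 L0 k.
  apply: wp_seq; wput => /=; upds => //.
  apply: wp_seq; wput => /=; upds; first by rewrite expn_gt0.
  wput => /=; upds; first by move=> bM; have := bM VX 0; upds.
  rewrite i1; split=> //; upds => //.
    by rewrite ag.
  split.
  + by do !(apply: agree_update; first by rewrite !inE ?eqxx ?orbT).
  + move=> z; upds; rewrite /fupd h1 (take_nth 0 kL) mem_rcons inE -/x.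
    by case: (z == x).
  + move=> z; upds; rewrite /fupd h2 (take_nth 0 kL) mem_rcons inE -/x.
    by case: (z == x).
  + move=> j; rewrite ltnS => jk; upds; rewrite /fupd; case: eqP => [->//|jN].
    by apply: h3; lia.
move=> s M1 sl [ag h1 h2 h3]; split=> //.
- by apply: leq_trans sl _; rewrite sum_nat_const card_ord; lia.
- by move=> z; rewrite h1 take_size.
- by move=> z; rewrite h2 take_size.
Qed.

Variable w : nat -> nat.

Lemma wp_sum_lengths (M : memory) : static g M -> M NE 0 = m -> (forall e, e < m -> M WT e = w e) ->
  \sum_(e < m) w e * elen g e < 2 ^ B ->
  wp B sum_lengths M (fun s M' => [/\ s <= 3 * m + 3, agree [:: WS; I1] M M' &
    M' WS 0 = \sum_(e < m) w e * elen g e]).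
Proof.
move=> st nE wE sB; apply: wp_seq; wset => /=; first by rewrite expn_gt0.
have part k : k <= m -> \sum_(e < k) w e * elen g e <= \sum_(e < m) w e * elen g e.
  by move=> km; rewrite (big_ord_widen m (fun e => w e * elen g e) km) big_mkcond; apply: leq_sum => e _; case: ifP.
apply: (wp_for B_gt0 (J := fun i M1 => agree [:: WS; I1] M M1 /\ M1 WS 0 = \sum_(e < i) w e * elen g e)
  (f := fun=> 1) (N := m)) => //.
- by split; [agr | upds; rewrite big_ord0].
- move=> k M1 p [ag h1]; split; [|by upds].
  by apply: agree_update => //; rewrite !inE ?eqxx ?orbT.
- move=> k M1 km [ag h1] i1.
  wset => /=; rewrite i1 h1 (ag WT) // wE // (ag LEN) // (st_len st) //.
    move=> _; apply: leq_ltn_trans sB; apply: leq_trans (part k.+1 km).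
    by rewrite big_ord_recr.
  split=> //; upds => //; first by rewrite ag.
  split; first by apply: agree_update => //; rewrite !inE ?eqxx ?orbT.
  by upds; rewrite big_ord_recr.
move=> s M1 sl [ag h1]; split=> //.
by move: sl; rewrite sum_nat_const card_ord; clear; lia.
Qed.

Variable beta : nat.
Notation mu := (mu g w beta).
Notation vol := (vol g w beta).

Lemma vol_predT : vol predT = \sum_(e < m) 2 * (4 * w e * elen g e + beta).
Proof.
rewrite /vol /mu /wmu big_split /=.
have h d : \sum_(x < n) \sum_(e < m | src g d e == x) (4 * w e * elen g e + beta) = \sum_(e < m) (4 * w e * elen g e + beta).
  by rewrite -(sum_src g d predT (fun e => 4 * w e * elen g e + beta)).
by rewrite !h -big_split /=; apply: eq_bigr => e _; rewrite mul2n addnn.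
Qed.

Lemma wp_set_mu (M : memory) : static g M -> M NE 0 = m -> (forall e, e < m -> M WT e = w e) ->
  M BET 0 = beta -> (forall x, M MU x = 0) ->
  vol predT < 2 ^ B ->
  wp B set_mu M (fun s M' => [/\ s <= 6 * m + 3, agree [:: MU; VOL; YY; I1] M M',
    forall x, M' MU x = mu x & M' VOL 1 = vol predT]).
Proof.
move=> st nE wE bE mu0 vB.
pose zc e := 4 * w e * elen g e + beta.
pose mk d k x := \sum_(e < k | src g d e == x) zc e.
have mkS d k x : mk d k.+1 x = mk d k x + (if src g d k == x then zc k else 0).
  by rewrite /mk big_mkcond big_ord_recr /= -big_mkcond.
pose vk k := \sum_(e < k) 2 * zc e.
have mkv k x : mk false k x + mk true k x <= vk k.
  rewrite /vk /mk [X in X + _ <= _]big_mkcond [X in _ + X <= _]big_mkcond -big_split.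
  by apply: leq_sum => e _ /=; case: ifP => _; case: ifP => _; lia.
have vkm k : k <= m -> vk k <= vol predT.
  move=> km; rewrite vol_predT /vk (big_ord_widen m (fun e => 2 * zc e) km) big_mkcond.
  by apply: leq_sum => e _; case: ifP.
have vkS k : vk k.+1 = vk k + 2 * zc k by rewrite /vk big_ord_recr.
apply: wp_seq; wput => /=; first by rewrite expn_gt0.
apply: (wp_for B_gt0 (J := fun i M1 => [/\ agree [:: MU; VOL; YY; I1] M M1,
   forall x, M1 MU x = mk false i x + mk true i x & M1 VOL 1 = vk i]) (f := fun=> 4) (N := m)) => //.
- split; [agr | by move=> x; upds; rewrite mu0 /mk !big_ord0 | by upds; rewrite /vk big_ord0].
- move=> k M1 p [ag h1 h2]; split; [|by move=> x; upds|by upds].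
  by apply: agree_update => //; rewrite !inE ?eqxx ?orbT.
- move=> k M1 km [ag h1 h2] i1.
  have zB : vk k + 2 * zc k < 2 ^ B.
    by rewrite -vkS; apply: leq_ltn_trans (vkm _ km) vB.
  have e0 : M1 1 k = src g false k by rewrite ag // (st_src st false km).
  have e1 : M1 2 k = src g true k by rewrite ag // (st_src st true km).
  apply: wp_seq; wset => /=; rewrite i1 (ag WT) // wE // (ag LEN) // (st_len st) // (ag BET) // bE mulnA -/(zc k).
    by move=> _; lia.
  apply: wp_seq; wput => /=; upds; rewrite i1 e0 h1.
    by move=> _; have := mkv k (src g false k); lia.
  apply: wp_seq; wput => /=; upds; rewrite i1 e1 /fupd h1.
    by move=> _; have := mkv k (src g true k); case: eqP => [<-|_]; lia.
  wput => /=; upds; rewrite h2.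
    by move=> _; lia.
  split=> //; upds => //; first by rewrite ag.
  split.
  + by do !(apply: agree_update; first by rewrite !inE ?eqxx ?orbT).
  + move=> x; upds; rewrite /fupd !mkS h1 (eq_sym (src g true k)) (eq_sym (src g false k)).
    case: (eqVneq x (src g true k)) => [->|xt]; last first.
      by case: (eqVneq x (src g false k)) => [->|xf]; rewrite ?h1 ?addn0 //; lia.
    case: (eqVneq (src g true k) (src g false k)) => [->|xf]; rewrite ?h1; lia.
  + by upds; rewrite vkS.
move=> s M1 sl [ag h1 h2]; split=> //.
- by move: sl; rewrite sum_nat_const card_ord; clear; lia.
- by rewrite h2 vol_predT.
Qed.

Definition weight (c : nat -> nat) e := 2 ^ (c e %/ elen g e).

Lemma wp_reweight (M : memory) row (c c' : nat -> nat) :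
  static g M -> M NE 0 = m -> M ROW 0 = row -> (forall e, e < m -> M WT e = weight c e) ->
  (forall e, e < m -> M RM e = c e %% elen g e) ->
  (forall e, e < m -> c' e = c e + (M 5 (row + e) != 0)) ->
  (forall e, e < m -> weight c' e < 2 ^ B) -> (forall e, e < m -> elen g e < 2 ^ B) ->
  wp B reweight M (fun s M' => [/\ s <= 6 * m + 2, agree [:: WT; RM; I1] M M',
    forall e, e < m -> M' WT e = weight c' e & forall e, e < m -> M' RM e = c' e %% elen g e]).
Proof.
move=> st nE rowE wE rE c'E wB lB.
apply: (wp_for B_gt0 (J := fun i M1 => [/\ agree [:: WT; RM; I1] M M1,
   forall e, e < m -> M1 WT e = weight (if e < i then c' else c) e &
   forall e, e < m -> M1 RM e = (if e < i then c' else c) e %% elen g e]) (f := fun=> 4) (N := m)) => //.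
- move=> k M1 p [ag h1 h2]; split; [|by move=> e em; upds; apply: h1|by move=> e em; upds; apply: h2].
  by apply: agree_update => //; rewrite !inE ?eqxx ?orbT.
- move=> k M1 km [ag h1 h2] i1.
  have l0 := elen_gt0 km.
  have wk : M1 WT k = weight c k by rewrite h1 // ltnn.
  have rk : M1 RM k = c k %% elen g k by rewrite h2 // ltnn.
  have lk : M1 LEN k = elen g k by rewrite ag // (st_len st).
  have out e : e != k -> (if e < k.+1 then c' else c) = (if e < k then c' else c).
    by move=> ek; rewrite ltnS leq_eqVlt (negbTE ek).
  wif; rewrite /= i1 (ag ROW) // rowE (ag 5) //; case: ifP => hc; last first.
    wskip; split=> //; first by rewrite ag.
    have ck : c' k = c k by rewrite c'E // hc addn0.
    split=> // e em; case: (eqVneq e k) => [->|ek]; try (by rewrite out ?h1 ?h2).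
      by rewrite wk ltnSn /weight ck.
    by rewrite rk ltnSn ck.
  have ck : c' k = (c k).+1 by rewrite c'E // hc addn1.
  have hdm := divmod_succ (c k) l0; rewrite -ck in hdm.
  wif; rewrite condE /= i1 rk lk addn1; move: hdm; case: ifP => _ [hq hr].
    apply: wp_seq; wput => /=; first by rewrite expn_gt0.
    have w2 : 2 * weight c k = weight c' k by rewrite /weight hq expnS.
    wput => /=; upds; rewrite i1 wk w2; first by move=> _; apply: wB.
    split=> //; upds => //; first by rewrite ag.
    split.
    + by do !(apply: agree_update; first by rewrite !inE ?eqxx ?orbT).
    + move=> e em; upds; rewrite /fupd; case: (eqVneq e k) => [->|ek]; first by rewrite ltnSn.
      by rewrite out // h1.
    + move=> e em; upds; rewrite /fupd; case: (eqVneq e k) => [->|ek]; first by rewrite ltnSn hr.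
      by rewrite out // h2.
  wput => /=; rewrite i1 rk addn1.
    by move=> _; apply: leq_ltn_trans (lB _ km); apply: ltn_pmod.
  split=> //; upds => //; first by rewrite ag.
  split.
  + by do !(apply: agree_update; first by rewrite !inE ?eqxx ?orbT).
  + move=> e em; upds; case: (eqVneq e k) => [->|ek]; first by rewrite ltnSn wk /weight hq.
    by rewrite out // h1.
  + move=> e em; upds; rewrite /fupd; case: (eqVneq e k) => [->|ek]; first by rewrite ltnSn hr.
    by rewrite out // h2.
move=> s M1 sl [ag h1 h2]; split=> //.
- by move: sl; rewrite sum_nat_const card_ord; clear; lia.
- by move=> e em; rewrite h1 // em.
- by move=> e em; rewrite h2 // em.
Qed.

End Setup.

(** All vertices with edges form part 1. [BET] exceeds the average of weight times length, so that
    every nonzero volume is above this average. *)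
Definition setup_round : cmd :=
  Seq (Set_ ROW (Bin Mul (var TT) (var NE))) (Seq reset_vertices (Seq sum_lengths
    (Seq (Set_ BET (succ_ (Bin Div (var WS) (var NE)))) (Seq set_mu
      (Seq (Put ST (Cst 1) (Cst 0)) (Seq (Put EN (Cst 1) (var N0)) (Seq (Put DONE (Cst 1) (Cst 0))
        (Seq (Set_ NP (Cst 2)) (Set_ TOP (var N0)))))))))).

Definition round : cmd := Seq setup_round (Seq decompose reweight).

Notation round_mods := [:: 5; ST; EN; VOL; DONE; NP; COMP; LL; TOP;
  LAM true; QQ true; QL true; AA true; DG true; BIG true; LEV true;
  LAM false; QQ false; QL false; AA false; DG false; BIG false; LEV false;
  VY; NL; VX; VE; I1; N1; DEL; AC; FND; YY; JJ; CQ; VV; CI; CX; ROW; WS; BET; MU; WT; RM].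

Section Round.
Variables (B : nat) (g : graph) (D T : nat) (L0 : seq nat).
Notation n := (nv g).
Notation m := (ne g).
Notation Lm := (trunc_log 2 (10 * m)).
Notation h := (bits Lm).
Notation dtot := (dtot g).
Notation weight := (weight g).

(** 48 is 4 * 12, from the factor 4 in [cheap] and from the total volume, which is at most 12 times
    the sum of weight times length. The alternative [x = y] covers isolated vertices, which belong
    to no part. *)
Definition good_cut (S : pred nat) (w : nat -> nat) : Prop :=
  (forall x y, scc g S x y -> x = y \/ exists2 C, core g D C & C x && C y) /\
  D * \sum_(e < m | S e) w e <= 48 * h * Lm * \sum_(e < m) w e * elen g e.

Record capacity : Prop := Capacity {
  cap_B : 0 < B;
  cap_D : 0 < D;
  cap_D2 : 2 * D + 2 < 2 ^ B;
  cap_len : forall e, e < m -> 2 * D + 4 * elen g e + 2 < 2 ^ B;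
  cap_w : 12 * (\sum_(e < m) 2 ^ T * elen g e) + 2 < 2 ^ B;
  cap_t : 12 * m * Lm.+1 + 2 * n + 10 < 2 ^ B;
  cap_T : T * m + 2 ^ T < 2 ^ B }.

Record round_inv (t : nat) (M : memory) : Prop := RoundInv {
  ri_static : static g M;
  ri_D : M 0 2 = D;
  ri_h : M HH 0 = h;
  ri_ne : M NE 0 = m;
  ri_n0 : M N0 0 = size L0;
  ri_la : forall i, i < size L0 -> M L0A i = nth 0 L0 i;
  ri_wt : forall e, e < m -> M WT e = weight (fun e => \sum_(i < t) M 5 (i * m + e)) e;
  ri_rm : forall e, e < m -> M RM e = (\sum_(i < t) M 5 (i * m + e)) %% elen g e;
  ri_lam : forall d z, M (LAM d) z = 0;
  ri_comp : forall x, x \notin L0 -> M COMP x = 0;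
  ri_mu : forall x, x \notin L0 -> M MU x = 0;
  ri_tab : forall j, t * m <= j -> M 5 j = 0;
  ri_bool : forall j, M 5 j <= 1 }.

Hypothesis cap : capacity.
Lemma sum_dtot : \sum_(x < n) dtot x = 2 * m.
Proof.
rewrite /dtot big_split /=.
have h d : \sum_(x < n) degr g d x = m by rewrite (sum_degr g d predT) sum_nat_const card_ord muln1.
by rewrite !h mul2n addnn.
Qed.

Section Weights.
Variable w : nat -> nat.
Hypothesis w_gt0 : forall e, e < m -> 0 < w e.
Hypothesis w_le : forall e, e < m -> w e <= 2 ^ T.
Let W := \sum_(e < m) w e * elen g e.
Let beta := (W %/ m).+1.

Lemma m_le_W : m <= W.
Proof.
rewrite -[X in X <= _]card_ord -sum1_card; apply: leq_sum => e _.
by rewrite muln_gt0 w_gt0 // elen_gt0.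
Qed.

Lemma W_le : W <= \sum_(e < m) 2 ^ T * elen g e.
Proof. by apply: leq_sum => e _; rewrite leq_mul2r w_le ?orbT. Qed.

Lemma volE : vol g w beta predT = 8 * W + 2 * (m * beta).
Proof.
rewrite vol_predT -big_distrr /= big_split /= sum_nat_const card_ord.
under eq_bigr => e _ do rewrite -mulnA.
by rewrite -big_distrr /= -/W; lia.
Qed.

(** [beta] exceeds [W / m] by at most 1, and [m <= W] as weights and lengths are positive. *)
Lemma mbeta_le : m * beta <= 2 * W.
Proof.
rewrite /beta mulnS; have := leq_divM W m; have := m_le_W; rewrite [W %/ m * m]mulnC.
by move: (m * _) => z; lia.
Qed.

Lemma vol_le12 : vol g w beta predT <= 12 * W.
Proof. by rewrite volE; have := mbeta_le; move: (m * beta) => z; lia. Qed.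

Lemma mu_ge x : 0 < mu g w beta x -> beta <= mu g w beta x.
Proof.
have hd d : 0 < wmu g w beta d x -> beta <= wmu g w beta d x.
  case: (pickP [pred e : 'I_m | src g d e == x]) => [e /= xe _|none]; last first.
    by rewrite /wmu big_pred0.
  by rewrite /wmu (bigD1 e) //= -addnA -[X in X <= _]add0n leq_add // leq_addr.
rewrite /mu addn_gt0 => /orP[/hd|/hd] hb; apply: leq_trans hb _; [exact: leq_addr | exact: leq_addl].
Qed.

Lemma mu_touched x : x < n -> (0 < mu g w beta x) = (0 < dtot x).
Proof.
move=> xn; have hd d : (0 < wmu g w beta d x) = (0 < degr g d x).
  have -> : degr g d x = \sum_(e < m | src g d e == x) 1 by rewrite -(sum_adj g d x (fun=> 1)) sum1_size.
  rewrite /wmu; case: (pickP [pred e : 'I_m | src g d e == x]) => [e /= xe|none]; last by rewrite !big_pred0.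
  by rewrite (bigD1 e) //= [in RHS](bigD1 e) //= /beta addnS.
by rewrite /mu /dtot !addn_gt0 !hd.
Qed.

(** A nonzero volume is at least [beta], and the total volume [8 * W + 2 * (m * beta)] is below
    [10 * m * beta] because [W < m * beta]. This is the origin of [10 * m] in [Lm]. *)
Lemma Lm_bound U l : 0 < vol g w beta U -> vol g w beta U * 2 ^ l <= vol g w beta predT -> l <= Lm.
Proof.
move=> U0 hU.
have [x Ux mx] : exists2 x : 'I_n, U x & 0 < mu g w beta x.
  case: (pickP [pred x : 'I_n | U x && (0 < mu g w beta x)]) => [x /andP[h1 h2]|none]; first by exists x.
  by move: U0; rewrite /vol big1 // => x Ux; apply/eqP; have := none x; rewrite /= Ux /= lt0n => /negbFE.
have bU : beta <= vol g w beta U.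
  by apply: leq_trans (mu_ge mx) _; rewrite /vol (bigD1 x) //=; apply: leq_addr.
have m0 : 0 < m.
  rewrite lt0n; apply/negP => /eqP m0; move: mx; rewrite mu_touched //.
  have := sum_dtot; rewrite m0 (bigD1 x) //=; lia.
have Wb : W < m * beta by rewrite mulnC -ltn_divLR // /beta.
apply: trunc_log_max => //; rewrite -(leq_pmul2r (isT : 0 < beta)).
apply: leq_trans (_ : vol g w beta U * 2 ^ l <= _).
  by rewrite mulnC leq_mul2r bU orbT.
by apply: leq_trans hU _; rewrite volE -mulnA; move: (m * beta) Wb => z; lia.
Qed.

Lemma round_bounds : bounds B g w beta D Lm.
Proof.
have hW := W_le; have [c1 c2 c3 c4 c5 c6 c7] := cap.
have v12 := vol_le12.
split=> //.
- by move: c6; move: (12 * m * _) => z; lia.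
- have : m <= 12 * m * Lm.+1 by rewrite -mulnA mulnCA -[X in X <= _]muln1 leq_mul2l; apply/orP; right; lia.
  by move: c6; move: (12 * m * _) => z; lia.
- by lia.
- apply: leq_ltn_trans (_ : W < _); last by lia.
  by apply: leq_sum => e _; rewrite leq_pmulr // elen_gt0.
- exact: Lm_bound.
Qed.

End Weights.

Hypothesis L0_uniq : uniq L0.
Hypothesis L0_mem : forall x, (x \in L0) = (x < n) && (0 < dtot x).

Lemma sum_L0 : \sum_(x < n | (x : nat) \in L0) (dtot x).+1 <= 4 * m.
Proof.
apply: leq_trans (_ : \sum_(x < n) 2 * dtot x <= _); last by rewrite -big_distrr /= sum_dtot; lia.
rewrite big_mkcond; apply: leq_sum => x _; case: ifP => //; rewrite L0_mem; lia.
Qed.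

Lemma size_L0 : size L0 <= 2 * m.
Proof.
have -> : size L0 = \sum_(x < n | (x : nat) \in L0) 1.
  rewrite -(sum_w_vol (g := g) (fun=> 1) (P := fun x => x \in L0) L0_uniq) => [|x|x] //.
    by rewrite -sum1_size big_seq.
  by rewrite L0_mem => /andP[].
rewrite -sum_dtot big_mkcond; apply: leq_sum => x _; case: ifP => //.
by rewrite L0_mem => /andP[].
Qed.

Lemma size_L0_n : size L0 <= n.
Proof.
rewrite -[X in _ <= X](size_iota 0); apply: uniq_leq_size L0_uniq _ => x.
by rewrite L0_mem mem_iota => /andP[].
Qed.

Lemma reach_touched S x y : reach g S x y -> x = y \/ y \in L0.
Proof.
case=> [|e em _ _]; [by left | right]; rewrite L0_mem src_lt //= /dtot addn_gt0; apply/orP; right.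
by rewrite /degr -has_predT; apply/hasP; exists e => //; rewrite mem_adj em eqxx.
Qed.

End Round.

Notation setup_mods := [:: ROW; COMP; MU; LL; I1; VX; WS; BET; VOL; YY; ST; EN; DONE; NP; TOP].

Section Setup_round.
Variables (B : nat) (g : graph) (D T : nat) (L0 : seq nat).
Notation n := (nv g).
Notation m := (ne g).
Notation Lm := (trunc_log 2 (10 * m)).
Notation dtot := (dtot g).
Notation weight := (weight g).
Hypothesis cap : capacity B g D T.
Hypothesis L0_uniq : uniq L0.
Hypothesis L0_mem : forall x, (x \in L0) = (x < n) && (0 < dtot x).
Notation round_inv := (round_inv g D L0).

Variables (t : nat) (M : memory).
Hypothesis ri : round_inv t M.
Hypothesis tE : M TT 0 = t.
Hypothesis tT : t < T.

Let w := weight (fun e => \sum_(i < t) M 5 (i * m + e)).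
Let W := \sum_(e < m) w e * elen g e.
Let beta := (W %/ m).+1.
Notation vol := (vol g w beta).
Notation mu := (mu g w beta).

Lemma round_w_gt0 e : 0 < w e.
Proof. by rewrite /w /weight expn_gt0. Qed.

Lemma round_w_le e : w e <= 2 ^ T.
Proof.
rewrite /w /weight leq_exp2l //; apply: leq_trans (leq_div _ _) _.
apply: leq_trans (_ : \sum_(i < t) 1 <= _); last by rewrite sum1_card card_ord ltnW.
by apply: leq_sum => i _; apply: (ri_bool ri).
Qed.

Lemma round_bd : bounds B g w beta D Lm.
Proof. by apply: (round_bounds cap) => e _; [apply: round_w_gt0 | apply: round_w_le]. Qed.

Lemma wp_setup_round :
  wp B setup_round M (fun s M' => [/\ s <= 30 * m + 30, agree setup_mods M M',
    round_static g w beta D Lm M', M' ROW 0 = t * m &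
    [/\ M' NP 0 = 2, M' TOP 0 = size L0, M' ST 1 = 0 & [/\ M' EN 1 = size L0, M' DONE 1 = 0, M' VOL 1 = vol predT,
      forall x, M' COMP x = (x \in L0) /\ M' MU x = mu x & forall i, i < size L0 -> M' LL i = nth 0 L0 i]]]).
Proof.
have bd := round_bd; have B_gt0 := b_B bd.
have [r1 r2 r3 r4 r5 r6 r7 r8 r9 r10 r11 r12 r13] := ri; rewrite -/w in r7.
have s2 := size_L0 L0_uniq L0_mem.
have [c1 c2 c3 c4 c5 c6 c7] := cap.
have WB : W < 2 ^ B.
  have := W_le (g := g) (T := T) (w := w) (fun e _ => round_w_le e); rewrite -/W => hW.
  by apply: leq_ltn_trans hW _; move: (\sum_(_ < _) _) c5 => z; lia.
have vB : vol predT < 2 ^ B := b_vol bd.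
have B2 : 2 < 2 ^ B by lia.
have sB : size L0 < 2 ^ B.
  by apply: leq_ltn_trans (size_L0_n L0_uniq L0_mem) (b_n bd).
apply: wp_seq; wset => /=; rewrite tE r4.
  move=> _; apply: leq_ltn_trans (_ : T * m < _); first by rewrite leq_mul2r ltnW ?orbT.
  by move: c7; move: (T * m) (2 ^ T) => y z; lia.
set M0 := update _ _ _ _.
have ag0 : agree [:: ROW] M M0 by apply: agree_update; rewrite ?inE ?eqxx.
apply: wp_seq.
apply: wp_conseq (@wp_reset_vertices _ B_gt0 M0 L0 _ _) _; [by rewrite ag0| by move=> i ?; rewrite ag0 ?r6|].
move=> s1 M1 [sl1 ag1 comp1 mu1 ll1].
have ag01 : agree [:: ROW; COMP; MU; LL; I1; VX] M M1.
  by apply: agree_trans (agree_sub _ ag0) (agree_sub _ ag1); sublist.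
have st1 : static g M1 by apply: static_agree ag01 r1.
apply: wp_seq; apply: wp_conseq (@wp_sum_lengths _ _ B_gt0 w M1 st1 _ _ WB) _.
- by rewrite ag01.
- by move=> e em; rewrite ag01 // r7.
move=> s3 M3 [sl3 ag3 ws3]; rewrite -/W in ws3.
have ag03 : agree [:: ROW; COMP; MU; LL; I1; VX; WS] M M3.
  by apply: agree_trans (agree_sub _ ag01) (agree_sub _ ag3); sublist.
apply: wp_seq; wset => /=; rewrite ws3 (ag03 NE) // r4 addn1 -/beta.
  move=> _; rewrite /beta; have [m0|m0] := posnP m; first by rewrite m0 divn0; lia.
  have := mbeta_le (g := g) (fun e _ => round_w_gt0 e); rewrite -/w -/W -/beta => mb.
  have W2 : 2 * W < 2 ^ B.
    have := W_le (g := g) (T := T) (w := w) (fun e _ => round_w_le e); rewrite -/W => hW.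
    by move: hW c5; move: (\sum_(_ < _) _) W => y z; lia.
  by apply: leq_ltn_trans W2; apply: leq_trans mb; rewrite -/beta leq_pmull.
set M4 := update _ _ _ _.
have ag4 : agree [:: BET] M3 M4 by apply: agree_update; rewrite ?inE ?eqxx.
have ag04 : agree [:: ROW; COMP; MU; LL; I1; VX; WS; BET] M M4.
  by apply: agree_trans (agree_sub _ ag03) (agree_sub _ ag4); sublist.
have st4 : static g M4 by apply: static_agree ag04 r1.
apply: wp_seq; apply: wp_conseq (@wp_set_mu _ _ B_gt0 w beta M4 st4 _ _ _ _ vB) _.
- by rewrite ag04.
- by move=> e em; rewrite ag04 // r7.
- by rewrite /M4; upds.
- move=> x; rewrite ag4 // ag3 // mu1; case: ifP => // xL; rewrite ag0 // r11 //.
  by rewrite xL.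
move=> s5 M5 [sl5 ag5 mu5 vol5].
have ag05 : agree setup_mods M M5.
  by apply: agree_trans (agree_sub _ ag04) (agree_sub _ ag5); sublist.
apply: wp_seq; wput => /=; first by lia.
apply: wp_seq; wput => /=; upds; rewrite ag05 // r5 //.
apply: wp_seq; wput => /=; upds; first by lia.
apply: wp_seq; wset => /=; upds => //.
wset => /=; upds; rewrite ?(ag05 N0) // ?r5 //.
split=> //.
- by lia.
- by do !(apply: agree_update; first by rewrite !inE ?eqxx ?orbT).
- have ag06 : agree [:: TOP; NP; DONE; EN; ST] M5 (update (update (update (update (update M5 ST 1 0) EN 1 (size L0)) DONE 1 0) NP 0 2) TOP 0 (size L0)).
    by agr.
  split.
  + apply: (static_agree (xs := setup_mods)) r1 => //.
    by apply: agree_trans ag05 _; apply: agree_sub ag06; sublist.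
  + by rewrite ag06 // ag05.
  + by move=> e em; rewrite ag06 // ag05 // r7.
  + by move=> x xn; rewrite ag06 // mu5.
  + by rewrite ag06 // ag05.
- upds; rewrite ag5 // ag4 // ag3 // ag1 // /M0; upds.
upds; split=> //.
split=> //.
- move=> x; split; upds; last by rewrite mu5.
  by rewrite ag5 // ag4 // ag3 // comp1; case: ifP => // xL; rewrite ag0 // r10 // xL.
- by move=> i iL; upds; rewrite ag5 // ag4 // ag3 // ll1.
Qed.

End Setup_round.

Section Wp_round.
Variables (B : nat) (g : graph) (D T : nat) (L0 : seq nat).
Notation n := (nv g).
Notation m := (ne g).
Notation Lm := (trunc_log 2 (10 * m)).
Notation h := (bits Lm).
Notation dtot := (dtot g).
Notation weight := (weight g).
Hypothesis cap : capacity B g D T.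
Hypothesis L0_uniq : uniq L0.
Hypothesis L0_mem : forall x, (x \in L0) = (x < n) && (0 < dtot x).
Notation round_inv := (round_inv g D L0).

Lemma mu_out w beta x : n <= x -> mu g w beta x = 0.
Proof.
move=> nx; rewrite /mu /wmu !big_pred0 // => e.
  by apply/eqP => xe; have := src_lt true (ltn_ord e); rewrite xe; lia.
by apply/eqP => xe; have := src_lt false (ltn_ord e); rewrite xe; lia.
Qed.

Definition round_bound := 100 * process_bound D Lm * Lm.+1.

Lemma wp_round t (M : memory) : round_inv t M -> M TT 0 = t -> t < T ->
  wp B round M (fun s M' => [/\ s <= round_bound * m.+1, agree round_mods M M', round_inv t.+1 M',
    forall j, j < t * m -> M' 5 j = M 5 j &
    good_cut g D (fun e => M' 5 (t * m + e) != 0) (weight (fun e => \sum_(i < t) M 5 (i * m + e)))]).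
Proof.
move=> ri tE tT; have bd := round_bd cap ri tT.
have := wp_setup_round cap L0_uniq L0_mem ri tE tT.
have w_le := round_w_le ri tT; have w_gt0 := round_w_gt0 g t M.
set w := weight _ in bd w_le w_gt0 *; set W := \sum_(e < m) _ in bd *; set beta := (W %/ m).+1 in bd *.
move=> su; have B_gt0 := b_B bd.
have [r1 r2 r3 r4 r5 r6 r7 r8 r9 r10 r11 r12 r13] := ri; rewrite -/w in r7.
have s2 := size_L0 L0_uniq L0_mem.
have [c1 c2 c3 c4 c5 c6 c7] := cap.
have touched x : (x \in L0) = (x < n) && (0 < mu g w beta x).
  by rewrite L0_mem; case: (ltnP x n) => //= xn; rewrite mu_touched.
apply: wp_seq; apply: wp_conseq su _.
move=> s1 M1 [sl1 ag1 rs1 row1 [np1 top1 st1 [en1 done1 vol1 comp1 ll1]]].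
have T1 : M1 5 = M 5 by rewrite ag1.
have row0 e : M 5 (t * m + e) = 0 by rewrite r12 ?leq_addr.
have q1 q : 0 < q < M1 NP 0 -> q = 1 by rewrite np1; lia.
have live1 x : live M1 x -> x \in L0 by rewrite /live (comp1 x).1; case: (x \in L0).
have seg1 : segment g M1 1 L0.
  split=> //; rewrite ?en1 ?st1 ?top1 //.
  by split=> x; [rewrite (comp1 x).1; case: (x \in L0) | rewrite L0_mem => /andP[]].
(* The round starts with a single part at level 0, whose volume bound is the total volume, and with
   an empty row. *)
have pi1 : pinv g w beta D Lm (t * m) (M 5) M1 (fun=> 0).
  split.
  + by rewrite np1.
  + by move=> x; rewrite np1 (comp1 x).1 touched; split; case: (_ && _).
  + by move=> q /q1 ->; exists L0.
  + move=> q /q1 ->; rewrite vol1 expn0 muln1; split=> //.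
    rewrite /vol [X in X <= _]big_mkcond; apply: leq_sum => x _; case: ifP => //.
  + by move=> q /q1 ->; rewrite done1.
  + move=> x y [rxy ryx]; rewrite !(comp1 _).1.
    case: (reach_touched L0_mem rxy) => [->//|yL]; case: (reach_touched L0_mem ryx) => [->//|xL].
    by rewrite xL yL.
  + rewrite big_pred0 => [|e]; last by rewrite /cut_row T1 row0.
    rewrite muln0 add0n -[X in _ <= X]mulnA leq_mul2l; apply/orP; right.
    rewrite /vol big_distrl /= big_mkcond; apply: leq_sum => x _; case: ifP => // _.
    by rewrite subn0.
  + move=> j; rewrite T1; case: ifP => // /andP[/subnKC <- _]; by rewrite row0.
have tp1 : tpot g Lm M1 (fun=> 0) <= 4 * m * Lm.+1.
  rewrite /tpot -big_distrl /= leq_mul2r; apply/orP; right.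
  apply: leq_trans (sum_L0 L0_uniq L0_mem); rewrite [X in X <= _]big_mkcond [X in _ <= X]big_mkcond.
  by apply: leq_sum => x _; case: ifP => // /live1 ->.
have sp1 : spot M1 = size L0.
  rewrite /spot np1 big_mkcond big_ord_recl big_ord1 /= done1 /= en1 st1; lia.
have mL : 2 * m <= 2 * m * Lm.+1 by rewrite leq_pmulr.
apply: wp_seq; apply: wp_conseq (wp_decompose bd rs1 pi1 row1 _ _ _ _) _.
- by move=> d z; rewrite ag1 ?r9 //; neqarr.
- move=> x /live1 xL; exists (index x L0); rewrite (comp1 x).1 xL st1 en1 ll1 ?index_mem //.
  by split=> //; rewrite nth_index.
- by move: tp1 mL c6 np1; clear; lia.
- by move: tp1 mL c6 top1 s2; clear; lia.
move=> s2' M2 [ag2 lam2 sl2 [lv pi2 done2]].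
have [p1 p2 p3 p4 p5 p6 p7 p8] := pi2.
have ag02 : agree round_mods M M2.
  by apply: agree_trans (agree_sub _ ag1) (agree_sub _ ag2); sublist.
pose c e := \sum_(i < t) M 5 (i * m + e).
pose c' e := \sum_(i < t.+1) M2 5 (i * m + e).
have old j : j < t * m -> M2 5 j = M 5 j.
  by move=> jt; rewrite p8 leqNgt jt.
have new e : e < m -> M2 5 (t * m + e) = (M2 5 (t * m + e) != 0).
  by move=> em; rewrite {1}p8 leq_addr addKn em.
have c'E e : e < m -> c' e = c e + (M2 5 (t * m + e) != 0).
  move=> em; rewrite /c' big_ord_recr /= -new //; congr (_ + _).
  apply: eq_bigr => i _; apply: old.
  by apply: leq_trans (_ : i.+1 * m <= _); rewrite ?leq_mul2r ?ltn_ord ?orbT // mulSn addnC ltn_add2r.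
have le1 j : M2 5 j <= 1 by rewrite p8; case: ifP => // _; case: eqP.
have st2 : static g M2 by apply: static_agree ag02 r1.
have rE : M2 ROW 0 = t * m by rewrite ag2.
have wE e : e < m -> M2 WT e = weight c e by move=> em; rewrite ag2 // (rs_wt rs1).
have rmE e : e < m -> M2 RM e = c e %% elen g e by move=> em; rewrite ag2 // ag1 // r8.
have wB e : e < m -> weight c' e < 2 ^ B.
  move=> em; apply: leq_ltn_trans (_ : 2 ^ T < _); last by move: c7; move: (T * m) (2 ^ T) (2 ^ B); lia.
  rewrite /weight leq_exp2l //; apply: leq_trans (leq_div _ _) _.
  apply: leq_trans (_ : \sum_(i < t.+1) 1 <= _); last by rewrite sum1_card card_ord.
  by apply: leq_sum.
have lB e : e < m -> elen g e < 2 ^ B by move=> em; have := c4 e em; lia.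
have nE : M2 NE 0 = m by rewrite ag02.
apply: wp_conseq (wp_reweight B_gt0 st2 nE rE wE rmE c'E wB lB) _.
move=> s3 M3 [sl3 ag3 wt3 rm3].
have ag03 : agree round_mods M M3.
  by apply: agree_trans ag02 _; apply: agree_sub ag3; sublist.
have T3 : M3 5 = M2 5 by rewrite ag3.
have gone x : x \notin L0 -> mu g w beta x = 0.
  rewrite touched; case: (ltnP x n) => /= [_|nx _]; last exact: mu_out.
  by rewrite lt0n negbK => /eqP.
split=> //.
- move: sl2; rewrite /phi sp1 top1 /round_bound => sl2.
  have K6g : 1 <= process_bound D Lm by rewrite /process_bound addn_gt0; apply/orP; right; rewrite muln_gt0 muln_gt0.
  have h1 : 3 * process_bound D Lm * tpot g Lm M1 (fun=> 0) <= 12 * (process_bound D Lm * Lm.+1 * m).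
    apply: leq_trans (_ : 3 * process_bound D Lm * (4 * m * Lm.+1) <= _); first by rewrite leq_mul2l tp1 orbT.
    by move: (process_bound D Lm) => K; clear; lia.
  have h2 : process_bound D Lm * size L0 <= 2 * (process_bound D Lm * Lm.+1 * m).
    apply: leq_trans (_ : process_bound D Lm * (2 * m * Lm.+1) <= _); last by move: (process_bound D Lm) => K; clear; lia.
    by rewrite leq_mul2l; apply/orP; right; apply: leq_trans s2 mL.
  have h3 : m.+1 <= process_bound D Lm * Lm.+1 * m.+1 by rewrite leq_pmull // muln_gt0 K6g.
  have h4 : process_bound D Lm * Lm.+1 * m <= process_bound D Lm * Lm.+1 * m.+1 by rewrite leq_mul2l leqnSn orbT.
  move: h1 h2 h3 h4 sl1 sl2 sl3 s2; move: (process_bound D Lm) => K; clear; lia.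
- have e3 a : a \notin round_mods -> M3 a = M a by apply: ag03.
  split.
  + exact: static_agree ag03 r1.
  + by rewrite e3.
  + by rewrite e3.
  + by rewrite e3.
  + by rewrite e3.
  + by move=> i iL; rewrite e3 // r6.
  + by move=> e em; rewrite wt3 // T3.
  + by move=> e em; rewrite rm3 // T3.
  + by move=> d z; rewrite ag3 ?lam2 //; neqarr.
  + move=> x xL; apply/eqP; rewrite ag3 // -[_ == _]negbK (p2 x).2 -touched //.
  + by move=> x xL; rewrite ag3 // ag2 // (comp1 x).2 gone.
  + move=> j; rewrite mulSn => jt; rewrite T3 p8 ifF; first by apply: r12; lia.
    by apply/negP => /andP[]; lia.
  + by move=> j; rewrite T3.
- by move=> j jt; rewrite T3 old.
split; rewrite T3.
  move=> x y sxy; have cxy := p6 x y sxy; have [rxy ryx] := sxy.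
  case: (reach_touched L0_mem rxy) => [->|yL]; [by left | right].
  have cy : M2 COMP y != 0 by rewrite (p2 y).2 -touched.
  exists (part M2 (M2 COMP y)); last by rewrite /part /= cxy eqxx.
  by apply: p5; [rewrite (p2 y).1 lt0n cy | apply: done2].
(* The unspent levels are dropped from [p_cost], and the total volume is replaced by [12 * W]. *)
apply: leq_trans (leq_trans (leq_addr _ _) p7) _.
apply: leq_trans (_ : 4 * h * (12 * W) * Lm <= _); last by clear; lia.
rewrite leq_mul2r leq_mul2l; apply/orP; right; apply/orP; right.
by apply: vol_le12.
Qed.

End Wp_round.

(** * Adjacency lists and parameters *)

Definition link d : cmd :=
  Seq (Set_ VX (Get (SRC d) (var I1)))
    (Seq (Put (NXT d) (var I1) (Get (FST d) (var VX)))
      (Seq (Put (FST d) (var VX) (succ_ (var I1)))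
        (Seq (Put (DEG d) (var VX) (succ_ (Get (DEG d) (var VX))))
          (If (Get COMP (var VX)) Skip
            (Seq (Put COMP (var VX) (Cst 1))
              (Seq (Put L0A (var N0) (var VX)) (Set_ N0 (succ_ (var N0))))))))).

Definition build_graph : cmd :=
  Seq (Set_ NE (Get 0 (Cst 1)))
    (For I1 NE (Seq (link false) (Seq (link true) (Put WT (var I1) (Cst 1))))).

Definition log_of (x : expr) := Seq (Set_ VV x) (log_ratio (Cst 1)).

Definition set_parameters : cmd :=
  Seq (log_of (Bin Mul (Cst 10) (var NE))) (Seq (log_of (var JJ)) (Seq (Set_ HH (succ_ (var JJ)))
    (Seq (log_of (var 0)) (Set_ TB (Bin Mul (Get 0 (Cst 2)) (succ_ (var JJ))))))).

Definition decomposition_program : cmd :=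
  Seq build_graph (Seq set_parameters (Seq (Put 4 (Cst 0) (var TB)) (For TT TB round))).

Lemma bool_neq (d d' : bool) : d' != d -> d' = ~~ d.
Proof. by case: d'; case: d. Qed.

Lemma chain_ext nxt nxt' p l : {in l, nxt =1 nxt'} -> chain nxt p l -> chain nxt' p l.
Proof.
elim: l p => //= e l IH p h [pe cl]; split=> //.
rewrite -h ?mem_head //; apply: IH cl => x xl; apply: h; by rewrite inE xl orbT.
Qed.

Lemma wp_log_of B x (M : memory) V : 0 < B -> expr_val M x = V -> V < 2 ^ B ->
  wp B (log_of x) M (fun s M' => [/\ s <= 3 * trunc_log 2 V + 4, agree [:: VV; YY; JJ] M M' & M' JJ 0 = trunc_log 2 V]).
Proof.
move=> B_gt0 vE vB; apply: wp_seq; wset => /=; rewrite vE //.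
set M0 := update _ _ _ _.
apply: wp_conseq (wp_log_ratio B_gt0 (a := Cst 1) (M := M0) (V := V) (A := 1) _ _ _) _ => //.
by move=> _; case: (B) B_gt0 => // b' _; rewrite expnS; have := expn_gt0 2 b'; lia.
move=> s M1 [sl ag]; rewrite divn1 => ->; split=> //; first by rewrite divn1 in sl; lia.
by apply: agree_trans (_ : agree _ M M0) (agree_sub _ ag); [agr | sublist].
Qed.

Notation build_mods := [:: NE; I1; WT; VX; NXT true; FST true; DEG true; NXT false; FST false; DEG false; COMP; L0A; N0].

Notation link_mods := [:: VX; NXT true; FST true; DEG true; NXT false; FST false; DEG false; COMP; L0A; N0].

Section Prep.
Variables (B : nat) (g : graph).
Hypothesis B_gt0 : 0 < B.
Notation n := (nv g).
Notation m := (ne g).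
Hypothesis nB : n < 2 ^ B.
Hypothesis mB : m < 2 ^ B.

Definition adj_upto d x k := [seq e <- rev (iota 0 k) | src g d e == x].

Lemma adj_uptoS d x k : adj_upto d x k.+1 = if src g d k == x then k :: adj_upto d x k else adj_upto d x k.
Proof. by rewrite /adj_upto -addn1 iotaD rev_cat /= add0n; case: ifP. Qed.

Lemma size_adj_upto d x k : size (adj_upto d x k) <= k.
Proof. by rewrite size_filter; apply: leq_trans (count_size _ _) _; rewrite size_rev size_iota. Qed.

(** Each direction has its own counter in [ks], since an edge is linked in one direction after the
    other. [COMP] serves as the mark of the vertices already listed in [L0A]. *)
Record linked (ks : bool -> nat) (L : seq nat) (M : memory) : Prop := Linked {
  lk_chain : forall d x, chain (M (NXT d)) (M (FST d) x) (adj_upto d x (ks d));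
  lk_deg : forall d x, M (DEG d) x = size (adj_upto d x (ks d));
  lk_n0 : M N0 0 = size L;
  lk_la : forall i, i < size L -> M L0A i = nth 0 L i;
  lk_uniq : uniq L;
  lk_mem : forall x, (x \in L) = (0 < size (adj_upto false x (ks false)) + size (adj_upto true x (ks true)));
  lk_comp : forall x, M COMP x = (x \in L);
  lk_lt : forall x, x \in L -> x < n }.

Lemma linked_agree xs ks L (M M' : memory) :
  all (fun a => a \notin xs) [:: NXT true; FST true; DEG true; NXT false; FST false; DEG false; COMP; L0A; N0] ->
  agree xs M M' -> linked ks L M -> linked ks L M'.
Proof.
move=> /allP hx ag [h1 h2 h3 h4 h5 h6 h7 h8].
have e a : a \in [:: NXT true; FST true; DEG true; NXT false; FST false; DEG false; COMP; L0A; N0] -> M' a = M a.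
  by move=> /hx; apply: ag.
split=> //.
- by move=> d x; rewrite !e //; case: d.
- by move=> d x; rewrite !e //; case: d.
- by rewrite e.
- by move=> i iL; rewrite e // h4.
- by move=> x; rewrite e.
Qed.

Lemma wp_link d ks L (M : memory) : linked ks L M -> M I1 0 = ks d -> ks d < m ->
  M (SRC d) (ks d) = src g d (ks d) ->
  wp B (link d) M (fun s M' => [/\ s <= 8, agree link_mods M M' &
    exists L', linked (fun d' => if d' == d then (ks d).+1 else ks d') L' M']).
Proof.
move=> lk i1 km sE; have [h1 h2 h3 h4 h5 h6 h7 h8] := lk.
set k := ks d in i1 km sE *; set v := src g d k in sE *.
have vn : v < n by apply: src_lt.
have deg_lt : M (DEG d) v < m by rewrite h2; apply: leq_ltn_trans (size_adj_upto _ _ _) km.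
apply: (wp_bounded (B := B)) => bM.
have kB : k < 2 ^ B by apply: ltn_trans km mB.
apply: wp_seq; wset => /=; rewrite i1 sE; first by move=> _; apply: ltn_trans vn nB.
apply: wp_seq; wput => /=; upds; first by move=> _; apply: bM.
apply: wp_seq; wput => /=; upds; rewrite i1 addn1; first by move=> _; apply: leq_ltn_trans km mB.
apply: wp_seq; wput => /=; upds; rewrite addn1; first by move=> _; apply: leq_ltn_trans deg_lt mB.
set M1 := update _ (DEG d) _ _.
have ag1 : agree link_mods M M1.
  by rewrite /M1; case: d @k @v {i1 km sE vn deg_lt kB M1} => k v; do !(apply: agree_update; first by rewrite !inE ?eqxx ?orbT).
have new_adj d' x : adj_upto d' x (if d' == d then k.+1 else ks d') =
    if (d' == d) && (x == v) then k :: adj_upto d' x (ks d') else adj_upto d' x (ks d').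
  by case: (eqVneq d' d) => [->|//]; rewrite adj_uptoS -/v eq_sym.
have chain1 d' x : chain (M1 (NXT d')) (M1 (FST d') x) (adj_upto d' x (if d' == d then k.+1 else ks d')).
  rewrite new_adj; case: (eqVneq d' d) => [->|dN] /=; last first.
    rewrite (bool_neq dN) /M1; upds; apply: h1.
  rewrite /M1; upds; rewrite /fupd.
  have ch y : chain (fun j => if j == k then M (FST d) v else M (NXT d) j) (M (FST d) y) (adj_upto d y k).
    apply: chain_ext (h1 d y) => e; rewrite mem_filter mem_rev mem_iota => /andP[_ ek].
    by rewrite ifN //; lia.
  by case: (eqVneq x v) => [->|xN] //=; split=> //; rewrite eqxx; apply: ch.
have deg1 d' x : M1 (DEG d') x = size (adj_upto d' x (if d' == d then k.+1 else ks d')).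
  rewrite new_adj; case: (eqVneq d' d) => [->|dN] /=; last first.
    rewrite (bool_neq dN) /M1; upds; apply: h2.
  by rewrite /M1; upds; rewrite /fupd; case: (eqVneq x v) => [->|xN] //=; rewrite h2.
have mem1 x : (0 < size (adj_upto false x (if false == d then k.+1 else ks false)) +
    size (adj_upto true x (if true == d then k.+1 else ks true))) = (x == v) || (x \in L).
  rewrite h6 !new_adj; case: (eqVneq x v) => [->|xN]; last by rewrite !andbF.
  by case: (d); rewrite /= ?addnS.
have e1 : [/\ M1 COMP = M COMP, M1 N0 = M N0 & M1 L0A = M L0A] by rewrite /M1; split; upds.
have [ec en el] := e1.
have vx1 : M1 VX 0 = v by rewrite /M1; upds.
wif; rewrite /= vx1 ec h7; case: (boolP (v \in L)) => vL /=.
  wskip; split=> //; exists L; split=> //.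
  + by rewrite en.
  + by move=> i iL; rewrite el h4.
  + move=> x; rewrite mem1; case: (eqVneq x v) => [->|] //=.
  + by move=> x; rewrite ec h7.
have sL : (size L).+1 <= n.
  rewrite -[X in _ <= X](size_iota 0); apply: (@uniq_leq_size _ (v :: L)); first by rewrite /= vL h5.
  by move=> x; rewrite inE mem_iota add0n => /orP[/eqP->//|/h8].
apply: wp_seq; wput => /=; first by lia.
apply: wp_seq; wput => /=; upds; rewrite vx1; first by move=> _; apply: ltn_trans vn nB.
wset => /=; upds; rewrite en h3 addn1; first by move=> _; apply: leq_ltn_trans sL nB.
split=> //.
  by do !(apply: agree_update; first by rewrite !inE ?eqxx ?orbT).
exists (rcons L v); split.
- by move=> d' x; upds; apply: chain1.
- by move=> d' x; upds; apply: deg1.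
- by upds; rewrite size_rcons addn1.
- move=> i; rewrite size_rcons ltnS => iL; upds; rewrite /fupd nth_rcons.
  case: (eqVneq i (size L)) => [->|iN]; first by rewrite ltnn.
  have -> : i < size L by lia.
  by rewrite el h4 //; lia.
- by rewrite rcons_uniq vL.
- by move=> x; rewrite mem_rcons inE mem1.
- by move=> x; upds; rewrite /fupd ec h7 mem_rcons inE; case: eqP.
- by move=> x; rewrite mem_rcons inE => /orP[/eqP->//|/h8].
Qed.

Variable D : nat.

Record fresh (M : memory) : Prop := Fresh {
  fr_n : M 0 0 = n;
  fr_m : M 0 1 = m;
  fr_D : M 0 2 = D;
  fr_src : forall d e, e < m -> M (SRC d) e = src g d e;
  fr_ln : forall e, e < m -> M LEN e = elen g e;
  fr_zero : forall a, a \notin [:: 0; 1; 2; 3] -> forall i, M a i = 0 }.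

Lemma wp_build_graph (M : memory) : fresh M ->
  wp B build_graph M (fun s M' => [/\ s <= 19 * m + 3, agree build_mods M M', M' NE 0 = m,
    forall e, e < m -> M' WT e = 1 & exists L, linked (fun=> m) L M']).
Proof.
move=> [f1 f2 f3 f4 f5 f6].
apply: wp_seq; wset => /=; rewrite f2 //; set M0 := update _ _ _ _.
have z0 a i : a \notin [:: 0; 1; 2; 3; NE] -> M0 a i = 0.
  rewrite !inE !negb_or => /and5P[a0 a1 a2 a3 aN].
  by rewrite /M0 updN // f6 // !inE !negb_or a0 a1 a2 a3.
apply: (wp_for B_gt0 (J := fun k M1 => [/\ agree build_mods M M1, M1 NE 0 = m,
   forall e, e < k -> M1 WT e = 1 & exists L, linked (fun=> k) L M1]) (f := fun=> 17) (N := m)) => //.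
- split=> //; first by apply: agree_update => //; rewrite !inE.
  exists [::]; split=> //.
  + by move=> d x; rewrite /= z0; case: d.
  + by move=> d x; rewrite /= z0; case: d.
  + by rewrite z0.
  + by move=> x; rewrite z0.
- move=> k M1 p [ag h1 h2 [L h3]]; split; [|by upds|by move=> e ek; upds; apply: h2|].
    by apply: agree_update => //; rewrite !inE ?eqxx ?orbT.
  exists L; apply: linked_agree h3; last by apply: (agree_update (xs := [:: I1])); rewrite ?inE.
  by [].
- move=> k M1 km [ag h1 h2 [L h3]] i1.
  have s1 d : M1 (SRC d) k = src g d k by rewrite ag ?f4 //; case: d.
  apply: wp_seq; apply: wp_conseq (wp_link h3 i1 km (s1 false)) _.
  move=> t1 M2 [tl1 ag2 [L2 h32]].
  have i2 : M2 I1 0 = k by rewrite ag2.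
  have s2 : M2 (SRC true) k = src g true k by rewrite ag2 ?s1.
  have := wp_link (d := true) h32 i2 km s2 => /= lk2.
  apply: wp_seq; apply: wp_conseq lk2 _.
  move=> t2 M3 [tl2 ag3 [L3 h33]].
  have i3 : M3 I1 0 = k by rewrite ag3.
  wput => /=; first by lia.
  rewrite i3; split; upds => //; first by lia.
    by rewrite ag3 // ag2.
  split; upds => //.
  + apply: agree_update; first by rewrite !inE.
    apply: agree_trans ag _; apply: agree_trans (agree_sub _ ag2) (agree_sub _ ag3); sublist.
  + by rewrite ag3 // ag2.
  + by move=> e; rewrite ltnS /fupd; case: eqP => // eN ek; rewrite ag3 // ag2 // h2 //; lia.
  + have l3 : linked (fun=> k.+1) L3 M3.
      have -> : (fun=> k.+1) = (fun d' => if d' == true then k.+1 else if d' == false then k.+1 else k) by apply: funext => -[].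
      by [].
    exists L3; apply: linked_agree l3; last by apply: (agree_update (xs := [:: WT])); rewrite ?inE.
    by [].
move=> s M1 sl [ag h1 h2 h3]; split=> //.
by move: sl; rewrite sum_nat_const card_ord; clear; lia.
Qed.

End Prep.

Section Program.
Variables (B : nat) (g : graph) (D : nat).
Notation n := (nv g).
Notation m := (ne g).
Notation T := (D * bits n).
Notation Lm := (trunc_log 2 (10 * m)).
Hypothesis cap : capacity B g D T.
Notation fresh := (fresh g D).

Let B_gt0 : 0 < B := cap_B cap.

Lemma wp_set_parameters (M : memory) : M NE 0 = m -> M 0 0 = n -> M 0 2 = D ->
  wp B set_parameters M (fun s M' => [/\ s <= 6 * Lm + 3 * bits n + 12,
    agree [:: VV; YY; JJ; HH; TB] M M', M' HH 0 = bits Lm & M' TB 0 = T]).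
Proof.
move=> neE nE dE; have [c1 c2 c3 c4 c5 c6 c7] := cap.
have mL : 12 * m <= 12 * m * Lm.+1 by rewrite leq_pmulr.
have log_le x : trunc_log 2 x <= x.
  have [->|x0] := posnP x; first by rewrite trunc_log0.
  by apply: ltnW; apply: leq_trans (trunc_logP (isT : 1 < 2) x0); apply: ltn_expl.
have LmB : Lm <= 10 * m by apply: log_le.
have mB : 10 * m + 2 < 2 ^ B by lia.
have TltB : T < 2 ^ B by apply: leq_ltn_trans c7; apply: leq_trans (ltnW (ltn_expl _ (isT : 1 < 2))) (leq_addl _ _).
apply: wp_seq; apply: wp_conseq (wp_log_of B_gt0 (V := 10 * m) _ _) _; [by rewrite /= neE|by lia|].
move=> s1 M1 [sl1 ag1 j1].
apply: wp_seq; apply: wp_conseq (wp_log_of B_gt0 (V := Lm) _ _) _; [by rewrite /= j1|by lia|].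
move=> s2 M2 [sl2 ag2 j2].
apply: wp_seq; wset => /=; rewrite j2 addn1; first by have := log_le Lm; lia.
set M3 := update _ _ _ _.
have ag3 : agree [:: VV; YY; JJ; HH; TB] M M3.
  by apply: agree_update; [rewrite !inE ?eqxx ?orbT|apply: agree_trans (agree_sub _ ag1) (agree_sub _ ag2); sublist].
apply: wp_seq; apply: wp_conseq (wp_log_of B_gt0 (V := n) _ _) _; [by rewrite /= ag3|by lia|].
move=> s4 M4 [sl4 ag4 j4].
wset => /=; rewrite ag4 // ag3 // dE j4 addn1 //.
have := log_le Lm; rewrite /bits => l2; split.
- by move: sl1 sl2 sl4; lia.
- apply: agree_update; first by rewrite !inE ?eqxx ?orbT.
  by apply: agree_trans ag3 (agree_sub _ ag4); sublist.
- by upds; rewrite ag4 // /M3; upds.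
- by upds; rewrite addn1.
Qed.

(** The weights of a round are determined by the earlier rows, so the output table alone describes
    the whole run of the multiplicative weights method. *)
Definition good_table (t : nat) (tab : nat -> nat) : Prop := forall i, i < t ->
  good_cut g D (fun e => tab (i * m + e) != 0) (weight g (fun e => \sum_(j < i) tab (j * m + e))).

Lemma good_cut_ext (S S' : pred nat) (w w' : nat -> nat) : (forall e, e < m -> S e = S' e) -> (forall e, e < m -> w e = w' e) ->
  good_cut g D S w -> good_cut g D S' w'.
Proof.
move=> hS hw [h1 h2]; split.
  move=> x y [r1 r2]; apply: h1; split; [apply: reach_mono r1 | apply: reach_mono r2] => e em; by rewrite hS.
rewrite (eq_bigl (fun e : 'I_m => S e)); last by move=> e; rewrite hS.
rewrite [X in _ * X](eq_bigr (fun e : 'I_m => w e)); last by move=> e _; rewrite hw.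
by rewrite [X in _ <= _ * X](eq_bigr (fun e : 'I_m => w e * elen g e)) // => e _; rewrite hw.
Qed.

Lemma row_lt t i e : i < t -> e < m -> i * m + e < t * m.
Proof. by move=> it em; apply: leq_trans (_ : i.+1 * m <= _); rewrite ?leq_mul2r ?it ?orbT // mulSn addnC ltn_add2r. Qed.

Lemma good_table_succ t tab tab' : (forall j, j < t * m -> tab' j = tab j) -> good_table t tab ->
  good_cut g D (fun e => tab' (t * m + e) != 0) (weight g (fun e => \sum_(j < t) tab (j * m + e))) ->
  good_table t.+1 tab'.
Proof.
move=> old gt gc i; rewrite ltnS leq_eqVlt => /orP[/eqP ->|it].
  apply: good_cut_ext gc => // e em; rewrite /weight; congr (2 ^ (_ %/ _)).
  by apply: eq_bigr => j _; rewrite old ?row_lt.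
apply: good_cut_ext (gt i it) => e em; first by rewrite old ?row_lt.
rewrite /weight; congr (2 ^ (_ %/ _)); apply: eq_bigr => j _; rewrite old ?row_lt //.
exact: ltn_trans (ltn_ord j) it.
Qed.

Lemma round_inv_agree L0 t xs (M M' : memory) : 
  all (fun a => a \notin xs) ([:: 5; WT; RM; LAM true; LAM false; COMP; MU; NE; N0; L0A; HH] ++ static_arrays) -> 0 \notin xs ->
  agree xs M M' -> round_inv g D L0 t M -> round_inv g D L0 t M'.
Proof.
rewrite all_cat => /andP[/allP hx sx] h0 ag [r1 r2 r3 r4 r5 r6 r7 r8 r9 r10 r11 r12 r13].
have e a : a \in [:: 5; WT; RM; LAM true; LAM false; COMP; MU; NE; N0; L0A; HH] -> M' a = M a by move=> /hx; apply: ag.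
split.
- exact: static_agree ag r1.
- by rewrite ag.
- by rewrite e.
- by rewrite e.
- by rewrite e.
- by move=> i iL; rewrite e // r6.
- by move=> i im; rewrite !e // r7.
- by move=> i im; rewrite !e // r8.
- by move=> d z; rewrite e ?r9 //; case: d.
- by move=> x xL; rewrite e // r10.
- by move=> x xL; rewrite e // r11.
- by move=> j tj; rewrite e // r12.
- by move=> j; rewrite e.
Qed.

Lemma wp_rounds (M : memory) L0 : uniq L0 -> (forall x, (x \in L0) = (x < n) && (0 < dtot g x)) ->
  round_inv g D L0 0 M -> M TB 0 = T ->
  wp B (For TT TB round) M (fun s M' => [/\ s <= T * (round_bound g D * m.+1 + 2) + 2, agree (TT :: round_mods) M M',
    forall j, M' 5 j <= 1 & good_table T (M' 5)]).
Proof.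
move=> uL mL ri tE.
apply: (wp_for B_gt0 (J := fun t M1 => [/\ agree (TT :: round_mods) M M1, round_inv g D L0 t M1 & good_table t (M1 5)])
  (f := fun=> round_bound g D * m.+1) (N := T)) => //.
- move=> t M1 p [ag h1 h2]; split.
  + by apply: agree_update; first by rewrite !inE.
  + by apply: round_inv_agree h1; last by apply: (agree_update (xs := [:: TT])); rewrite ?inE.
  + by upds.
- move=> t M1 tT [ag h1 h2] tE1.
  apply: wp_conseq (wp_round cap uL mL h1 tE1 tT) _ => s M2 [sl ag2 h3 old gc].
  split=> //.
  + by rewrite ag2.
  + by rewrite ag2 // ag.
  split=> //.
  + by apply: agree_trans ag _; apply: agree_sub ag2; sublist.
  + exact: good_table_succ old h2 gc.
move=> s M1 sl [ag h1 h2]; split=> //; last exact: (ri_bool h1).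
by move: sl; rewrite sum_nat_const card_ord.
Qed.

Lemma wp_decomposition_program (M : memory) : fresh M ->
  wp B decomposition_program M (fun s M' =>
    [/\ s <= 19 * m + 6 * Lm + 3 * bits n + T * (round_bound g D * m.+1 + 2) + 20, M' 4 0 = T,
      forall j, M' 5 j <= 1 & good_table T (M' 5)]).
Proof.
move=> fr; have [f1 f2 f3 f4 f5 f6] := fr; have [c1 c2 c3 c4 c5 c6 c7] := cap.
have mL : 12 * m <= 12 * m * Lm.+1 by rewrite leq_pmulr.
have nB : n < 2 ^ B by lia.
have mB : m < 2 ^ B by lia.
apply: wp_seq; apply: wp_conseq (wp_build_graph B_gt0 nB mB fr) _.
move=> s1 M1 [sl1 ag1 ne1 wt1 [L lk]].
have e1 a : a \notin build_mods -> M1 a = M a by apply: ag1.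
apply: wp_seq; apply: wp_conseq (@wp_set_parameters M1 ne1 _ _) _; [by rewrite e1|by rewrite e1|].
move=> s2 M2 [sl2 ag2 hh2 tb2].
have [h1 h2 h3 h4 h5 h6 h7 h8] := linked_agree (xs := [:: VV; YY; JJ; HH; TB]) isT ag2 lk.
have e2 a : a \notin [:: VV; YY; JJ; HH; TB] ++ build_mods -> M2 a = M a.
  by rewrite mem_cat negb_or => /andP[p1 p2]; rewrite ag2 ?e1.
apply: wp_seq; wput => /=; rewrite tb2.
  by move=> _; apply: leq_ltn_trans c7; apply: leq_trans (ltnW (ltn_expl _ (isT : 1 < 2))) (leq_addl _ _).
set M3 := update _ _ _ _.
have e3 a : a \notin 4 :: [:: VV; YY; JJ; HH; TB] ++ build_mods -> M3 a = M a.
  by rewrite inE negb_or => /andP[p1 p2]; rewrite /M3 updN // e2.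
have e32 a : a != 4 -> M3 a = M2 a by move=> a4; rewrite /M3 updN.
have L_mem x : (x \in L) = (x < n) && (0 < dtot g x).
  rewrite h6 /dtot /degr -!/(adj_upto _ _ _ _) andbC; case: (ltnP x n) => xn; rewrite ?andbT ?andbF //.
  by apply/negbTE/negP => hx; have := h8 x; rewrite h6 hx ltnNge xn => /(_ isT).
have e3z a : a \notin [:: 0; 1; 2; 3] ++ 4 :: [:: VV; YY; JJ; HH; TB] ++ build_mods -> forall i, M3 a i = 0.
  by rewrite mem_cat negb_or => /andP[p1 p2] i; rewrite e3 // f6.
have ri : round_inv g D L 0 M3.
  split.
  + split.
    - by rewrite e3.
    - by move=> d e em; rewrite e3 ?f4 //; case: d.
    - by move=> e em; rewrite e3 // f5.
    - by move=> d x xn; rewrite !e32 //; case: d.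
    - by move=> d x xn; rewrite !e32 //; case: d.
  + by rewrite e3.
  + by rewrite e32.
  + by rewrite e32 // ag2.
  + by rewrite e32.
  + by move=> i iL; rewrite e32 // h4.
  + by move=> e em; rewrite e32 // ag2 // wt1 // /weight big_ord0 div0n.
  + by move=> e em; rewrite e3z // big_ord0 mod0n.
  + by move=> d z; rewrite e3z //; case: d.
  + by move=> x /negbTE xL; rewrite e32 // h7 xL.
  + by move=> x xL; rewrite e3z.
  + by move=> j _; rewrite e3z.
  + by move=> j; rewrite e3z.
apply: wp_conseq (wp_rounds h5 L_mem ri _) _; first by rewrite e32.
move=> s4 M4 [sl4 ag4 b4 g4]; split=> //.
- by move: sl1 sl2 sl4; clear; lia.
- by rewrite ag4 // /M3; upds.
Qed.

End Program.

Import Order.TTheory GRing.Theory Num.Theory.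

(** * Directed graphs as instances *)

Section Instance.
Variables (n : nat) (G : digraph 'I_n) (es : seq ('I_n * 'I_n)).
Hypothesis es_edges : edge_listing G es.

Definition endpoint (d : bool) (e : 'I_n * 'I_n) : 'I_n := if d then e.2 else e.1.

Definition source d i := nth 0 [seq val (endpoint d e) | e <- es] i.
Definition edge_length i := nth 0 [seq len G e | e <- es] i.

Lemma source_lt d i : i < size es -> source d i < n.
Proof.
move=> ie; have /mapP[e _] : source d i \in [seq val (endpoint d e) | e <- es] by rewrite mem_nth ?size_map.
by move=> ->; apply: ltn_ord.
Qed.

Lemma edge_length_gt0 i : i < size es -> 0 < edge_length i.
Proof.
move=> ie; have /mapP[e ees ->] : edge_length i \in [seq len G e | e <- es] by rewrite mem_nth ?size_map.
by apply: (@len_gt0 _ G); rewrite -es_edges.2.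
Qed.

Definition instance : graph := Graph source_lt edge_length_gt0.

Lemma source_nth d i e : i < size es -> nth e es i = e -> source d i = endpoint d e.
Proof. by move=> ie ee; rewrite /source (nth_map e) // ee. Qed.

Lemma edge_length_nth i e : i < size es -> nth e es i = e -> edge_length i = len G e.
Proof. by move=> ie ee; rewrite /edge_length (nth_map e) // ee. Qed.

Lemma edge_of i : i < size es -> exists2 e, e \in es & nth e es i = e /\ index e es = i.
Proof.
move=> ie; case: (es) ie es_edges.1 => [//|e0 es'] ie u.
exists (nth e0 (e0 :: es') i); first exact: mem_nth.
by split; [apply: set_nth_default | rewrite index_uniq].
Qed.

Lemma walk_len_cons u v p : walk_len G u (v :: p) = len G (u, v) + walk_len G v p.
Proof. by rewrite /walk_len /= big_cons. Qed.

Lemma walk_len_cat u p q : walk_len G u (p ++ q) = walk_len G u p + walk_len G (last u p) q.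
Proof.
elim: p u => [|v p IH] u; first by rewrite /walk_len big_nil.
by rewrite cat_cons !walk_len_cons IH addnA.
Qed.

Definition route (u v : 'I_n) l := exists p, [/\ path (edge_rel (edges G)) u p, last u p = v & walk_len G u p = l].

Lemma route_cat u v w l l' : route u v l -> route v w l' -> route u w (l + l').
Proof.
case=> p [pp <- <-] [q [pq <- <-]]; exists (p ++ q).
by rewrite cat_path pp last_cat walk_len_cat.
Qed.

Lemma route_edge e : e \in es -> route e.1 e.2 (len G e).
Proof.
move=> ees; exists [:: e.2]; split=> //=; first by rewrite /edge_rel -surjective_pairing -es_edges.2 ees.
by rewrite walk_len_cons -surjective_pairing /walk_len big_nil addn0.
Qed.

Lemma route_nil u : route u u 0.
Proof. by exists [::]; split=> //; rewrite /walk_len big_nil. Qed.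

Lemma walk_route d a x l (v : 'I_n) : walk instance d a x l -> val v = a ->
  exists2 u : 'I_n, val u = x & if d then route u v l else route v u l.
Proof.
elim=> {a x l} [a|a i l /= ie _ IH] va; first by exists v => //; case: (d); apply: route_nil.
have [u uE hu] := IH va; have [e ees [ne _]] := edge_of ie.
rewrite (edge_length_nth ie ne) (source_nth (~~ d) ie ne).
rewrite (source_nth d ie ne) in uE; move/val_inj: uE hu => -> hu.
exists (endpoint (~~ d) e) => //; have re := route_edge ees.
by case: (d) hu => /= hu; [rewrite addnC; apply: route_cat re hu | apply: route_cat hu re].
Qed.

(** The route passes through the centre of the core, and each half has length at most [D / 2]. *)
Lemma core_route D C (x y : 'I_n) : core instance D C -> C x -> C y -> exists2 l, route x y l & (l <= D)%N.
Proof.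
case=> v hv Cx Cy; have [l1 w1 h1] := hv x Cx true; have [l2 w2 h2] := hv y Cy false.
(* That the centre is a vertex follows by tracing a walk back from [x]. *)
have vn : v < n.
  have : forall d a x l, walk instance d a x l -> x < n -> a < n.
    move=> d a x' l; elim=> {a x' l} // a i l /= ie _ IH _; apply: IH; exact: source_lt.
  by apply; [exact: w1 | exact: ltn_ord].
have [u1 e1 r1] := walk_route (v := Ordinal vn) w1 (erefl _).
have [u2 e2 r2] := walk_route (v := Ordinal vn) w2 (erefl _).
move/val_inj: e1 r1 => -> r1; move/val_inj: e2 r2 => -> r2.
by exists (l1 + l2); [apply: route_cat r1 r2 | lia].
Qed.

Lemma dist_le (R : realType) (x y : 'I_n) l : route x y l -> (dist R G x y <= l%:R%:E)%E.
Proof. by case=> p [h1 h2 <-]; apply: ereal_inf_lbound; exists p. Qed.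

Variable tab : nat -> nat.

Definition row_set i : {set 'I_n * 'I_n} := [set e in es | tab (i * size es + index e es) != 0].

Lemma row_set_sub i : row_set i \subset edges G.
Proof. by apply/fintype.subsetP => e; rewrite inE => /andP[ees _]; rewrite -es_edges.2. Qed.

Lemma connect_reach i (x y : 'I_n) : connect (edge_rel (edges G :\: row_set i)) x y ->
  reach instance (fun e => tab (i * size es + e) != 0) x y.
Proof.
case/connectP => p; elim/last_ind: p y => [|p z IH] y; first by move=> _ ->; apply: reach_refl.
rewrite rcons_path last_rcons => /andP[pp ez] ->.
have r := IH _ pp (erefl _); move: ez; rewrite /edge_rel !inE => /andP[].
set e := (_, _) => cut; rewrite -es_edges.2 => ees.
have ie : index e es < size es by rewrite index_mem.
have en : nth e es (index e es) = e by rewrite nth_index.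
have -> : (z : nat) = src instance true (index e es) by rewrite /= (source_nth true ie en).
apply: reach_step => //; first by move: cut; rewrite ees.
by rewrite /= (source_nth false ie en).
Qed.

Lemma row_set_diameter (R : realType) D w i (x y : 'I_n) :
  good_cut instance D (fun e => tab (i * size es + e) != 0) w ->
  same_scc (edges G :\: row_set i) x y -> (dist R G x y <= D%:R%:E)%E /\ (dist R G y x <= D%:R%:E)%E.
Proof.
case=> hS _ /andP[/connect_reach rxy /connect_reach ryx].
have le u v l : route u v l -> (l <= D)%N -> (dist R G u v <= D%:R%:E)%E.
  by move=> /(dist_le R) h lD; apply: le_trans h _; rewrite lee_fin ler_nat.
case: (hS x y (conj rxy ryx)) => [/val_inj ->|[C hC /andP[Cx Cy]]].
  by split; apply: (le _ _ 0%N) => //; apply: route_nil.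
have [l1 r1 h1] := core_route hC Cx Cy; have [l2 r2 h2] := core_route hC Cy Cx.
by split; [apply: le r1 h1 | apply: le r2 h2].
Qed.

Lemma input_fresh (R : realType) (D : R) : fresh instance (Num.truncn D) (input G D es).
Proof.
split=> //.
- by move=> d e em; rewrite /input /dirv /=; case: d.
- by case=> [|[|[|[|a]]]] // _ i; rewrite /input nth_nil.
Qed.

Lemma row_set_outputs T M : M 5 = tab -> (forall j, tab j <= 1) -> M 4 0 = T ->
  outputs es [seq row_set i | i <- iota 0 T] M.
Proof.
move=> m5 t1 m4; split; first by rewrite size_map size_iota.
move=> i e; rewrite size_map size_iota => iT ees.
rewrite (nth_map 0%N) ?size_iota // nth_iota // add0n inE ees /= m5.
by have := t1 (i * size es + index e es); case: (tab _) => [|[|]].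
Qed.

End Instance.

(** * Numbers of cuts *)

Section Potential.
Variables (g : graph) (D L T : nat) (tab : nat -> nat).
Notation m := (ne g).
Hypothesis tab_le1 : forall j, tab j <= 1.

Definition cuts t e := \sum_(j < t) tab (j * m + e).
Definition potential t := \sum_(e < m) weight g (cuts t) e * (elen g e + cuts t e %% elen g e).

(** Without a wrap-around of the remainder the term of a cut edge grows by its weight [w]; with one,
    [2 * w * l = w * (l + (l - 1)) + w]. *)
Lemma potential_succ t : potential t.+1 = potential t + \sum_(e < m | tab (t * m + e) != 0) weight g (cuts t) e.
Proof.
rewrite /potential [X in _ = _ + X]big_mkcond -big_split; apply: eq_bigr => e _ /=.
have e0 := elen_gt0 (ltn_ord e); rewrite /weight.
have -> : cuts t.+1 e = cuts t e + tab (t * m + e) by rewrite /cuts big_ord_recr.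
have := tab_le1 (t * m + e); case: (tab _) => [|[|//]] _ /=; first by rewrite !addn0.
rewrite addn1; have := divmod_succ (cuts t e) e0; have lt := ltn_pmod (cuts t e) e0.
case: eqP => h [-> ->]; last by rewrite addnS mulnS addnC.
by rewrite expnS addn0 -{2}h mulnDr mulnS -mulnA; lia.
Qed.

Hypothesis tab_cheap : forall t, t < T ->
  D * \sum_(e < m | tab (t * m + e) != 0) weight g (cuts t) e <= L * \sum_(e < m) weight g (cuts t) e * elen g e.

(** The growth by at most [1 + L / D] per round, cleared of denominators. *)
Lemma potential_le t : t <= T -> D ^ t * potential t <= (D + L) ^ t * \sum_(e < m) elen g e.
Proof.
elim: t => [|t IH] tT.
  rewrite !expn0 !mul1n; apply: leq_sum => e _.
  by rewrite /cuts /weight big_ord0 div0n mod0n addn0 mul1n.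
have h : D * potential t.+1 <= (D + L) * potential t.
  rewrite potential_succ mulnDr mulnDl leq_add2l; apply: leq_trans (tab_cheap tT) _.
  by rewrite leq_mul2l; apply/orP; right; apply: leq_sum => e _; rewrite leq_mul2l leq_addr orbT.
rewrite !expnS -mulnA [D ^ t * _]mulnC mulnA mulnC.
apply: leq_trans (_ : D ^ t * ((D + L) * potential t) <= _); first by rewrite leq_mul2l h orbT.
by rewrite mulnCA -mulnA leq_mul2l IH ?orbT // ltnW.
Qed.

(** A single term of the potential is at least [2 ^ (c / l)]. The [D * Lam] rounds multiply the
    potential by at most [(4 ^ L) ^ Lam], and [Sigma] bounds the logarithm of its initial value. The
    [.+1] accounts for the remainder of [c] modulo [l]. *)
Lemma cuts_le Sigma Lam e : 0 < D -> T = D * Lam -> (D + L) ^ D <= 4 ^ L * D ^ D ->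
  \sum_(e < m) elen g e <= 2 ^ Sigma -> e < m ->
  cuts T e <= elen g e * (2 * L * Lam + Sigma).+1.
Proof.
move=> D0 TE hD hS em; have l0 := elen_gt0 em.
have hp : 2 ^ (cuts T e %/ elen g e) <= potential T.
  rewrite /potential (bigD1 (Ordinal em)) //=; apply: leq_trans (leq_addr _ _).
  by rewrite -[X in X <= _]muln1 leq_mul2l /= addn_gt0 l0 orbT.
have : D ^ T * 2 ^ (cuts T e %/ elen g e) <= D ^ T * 2 ^ (2 * L * Lam + Sigma).
  apply: leq_trans (_ : D ^ T * potential T <= _); first by rewrite leq_mul2l hp orbT.
  apply: leq_trans (potential_le (leqnn T)) _.
  rewrite expnD mulnA; apply: leq_mul hS.
  rewrite TE !expnM; apply: leq_trans (_ : (4 ^ L * D ^ D) ^ Lam <= _); first by case: (Lam) => // l; rewrite leq_exp2r.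
  by rewrite expnMn mulnC -[2 ^ 2]/4.
rewrite leq_pmul2l ?expn_gt0 ?D0 // leq_exp2l // => hq.
rewrite {1}(divn_eq (cuts T e) (elen g e)) mulnS addnC; apply: leq_add; first by rewrite ltnW // ltn_pmod.
by rewrite mulnC leq_mul2l hq orbT.
Qed.

End Potential.

(** * Polynomial sizes and the word length *)

Lemma bitsD x k : bits (2 ^ k * x) <= bits x + k.
Proof.
rewrite /bits addSn ltnS; have [->|x0] := posnP x; first by rewrite muln0 trunc_log0.
elim: k => [|k IH]; first by rewrite mul1n addn0.
by rewrite expnS -mulnA trunc_logMp // ?muln_gt0 ?expn_gt0 ?x0 // addnS ltnS.
Qed.

Section Sizes.
Variables (g : graph) (a b D : nat).
Notation n := (nv g).
Notation m := (ne g).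
Notation Lm := (trunc_log 2 (10 * m)).
Hypothesis m_le : m <= n * n.
Hypothesis ln_le : forall e, e < m -> elen g e <= a * n ^ b.
Let Lam := bits n.

Lemma m_le_exp : m <= 2 ^ (2 * Lam).
Proof.
apply: leq_trans m_le _; rewrite mul2n -addnn expnD; apply: leq_mul; exact: ltnW (ltn_bits n).
Qed.

(** [10 * m < 2 ^ (2 * Lam + 4)], and [Lam] is at least 1. *)
Lemma Lm_le : Lm < 6 * Lam.
Proof.
rewrite ltnNge; apply/negP => h.
have [m0|m0] := posnP m; first by rewrite m0 trunc_log0 in h; rewrite /Lam /bits in h; lia.
have := trunc_logP (isT : 1 < 2) (_ : 0 < 10 * m); rewrite muln_gt0 m0 => /(_ isT).
rewrite leqNgt => /negP; apply; apply: leq_trans (_ : 2 ^ (2 * Lam + 4) <= _); last first.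
  by rewrite leq_exp2l //; apply: leq_trans h; rewrite /Lam /bits; lia.
by rewrite expnD; have := m_le_exp; lia.
Qed.

Lemma bits_Lm : bits Lm <= 4 * bits Lam.
Proof.
apply: leq_trans (_ : bits (2 ^ 3 * Lam) <= _).
  by rewrite /bits ltnS; apply: leq_trunc_log; have := Lm_le; lia.
by apply: leq_trans (bitsD _ _) _; rewrite /bits; lia.
Qed.

Lemma sum_ln : \sum_(e < m) elen g e <= 2 ^ (a + (b + 2) * Lam).
Proof.
apply: leq_trans (_ : \sum_(e < m) a * n ^ b <= _); first by apply: leq_sum => e _; apply: ln_le.
rewrite sum_nat_const card_ord; have nl : n <= 2 ^ Lam := ltnW (ltn_bits n).
apply: leq_trans (_ : (2 ^ (2 * Lam)) * (2 ^ a * (2 ^ Lam) ^ b) <= _); last first.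
  by rewrite -expnM -!expnD leq_exp2l //; lia.
apply: leq_mul m_le_exp _; apply: leq_mul; first exact: ltnW (ltn_expl _ _).
by case: (b) => // b'; rewrite leq_exp2r.
Qed.

Lemma m_le_sum : m <= \sum_(e < m) elen g e.
Proof. by rewrite -[X in X <= _]card_ord -sum1_card; apply: leq_sum => e _; apply: elen_gt0. Qed.

Hypothesis D_gt0 : 0 < D.

(** [D * Lam] bits for the weights, [a + (b + 2) * Lam] for the sum of the lengths, [2 * Lam] for
    numbers polynomial in [n], and 8 for constant factors. *)
Definition word_size := D * Lam + a + (b + 4) * Lam + 8.

Lemma word_capacity : capacity word_size g D (D * Lam).
Proof.
set B := word_size; set T := D * Lam; set s := a + (b + 2) * Lam.
have Lam0 : 0 < Lam by [].
have DT : D <= T by rewrite leq_pmulr.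
have BE : B = T + s + 2 * Lam + 8 by rewrite /B /word_size -/T /s; lia.
have x1 : 2 ^ B = 256 * (2 ^ T * 2 ^ s * 2 ^ (2 * Lam)) by rewrite BE !expnD -[2 ^ 8]/256; lia.
have [t1 s1 l1] : [/\ 0 < 2 ^ T, 0 < 2 ^ s & 0 < 2 ^ (2 * Lam)] by rewrite !expn_gt0.
have Dl : D < 2 ^ T by apply: leq_ltn_trans DT (ltn_expl _ _).
have p1 : 2 ^ T * 2 ^ s <= 2 ^ T * 2 ^ s * 2 ^ (2 * Lam) by rewrite leq_pmulr.
have p2 : 2 ^ T <= 2 ^ T * 2 ^ s by rewrite leq_pmulr.
have p3 : 2 ^ s <= 2 ^ T * 2 ^ s by rewrite leq_pmull.
have sl := sum_ln; rewrite -/s in sl.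
split.
- by rewrite BE addnS.
- by [].
- by rewrite x1; lia.
- move=> e em; have : elen g e <= 2 ^ s.
    by apply: leq_trans sl; rewrite (bigD1 (Ordinal em)) //= leq_addr.
  by rewrite x1; lia.
- rewrite -big_distrr /= x1.
  have : 2 ^ T * (\sum_(e < m) elen g e) <= 2 ^ T * 2 ^ s by rewrite leq_mul2l sl orbT.
  by move: p1 p2 t1; move: (2 ^ T) (2 ^ T * 2 ^ s) (2 ^ T * 2 ^ s * 2 ^ (2 * Lam)) (2 ^ T * \sum_(e < m) elen g e); clear; lia.
- have n1 : n < 2 ^ Lam := ltn_bits n.
  have n2 : 2 ^ Lam <= 2 ^ (2 * Lam) by rewrite leq_exp2l //; lia.
  have Lm1 : 12 * m * Lm.+1 <= 72 * (m * Lam) by have := Lm_le; nia.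
  have mS : m <= 2 ^ s := leq_trans m_le_sum sl.
  have L2 : Lam <= 2 ^ T by apply: leq_trans (ltnW (ltn_expl Lam (isT : 1 < 2))) _; rewrite leq_exp2l // leq_pmull.
  have : m * Lam <= 2 ^ T * 2 ^ s by rewrite mulnC leq_mul.
  have p4 : 2 ^ (2 * Lam) <= 2 ^ T * 2 ^ s * 2 ^ (2 * Lam) by rewrite leq_pmull // muln_gt0 t1.
  by rewrite x1; lia.
- have : T * m <= 2 ^ T * 2 ^ s.
    by apply: leq_mul; [apply: ltnW (ltn_expl _ _) | apply: leq_trans m_le_sum sl].
  by rewrite x1; lia.
Qed.

Lemma word_size_le : word_size <= D * Lam * (a + b + 13).
Proof.
clear m_le ln_le.
have Lam0 : 0 < Lam by []; have : Lam <= D * Lam by rewrite leq_pmull.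
have : 0 < D * Lam by rewrite muln_gt0 D_gt0.
rewrite /word_size; move: (D * Lam) => X; nia.
Qed.

(** There are [D * Lam] rounds. In a round, an edge is charged once per level, each time with about
    [D] radii and a logarithm to compute, which makes another [D * Lam ^ 2]. *)
Lemma steps_le s : s <= 19 * m + 6 * Lm + 3 * Lam + D * Lam * (round_bound g D * m.+1 + 2) + 20 ->
  s <= 50 * 1000 * 1000 * (m.+1 * (D ^ 2 * Lam ^ 3)).
Proof.
have Lam0 : 0 < Lam by []; have hL := Lm_le.
have K2E : explore_bound D Lm <= 410 * (D.+1 * Lm.+1).
  have -> : 410 * (D.+1 * Lm.+1) = (2 * D + 2) * (205 * Lm.+1) by lia.
  by rewrite leq_mul2l /step_bound; apply/orP; right; lia.
have K7E : round_bound g D <= 40 * 1000 * 1000 * (D * (Lam * Lam)).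
  have h1 : process_bound D Lm <= 10 * 541 * (D.+1 * Lm.+1) by rewrite /process_bound; move: K2E; lia.
  have h2 : D.+1 * Lm.+1 <= 2 * D * (6 * Lam) by apply: leq_mul; lia.
  rewrite /round_bound; apply: leq_trans (_ : 100 * (10 * 541 * (2 * D * (6 * Lam))) * (6 * Lam) <= _); last by lia.
  by apply: leq_mul => //; rewrite leq_mul2l; lia.
move=> hs; apply: leq_trans hs _.
have DL : 0 < D * Lam by rewrite muln_gt0 D_gt0.
have Y : D * Lam <= D * Lam * (D * (Lam * Lam)) by rewrite leq_pmulr // !muln_gt0 D_gt0.
have YE : D ^ 2 * Lam ^ 3 = D * Lam * (D * (Lam * Lam)) by rewrite !expnS expn0; lia.
have h3 : D * Lam * (round_bound g D * m.+1) <= 40 * 1000 * 1000 * (m.+1 * (D ^ 2 * Lam ^ 3)).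
  rewrite YE; apply: leq_trans (_ : D * Lam * (40 * 1000 * 1000 * (D * (Lam * Lam)) * m.+1) <= _); last by lia.
  by rewrite leq_mul2l leq_mul2r K7E !orbT.
have h4 : D * Lam <= D ^ 2 * Lam ^ 3 by rewrite YE.
have h5 : Lam <= D * Lam by rewrite leq_pmull.
have h6 : D ^ 2 * Lam ^ 3 <= m.+1 * (D ^ 2 * Lam ^ 3) by rewrite leq_pmull.
have h7 : m.+1 <= m.+1 * (D ^ 2 * Lam ^ 3) by rewrite leq_pmulr // YE !muln_gt0 D_gt0.
by move: h3 h4 h5 h6 h7 hL Lam0; move: (D ^ 2 * Lam ^ 3) => Z; rewrite mulnDr; lia.
Qed.

End Sizes.

(** * Estimates of logarithms *)

Local Open Scope ring_scope.

Section Logarithms.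
Variable R : realType.

(** Inverting [expR (- 1 / 2) >= 1 - 1 / 2]. *)
Lemma expR_half : expR (2^-1 : R) <= 2.
Proof.
have := expR_ge1Dx (- 2^-1 : R); rewrite expRN => h.
by rewrite -[expR _]invrK -[X in _ <= X]invrK lef_pV2 ?posrE ?invr_gt0 ?expR_gt0 //; lra.
Qed.

Lemma ln2_ge : 2^-1 <= ln 2 :> R.
Proof. by rewrite -[X in X <= _]expRK ler_ln ?posrE ?expR_gt0 ?expR_half. Qed.

Lemma expR1_le4 : expR 1 <= 4 :> R.
Proof.
have e1 : expR 1 = expR (2^-1) ^+ 2 :> R by rewrite -expRM_natr; congr expR; field.
rewrite e1; apply: le_trans (_ : 2 ^+ 2 <= _); last by lra.
by rewrite lerXn2r ?nnegrE ?expR_ge0 ?expR_half.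
Qed.

(** An inequality of natural numbers, proved by [(1 + L / D) ^ D <= e ^ L] and [e <= 4]. *)
Lemma expn_add_le (D L : nat) : (0 < D)%N -> ((D + L) ^ D <= 4 ^ L * D ^ D)%N.
Proof.
move=> D0; rewrite -(ler_nat R) natrM !natrX natrD.
have D0' : 0 < D%:R :> R by rewrite ltr0n.
have -> : D%:R + L%:R = (1 + L%:R / D%:R) * D%:R :> R by field; rewrite gt_eqF.
rewrite exprMn ler_pM2r ?exprn_gt0 //.
apply: le_trans (_ : expR (L%:R / D%:R) ^+ D <= _).
  by rewrite lerXn2r ?nnegrE ?expR_ge0 ?expR_ge1Dx // addr_ge0 // divr_ge0.
rewrite -expRM_natr mulfVK ?gt_eqF // -[L%:R]mul1r expRM_natr lerXn2r ?nnegrE ?expR_ge0 //.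
exact: expR1_le4.
Qed.

Lemma bits_le_ln k : (0 < k)%N -> (bits k)%:R <= 2 * ln k%:R + 1 :> R.
Proof.
move=> k0; rewrite /bits -natr1 lerD2r.
have := trunc_logP (isT : (1 < 2)%N) k0; rewrite -(ler_nat R) natrX => h.
have : ln (2 ^+ trunc_log 2 k) <= ln k%:R :> R by rewrite ler_ln ?posrE ?exprn_gt0 ?ltr0n.
rewrite lnXn // -[ln 2 *+ _]mulr_natr => h2.
have : 2^-1 * (trunc_log 2 k)%:R <= ln 2 * (trunc_log 2 k)%:R :> R by rewrite ler_wpM2r ?ln2_ge.
lra.
Qed.

Lemma log_ge1 n : 1 <= log R n.
Proof. by rewrite /log le_max lexx. Qed.

Lemma loglog_ge1 n : 1 <= loglog R n.
Proof. by rewrite /loglog le_max lexx. Qed.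

Lemma bits_le_log n : (bits n)%:R <= 3 * log R n.
Proof.
have h1 := log_ge1 n; have [->|n0] := posnP n.
  have := log_ge1 0; rewrite /bits trunc_log0; lra.
have : ln n%:R <= log R n by rewrite /log le_max lexx orbT.
by have := bits_le_ln n0; lra.
Qed.

(** The bound is [2 * (ln 3 + loglog) + 1], where [ln 3 <= 2] and [1 <= loglog]. *)
Lemma bits_bits_le_loglog n : (bits (bits n))%:R <= 7 * loglog R n.
Proof.
have h1 := loglog_ge1 n; have l0 : 0 < log R n by apply: lt_le_trans (log_ge1 n).
have := @bits_le_ln (bits n) isT.
have : ln (bits n)%:R <= ln (3 * log R n) :> R.
  by rewrite ler_ln ?posrE ?ltr0n ?mulr_gt0 // bits_le_log.
have h : ln (log R n) <= loglog R n by rewrite /loglog le_max lexx orbT.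
have h3 : ln 3 <= 2 :> R by have := @le_ln1Dx R 2; rewrite -[1 + 2]/(1 + 2%:R) -natr1; apply; lra.
rewrite lnM ?posrE //; lra.
Qed.

End Logarithms.

Lemma sum_count_mem (T : finType) (P : pred T) (s : seq T) :
  (\sum_(x | P x) count_mem x s = count P s)%N.
Proof.
elim: s => [|y s IH] /=; first by rewrite big1.
rewrite big_split /= IH; congr addn; case: (boolP (P y)) => Py.
  rewrite (bigD1 y) //= eqxx big1 // => x /andP[_ xy]; by rewrite eq_sym (negbTE xy).
by rewrite big1 // => x Px; case: eqP Px Py => [->|//] ->.
Qed.

(** * Loss, support and running time *)

Section Uniform.
Variables (R : realType) (T : finType) (s : seq T).
Hypothesis s_gt0 : (0 < size s)%N.

Lemma sum_uniform_on (P : pred T) : \sum_(x | P x) uniform_on R s x = (count P s)%:R / (size s)%:R.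
Proof. by rewrite -mulr_suml -natr_sum sum_count_mem. Qed.

Lemma uniform_on_distr : is_distr (uniform_on R s).
Proof.
split=> [x|]; first by rewrite divr_ge0.
by rewrite sum_uniform_on count_predT divff // pnatr_eq0 -lt0n.
Qed.

Lemma mem_supp_uniform_on x : (x \in supp (uniform_on R s)) = (x \in s).
Proof.
rewrite -topredE /= /supp /uniform_on mulf_eq0 invr_eq0 !pnatr_eq0 negb_or -!lt0n s_gt0 andbT.
by rewrite -has_count has_pred1.
Qed.

Lemma card_supp_uniform_on : (#|supp (uniform_on R s)| <= size s)%N.
Proof.
apply: leq_trans (card_size s); apply: subset_leq_card.
by apply/fintype.subsetP => x; rewrite mem_supp_uniform_on.
Qed.

End Uniform.

Section Bounded_input.
Variables (R : realType) (n : nat) (G : digraph 'I_n) (es : seq ('I_n * 'I_n)) (D : R).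
Hypothesis es_edges : edge_listing G es.

Lemma input_bounded B T : capacity B (instance es_edges) (Num.truncn D) T -> bounded B (input G D es).
Proof.
case=> c1 c2 c3 c4 c5 c6 c7; have B0 := expn_gt0 2 B.
have mL : (12 * size es <= 12 * size es * (trunc_log 2 (10 * size es)).+1)%N by rewrite leq_pmulr.
rewrite /= in c4 c5 c6 c7.
have hs s j : (forall x, x \in s -> x < 2 ^ B)%N -> (nth 0%N s j < 2 ^ B)%N.
  by move=> h; case: (ltnP j (size s)) => js; [apply: h; rewrite mem_nth | rewrite nth_default].
have nB : (n < 2 ^ B)%N by lia.
move=> a j; apply: hs => x; case: a => [|[|[|[|a]]]] //=.
- by rewrite !inE => /or3P[] /eqP ->; lia.
- by case/mapP => e _ ->; apply: ltn_trans nB.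
- by case/mapP => e _ ->; apply: ltn_trans nB.
case/mapP => e ees ->; have ie : (index e es < size es)%N by rewrite index_mem.
have := c4 _ ie; rewrite (edge_length_nth G ie (e := e)) ?nth_index //; lia.
Qed.

End Bounded_input.

Section Decomposition.
Variables (R : realType) (a b n : nat) (G : digraph 'I_n) (D : R) (es : seq ('I_n * 'I_n)).
Hypothesis len_le : forall e, e \in edges G -> (len G e <= a * n ^ b)%N.
Hypothesis D_ge1 : 1 <= D.
Hypothesis es_edges : edge_listing G es.
Notation m := (size es).
Notation g := (instance es_edges).
Notation D' := (Num.truncn D).
Notation T := (D' * bits n)%N.

(** The cost of a step per bit, the constant of the word length and the constant of the number of
    steps. *)
Definition time_factor : nat := (cmd_size decomposition_program * (a + b + 13) * (50 * 1000 * 1000))%N.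

Let D'_gt0 : (0 < D')%N.
Proof. by rewrite truncn_gt0. Qed.

Let m_le : (m <= n * n)%N.
Proof.
have [u _] := es_edges; rewrite -(card_uniqP u) -[in X in (_ <= X)%N](card_ord n) -card_prod.
exact: max_card.
Qed.

Let elen_le e : (e < m)%N -> (elen g e <= a * n ^ b)%N.
Proof.
move=> em; have [x xes [xe _]] := edge_of es_edges em.
by rewrite /= (edge_length_nth G em xe); apply: len_le; rewrite -es_edges.2.
Qed.

Lemma decomposition_output : exists t M, [/\ exec decomposition_program (input G D es) t M,
  (t <= time_factor * (m.+1 * D' ^ 3 * bits n ^ 4))%N,
  M 4 0 = T, forall j, (M 5 j <= 1)%N & good_table g D' T (M 5)].
Proof.
have cap := @word_capacity g a b D' m_le elen_le D'_gt0.
have [s [t [M [ex tl bM [sl M4 M5 gt]]]]] :=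
  wp_decomposition_program cap (input_fresh es_edges D) (input_bounded cap).
exists t, M; split=> //; apply: leq_trans tl _.
have hs := steps_le (g := g) m_le D'_gt0 sl.
have hw := word_size_le g a b D'_gt0.
apply: leq_trans (_ : cmd_size decomposition_program * (D' * bits n * (a + b + 13)) *
    (50 * 1000 * 1000 * (m.+1 * (D' ^ 2 * bits n ^ 3))) <= _)%N.
  by apply: leq_mul hs; apply: leq_mul hw; apply: leqnn.
rewrite /time_factor; move: (cmd_size _) (a + b + 13)%N (bits n) => x y z.
by rewrite !expnS; lia.
Qed.

Variable tab : nat -> nat.
Hypothesis tab_le1 : forall j, (tab j <= 1)%N.
Hypothesis tab_good : good_table g D' T tab.

Notation sets := [seq row_set es tab i | i <- iota 0 T].

Lemma size_sets : size sets = T.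
Proof. by rewrite size_map size_iota. Qed.

Lemma count_sets e : e \in es -> count (fun S : {set _} => e \in S) sets = cuts g tab T (index e es).
Proof.
move=> ees; rewrite count_map /cuts -sum1_count big_mkcond /= -[X in iota 0 X]subn0 big_mkord.
apply: eq_bigr => i _; rewrite /= inE ees /=.
by have := tab_le1 (i * m + index e es); case: (tab _) => [|[|]].
Qed.

(** In [cuts_le], [L] is [48 * bits Lm * Lm], where [bits Lm * Lm] is at most 24 times
    [bits n * bits (bits n)]. So [2 * L * Lam] contributes [2 * 48 * 24 = 2304], and [Sigma.+1]
    contributes [a + b + 3]. *)
Lemma cuts_bound e : e \in es ->
  (cuts g tab T (index e es) <= len G e * (bits n * ((2307 + a + b) * (bits n * bits (bits n)))))%N.
Proof.
move=> ees; have ie : (index e es < m)%N by rewrite index_mem.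
set Lm := trunc_log 2 (10 * m).
have cheap t : (t < T)%N -> (D' * \sum_(e < m | tab (t * m + e) != 0%N) weight g (cuts g tab t) e <=
    48 * bits Lm * Lm * \sum_(e < m) weight g (cuts g tab t) e * elen g e)%N.
  by move=> tT; have [_] := tab_good tT.
have := cuts_le (g := g) tab_le1 cheap D'_gt0 (erefl T) (expn_add_le R _ D'_gt0) (sum_ln (g := g) m_le elen_le) ie.
rewrite [elen g _]/= (edge_length_nth G ie (e := e)) ?nth_index // => h; apply: leq_trans h _.
rewrite leq_mul2l; apply/orP; right.
have h1 := Lm_le (g := g) m_le; have h2 := bits_Lm (g := g) m_le; rewrite -/Lm /= in h1 h2.
have h3 : (bits Lm * Lm <= 4 * bits (bits n) * (6 * bits n))%N by apply: leq_mul => //; apply: ltnW.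
move: h3; have [l0 l1] : (0 < bits n)%N /\ (0 < bits (bits n))%N by [].
move: (bits Lm * Lm)%N (mulnA 48 (bits Lm) Lm) (bits n) (bits (bits n)) l0 l1 => X <- y z y0 z0 hX.
have hy : (y <= y * (y * z))%N by rewrite leq_pmulr // muln_gt0 y0.
have hX2 : (X * y <= 24 * (y * (y * z)))%N.
  apply: leq_trans (_ : 4 * z * (6 * y) * y <= _)%N; first by rewrite leq_mul2r hX orbT.
  by lia.
have hab : ((a + b + 3) * y <= (a + b + 3) * (y * (y * z)))%N by rewrite leq_mul2l hy orbT.
have ha : (a <= a * y)%N by rewrite leq_pmulr.
by move: hX2 hab ha y0; clear; lia.
Qed.

(** One factor [bits n] of the number of cuts cancels against the number of rounds. 42 is 2 * 3 * 7:
    rounding [D] down costs a factor 2, and 3 and 7 come from comparing [bits n] and [bits (bits n)]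
    with the logarithms. *)
Lemma row_sets_LDD : is_LDD G D ((42 * (2307 + a + b))%:R * (log R n * loglog R n)) (uniform_on R sets).
Proof.
have D0 : 0 < D by apply: lt_le_trans D_ge1.
have T0 : (0 < size sets)%N by rewrite size_sets muln_gt0 D'_gt0.
have sets_row S : S \in supp (uniform_on R sets) -> exists2 i, (i < T)%N & S = row_set es tab i.
  by rewrite mem_supp_uniform_on // => /mapP[i]; rewrite mem_iota => iT ->; exists i.
split.
- exact: uniform_on_distr.
- by move=> S /sets_row[i _ ->]; apply: row_set_sub.
- move=> S /sets_row[i iT ->] u v uv.
  have [h1 h2] := row_set_diameter R (tab_good iT) uv.
  have hD : ((D'%:R : R)%:E <= D%:E)%E by rewrite lee_fin truncn_le ltW.
  by split; [apply: le_trans h1 hD | apply: le_trans h2 hD].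
move=> e eG; have ees : e \in es by rewrite es_edges.2.
rewrite sum_uniform_on count_sets // size_sets.
have [l1 l2 l3] : [/\ 0 < (bits n)%:R :> R, 0 < D'%:R :> R & 0 <= (len G e)%:R :> R].
  by rewrite !ltr0n D'_gt0 ler0n.
have hc := cuts_bound ees; move: (2307 + a + b)%N hc => K hc; rewrite -(ler_nat R) !natrM in hc.
apply: le_trans (_ : (len G e)%:R / D'%:R * (K%:R * ((bits n)%:R * (bits (bits n))%:R)) <= _).
  rewrite ler_pdivrMr ?natrM ?mulr_gt0 //; apply: le_trans hc _.
  by rewrite le_eqVlt; apply/orP; left; apply/eqP; field; rewrite gt_eqF.
have hD : D <= 2 * D'%:R.
  have /andP[_ h] := truncn_itv (ltW D0); rewrite -natr1 in h.
  have : 1 <= D'%:R :> R by rewrite ler1n.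
  lra.
have hDi : D'%:R^-1 <= 2 / D by rewrite ler_pdivlMr // mulrC ler_pdivrMr.
apply: le_trans (_ : (len G e)%:R * (2 / D) * (K%:R * (3 * log R n * (7 * loglog R n))) <= _).
  apply: ler_pM.
  + by rewrite mulr_ge0 ?invr_ge0 // ltW.
  + by rewrite !mulr_ge0.
  + by rewrite ler_wpM2l.
  + apply: ler_wpM2l; first exact: ler0n.
    by apply: ler_pM; [exact: ler0n | exact: ler0n | exact: bits_le_log | exact: bits_bits_le_loglog].
by rewrite le_eqVlt; apply/orP; left; apply/eqP; rewrite natrM; field; rewrite gt_eqF.
Qed.

Lemma size_sets_le : (size sets)%:R <= 3 * (D * log R n).
Proof.
rewrite size_sets natrM mulrCA; apply: ler_pM; rewrite ?ler0n ?bits_le_log //.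
by rewrite truncn_le; apply: le_trans ler01 D_ge1.
Qed.

(** 81 is [3 ^ 4]. The exponent of [D] is raised to 4, so that [D] and the logarithm share a single
    exponent. *)
Lemma time_bound K t : (t <= K * (m.+1 * D' ^ 3 * bits n ^ 4))%N ->
  t%:R <= (81 * K)%:R * (m.+1%:R * log R n ^+ 4 * D ^+ 4).
Proof.
rewrite -(ler_nat R) => h; apply: le_trans h _.
rewrite (natrM _ K) (natrM _ (m.+1 * D' ^ 3)) (natrM _ m.+1) !natrX (natrM _ 81).
have D0 : 0 <= D by apply: le_trans ler01 D_ge1.
have hD : D'%:R <= D by rewrite truncn_le.
have h3 : D'%:R ^+ 3 <= D ^+ 4.
  apply: le_trans (_ : D ^+ 3 <= _); first by rewrite lerXn2r ?nnegrE.
  by rewrite [X in _ <= X]exprS ler_peMl // exprn_ge0.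
have h4 : (bits n)%:R ^+ 4 <= 81 * log R n ^+ 4.
  have -> : 81 * log R n ^+ 4 = (3 * log R n) ^+ 4 by ring.
  by rewrite lerXn2r ?nnegrE ?bits_le_log // mulr_ge0 // (le_trans ler01 (log_ge1 R n)).
apply: le_trans (_ : K%:R * (m.+1%:R * D ^+ 4 * (81 * log R n ^+ 4)) <= _).
  by rewrite ler_wpM2l // ler_pM ?mulr_ge0 ?exprn_ge0 // ler_wpM2l.
by rewrite le_eqVlt; apply/orP; left; apply/eqP; ring.
Qed.

End Decomposition.

Theorem theorem2p7 (R : realType) (a b : nat) :
  exists (P : cmd) (C : R) (k : nat),
  forall (n : nat) (G : digraph 'I_n) (D : R) (es : seq ('I_n * 'I_n)),
    (forall e, e \in edges G -> (len G e <= a * n ^ b)%N) ->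
    1 <= D ->
    edge_listing G es ->
    exists mu : {set 'I_n * 'I_n} -> R,
      [/\ is_LDD G D (C * (log R n * loglog R n)) mu,
          #|supp mu|%:R <= C * (D * log R n)
        & exists (Ss : seq {set 'I_n * 'I_n}) (t : nat) (M : memory),
            [/\ mu = uniform_on R Ss,
                (size Ss)%:R <= C * (D * log R n),
                exec P (input G D es) t M,
                outputs es Ss M
              & t%:R <= C * ((size es).+1%:R * log R n ^+ k * D ^+ k)]].
Proof.
(* One constant for all bounds: the first summand is for the loss, the second for the time, and the
   support only asks for [3 <= C]. *)
pose C : nat := (42 * (2307 + a + b) + 81 * time_factor a b)%N.
exists decomposition_program, C%:R, 4%N => n G D es len_le D_ge1 es_edges.
have [t [M [ex tl M4 M5 gt]]] := decomposition_output len_le D_ge1 es_edges.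
set Ss := [seq row_set es (M 5%N) i | i <- iota 0 (Num.truncn D * bits n)].
have D0 : 0 < D by apply: lt_le_trans D_ge1.
have [l0 l1] := (lt_le_trans ltr01 (log_ge1 R n), lt_le_trans ltr01 (loglog_ge1 R n)).
have sz : (size Ss)%:R <= C%:R * (D * log R n).
  apply: le_trans (size_sets_le es D_ge1 (M 5%N)) _.
  by rewrite ler_wpM2r ?(ler_nat R 3) ?mulr_ge0 ?ltW // /C; lia.
have S0 : (0 < size Ss)%N by rewrite size_map size_iota muln_gt0 truncn_gt0 D_ge1.
exists (uniform_on R Ss); split.
- have [h1 h2 h3 h4] := row_sets_LDD len_le D_ge1 M5 gt.
  split=> // e eG; apply: le_trans (h4 e eG) _.
  apply: ler_wpM2l; first by rewrite divr_ge0 // ltW.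
  apply: ler_wpM2r; first by rewrite mulr_ge0 // ltW.
  by rewrite ler_nat leq_addr.
- by apply: le_trans sz; rewrite ler_nat card_supp_uniform_on.
exists Ss, t, M; split=> //.
- exact: row_set_outputs M4.
apply: le_trans (time_bound D_ge1 tl) _.
apply: ler_wpM2r; last by rewrite ler_nat leq_addl.
by rewrite !mulr_ge0 ?exprn_ge0 // ltW.
Qed.
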